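(* Suppose Assumptions 1, 2, 3 of the context hold and let $\{x_k\}$ be generated by the ZS-BMD method described in the context for the composite problem $\min_{x\in X}\{\Phi(x)=f(x)+\chi(x)\}$. Suppose the stepsizes satisfy $0<\alpha_k\le 2/L_s$ for all $s\in\mathcal B$ and all $k$, and $$P_R(k)=\mathrm{Prob}\{R=k\}=\frac{\alpha_k\min_{s\in\mathcal B}\{p_s(1-\frac{L_s}{2}\alpha_k)\}}{\sum_{k=1}^T\alpha_k\min_{s\in\mathcal B}\{p_s(1-\frac{L_s}{2}\alpha_k)\}},\quad k=1,\dots,T$$ (the denominator being nonzero). Then $$\mathbb E\big[\|\mathcal P(x_R,\nabla f(x_R),\alpha_R)\|^2\big]\le\frac{4[\Phi_\mu(x_1)-\Phi_\mu^*]+8(\max_{s\in\mathcal B}p_s)\tilde\sigma^2\sum_{k=1}^T\frac{\alpha_k}{T_k}}{\sum_{k=1}^T\alpha_k\min_{s\in\mathcal B}\{p_s(1-\frac{L_s}{2}\alpha_k)\}}+\frac{\mu^2}{2}L_f^2(n+3)^3,$$ where $\tilde\sigma^2=4(n+4)[2M^2+\sigma^2+\mu^2L_f^2(n+4)^2]$ and the expectation is over all the randomness of the method ($R$, block indices, oracle samples and Gaussian vectors).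
   Context: Notation: $n=n_1+\dots+n_b$, $\mathcal B=\{1,\dots,b\}$, $U_s\in\mathbb R^{n\times n_s}$ with $(U_1,\dots,U_b)=I_n$; $x^{(s)}=U_s^Tx$, $\nabla_sf=U_s^T\nabla f$; $\|\cdot\|$, $\|\cdot\|_s$ are Euclidean norms on $\mathbb R^n$, $\mathbb R^{n_s}$. $X=X_1\times\cdots\times X_b$, each $X_s\subseteq\mathbb R^{n_s}$ closed convex. Problem: $\Phi=f+\chi$ with $f(x)=\mathbb E_\xi[F(x,\xi)]$ (possibly nonconvex), $\xi$ a random variable, $F$ Borel measurable and defined for all $x\in\mathbb R^n$; $\chi(x)=\sum_{s=1}^b\chi_s(x^{(s)})$ with $\chi_s:\mathbb R^{n_s}\to\mathbb R$ closed convex. $\Phi^*=\min_{x\in X}\Phi(x)$. For $\mu>0$, $f_\mu(x)=\mathbb E_u[f(x+\mu u)]$ with $u\sim N(0,I_n)$, $\Phi_\mu=f_\mu+\chi$, and $\Phi_\mu^*$ is the minimum of $\Phi_\mu$ over $X$. Assumption 1: $\mathbb E[F(x,\xi)]=f(x)$ and $\mathbb E[\nabla F(x,\xi)]=\nabla f(x)$ for all $x$, and $\mathbb E[\|\nabla F(x,\xi)-\nabla f(x)\|^2]\le\sigma^2$ for all $x\in X$. Assumption 2: almost surely in $\xi$, $\|\nabla F(x,\xi)-\nabla F(y,\xi)\|\le L_f\|x-y\|$ for all $x,y$, and for each $s\in\mathcal B$, $\|\nabla_sF(x+U_sh,\xi)-\nabla_sF(x,\xi)\|_s\le L_s\|h\|_s$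 for all $x$ and all $h\in\mathbb R^{n_s}$ ($L_f,L_s>0$). Assumption 3: $\|\nabla f(x)\|\le M$ for all $x\in X$. Generalized gradient: $\phi_s:\mathbb R^{n_s}\to\mathbb R$ is differentiable and 1-strongly convex, $D_{\phi_s}(x,y)=\phi_s(x)-\phi_s(y)-\langle\nabla\phi_s(y),x-y\rangle$. For $\alpha>0$, $P_s(x^{(s)},g^{(s)},\alpha)=\arg\min_{y\in X_s}\{\langle g^{(s)},y\rangle+\frac1\alpha D_{\phi_s}(y,x^{(s)})+\chi_s(y)\}$, $\mathcal P_s(x,g,\alpha)=\frac1\alpha[x^{(s)}-P_s(x^{(s)},g^{(s)},\alpha)]$, and $\mathcal P(x,g,\alpha)=(\mathcal P_1(x,g,\alpha),\dots,\mathcal P_b(x,g,\alpha))$. Zeroth-order gradient: $G_\mu(x,\xi,u)=\frac{F(x+\mu u,\xi)-F(x,\xi)}{\mu}u$. ZS-BMD method: given $x_1\in X$, $\mu>0$, iteration count $T$, stepsizes $\alpha_k>0$, batch sizes $T_k\ge1$, probabilities $p_s\in[0,1]$ with $\sum_sp_s=1$. Draw i.i.d. block indices $i_k$ with $\mathrm{Prob}\{i_k=s\}=p_s$ and $R\in\{1,\dots,T\}$ with probability mass function $P_R$. At step $k$ draw $u_{k,t}\sim N(0,I_n)$ and oracle samples $\xi_{k,t}$ distributed as $\xi$, $t=1,\dots,T_k$, set $G_{\mu,k}^{(i_k)}=\frac1{T_k}\sum_{t=1}^{T_k}U_{i_k}^TG_\mu(x_k,\xi_{k,t},u_{k,t})$,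 and update $x_{k+1}^{(i_k)}=P_{i_k}(x_k^{(i_k)},G_{\mu,k}^{(i_k)},\alpha_k)$, $x_{k+1}^{(s)}=x_k^{(s)}$ for $s\neq i_k$. Output $x_R$. All random quantities $i_k,\xi_{k,t},u_{k,t},R$ are mutually independent. *)

(* Defs.v *)
From HB Require Import structures.
From mathcomp Require Import all_boot all_order all_algebra.
From mathcomp Require Import all_classical all_reals all_analysis.

Set Implicit Arguments.
Unset Strict Implicit.
Unset Printing Implicit Defensive.

Import Order.TTheory GRing.Theory Num.Theory.
Import numFieldNormedType.Exports.

Local Open Scope classical_set_scope.
Local Open Scope ring_scope.

Section euclidean.
Context {R : realType} {m : nat}.
Implicit Types x y : 'cV[R]_m.

Definition dotc x y : R := \sum_i x i 0 * y i 0.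

(* The library norm on matrices is the sup norm. *)
Definition enorm x : R := Num.sqrt (dotc x x).

(* Meaningful where h is differentiable, which is always assumed separately:
   'D_v h is a total function. *)
Definition grad (h : 'cV[R]_m -> R) x : 'cV[R]_m :=
  \col_i 'D_(delta_mx i 0) h x.

Definition is_argmin (X : set 'cV[R]_m) (h : 'cV[R]_m -> R) : set 'cV[R]_m :=
  [set x | X x /\ forall y, X y -> h x <= h y].

Definition is_min (X : set 'cV[R]_m) (h : 'cV[R]_m -> R) (v : R) : Prop :=
  exists2 x, is_argmin X h x & h x = v.

Definition closed_convex (h : 'cV[R]_m -> R) : Prop :=
  closed [set z : 'cV[R]_m * R | h z.1 <= z.2] /\ convex_function setT h.

Definition strongly_convex1 (h : 'cV[R]_m -> R) : Prop :=
  forall x y (t : R), 0 <= t <= 1 ->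
    h (t *: x + (1 - t) *: y) <=
      t * h x + (1 - t) * h y - t * (1 - t) / 2 * enorm (x - y) ^+ 2.

Definition bregman (phi : 'cV[R]_m -> R) x y : R :=
  phi x - phi y - dotc (grad phi y) (x - y).

(* For X nonempty, closed and convex, chi closed convex and phi differentiable
   and 1-strongly convex, the minimizer exists and is unique; [get] picks it. *)
Definition prox (X : set 'cV[R]_m) (phi chi : 'cV[R]_m -> R)
    (x g : 'cV[R]_m) (alpha : R) : 'cV[R]_m :=
  get (is_argmin X
    (fun y => dotc g y + alpha^-1 * bregman phi y x + chi y)).

End euclidean.

Section gaussian.
Context {R : realType}.

(* R^n carries its sigma-algebra through n.-tuple R, whose library structure is
   the product of the Borel sigma-algebras; 'cV[R]_n has none. *)
Definition tcol n (t : n.-tuple R) : 'cV[R]_n := \col_i tnth t i.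

(* measurableTypeR R, where normal_prob lives, is R with its Borel sets under
   another display. *)
Definition tcons n (z : measurableTypeR R * n.-tuple R) : n.+1.-tuple R :=
  [tuple of (z.1 : R) :: z.2].

Lemma measurable_tcons n : measurable_fun setT (@tcons n).
Proof. by apply: measurable_cons => //; exact: measurable_fst. Qed.

HB.instance Definition _ n :=
  @isMeasurableFun.Build _ _ _ _ (@tcons n) (@measurable_tcons n).

(* N(0, I_n): the n-fold product of N(0, 1). *)
Fixpoint std_gaussian n : probability (n.-tuple R) R :=
  match n return probability (n.-tuple R) R with
  | 0 => dirac [tuple]
  | n'.+1 =>
      distribution (normal_prob (0 : R) 1 \x std_gaussian n')%E (@tcons n')
  end.

(* h_mu(x) = E[h(x + mu u)] with u ~ N(0, I_n). *)
Definition gsmooth n (mu : R) (h : 'cV[R]_n -> R) (x : 'cV[R]_n) : R :=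
  \int[std_gaussian n]_t h (x + mu *: tcol t).

End gaussian.

Section independence.
Context {d : measure_display} {Omega : measurableType d} {R : realType}.
Variable P : probability Omega R.

Definition mutually_independent (I : finType) (S : I -> set (set Omega)) : Prop :=
  forall (J : {set I}) (A : I -> set Omega),
    (forall j, j \in J -> S j (A j)) ->
    P (\bigcap_(j in [set` J]) A j) = (\prod_(j in J) P (A j))%E.

Definition same_law d' (T' : measurableType d')
    (Y : {RV P >-> T'}) (Q : set T' -> \bar R) : Prop :=
  forall B, measurable B -> distribution P Y B = Q B.

End independence.

Section blocks.
Context {R : realType} {b : nat}.
(* There are b.+1 >= 1 blocks, indexed by 'I_b.+1. *)
Variable n_ : 'I_b.+1 -> nat.
Local Notation n := (\sum_s n_ s)%N.

Definition Umx (s : 'I_b.+1) : 'M[R]_(n, n_ s) := submxrow 1%:M s.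

Definition blk (s : 'I_b.+1) (x : 'cV[R]_n) : 'cV[R]_(n_ s) := (Umx s)^T *m x.

Definition bmin (g : 'I_b.+1 -> R) : R := \big[Num.min/g ord0]_s g s.

Definition bmax (g : 'I_b.+1 -> R) : R := \big[Num.max/g ord0]_s g s.

Definition block_prod (X : forall s, set 'cV[R]_(n_ s)) : set 'cV[R]_n :=
  [set x | forall s, X s (blk s x)].

Definition block_sum (chi : forall s, 'cV[R]_(n_ s) -> R) (x : 'cV[R]_n) : R :=
  \sum_s chi s (blk s x).

Definition composite (f : 'cV[R]_n -> R) (chi : forall s, 'cV[R]_(n_ s) -> R)
    (x : 'cV[R]_n) : R :=
  f x + block_sum chi x.

Section oracle.
Context {d : measure_display} {Xi : measurableType d}.
Variables (Q : probability Xi R) (F : 'cV[R]_n -> Xi -> R) (f : 'cV[R]_n -> R).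

(* Each expectation is required to exist, coordinatewise for gradients. *)
Definition assumption1 (X : set 'cV[R]_n) (sigma : R) : Prop :=
  [/\ forall x, differentiable f x,
      forall x, Q.-integrable setT (EFin \o F x) /\ ('E_Q[F x] = (f x)%:E)%E,
      forall x j,
        Q.-integrable setT (fun z => (grad (F ^~ z) x j 0)%:E) /\
        ('E_Q[fun z => (grad (F ^~ z) x j 0)%R] = (grad f x j 0)%:E)%E &
      forall x, X x ->
        ('E_Q[fun z => (enorm (grad (F ^~ z) x - grad f x) ^+ 2)%R]
           <= (sigma ^+ 2)%:E)%E].

Definition assumption2 (Lf : R) (L : 'I_b.+1 -> R) : Prop :=
  {ae Q, forall z,
    [/\ forall x, differentiable (F ^~ z) x,
        forall x y, enorm (grad (F ^~ z) x - grad (F ^~ z) y)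
                      <= Lf * enorm (x - y) &
        forall s x (h : 'cV[R]_(n_ s)),
          enorm (blk s (grad (F ^~ z) (x + Umx s *m h))
                 - blk s (grad (F ^~ z) x)) <= L s * enorm h]}.

Definition assumption3 (X : set 'cV[R]_n) (M : R) : Prop :=
  forall x, X x -> enorm (grad f x) <= M.

End oracle.

Section generalized_gradient.
Variables (X : forall s, set 'cV[R]_(n_ s)).
Variables (phi chi : forall s, 'cV[R]_(n_ s) -> R).

Definition bprox (s : 'I_b.+1) (xs gs : 'cV[R]_(n_ s)) (alpha : R) :=
  prox (@X s) (@phi s) (@chi s) xs gs alpha.

Definition ggrad_blk (s : 'I_b.+1) (x g : 'cV[R]_n) (alpha : R) :
    'cV[R]_(n_ s) :=
  alpha^-1 *: (blk s x - bprox (blk s x) (blk s g) alpha).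

Definition ggrad (x g : 'cV[R]_n) (alpha : R) : 'cV[R]_n :=
  \mxcol_s ggrad_blk s x g alpha.

Section method.
Context {dX : measure_display} {Xi : measurableType dX}.
Context {d : measure_display} {Omega : measurableType d} {P : probability Omega R}.
Variables (F : 'cV[R]_n -> Xi -> R) (mu : R) (alpha : nat -> R) (N : nat -> nat).
Variables (i : nat -> Omega -> 'I_b.+1).
Variables (xi : nat -> nat -> {RV P >-> Xi}) (u : nat -> nat -> {RV P >-> n.-tuple R}).

Definition Gmu (x : 'cV[R]_n) (z : Xi) (v : 'cV[R]_n) : 'cV[R]_n :=
  ((F (x + mu *: v) z - F x z) / mu) *: v.

Definition Gbatch (k : nat) (s : 'I_b.+1) (x : 'cV[R]_n) (w : Omega) :
    'cV[R]_(n_ s) :=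
  (N k)%:R^-1 *: \sum_(t < N k) blk s (Gmu x (xi k t w) (tcol (u k t w))).

(* All sequences of the method start at index 0: iterate k here is x_(k+1), and
   likewise for alpha, N (the batch sizes), i, xi and u. *)
Fixpoint zsbmd (x1 : 'cV[R]_n) (k : nat) (w : Omega) : 'cV[R]_n :=
  match k with
  | 0 => x1
  | k'.+1 =>
      let x := zsbmd x1 k' w in
      \mxcol_s (if s == i k' w
                then bprox (blk s x) (Gbatch k' s x w) (alpha k')
                else blk s x)
  end.

End method.

End generalized_gradient.

Section randomness.
Context {dX : measure_display} {Xi : measurableType dX}.
Context {d : measure_display} {Omega : measurableType d} {P : probability Omega R}.
Variables (T : nat) (N : nat -> nat).
Variables (i : nat -> Omega -> 'I_b.+1).
Variables (xi : nat -> nat -> {RV P >-> Xi}) (u : nat -> nat -> {RV P >-> n.-tuple R}).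
Variable (rho : Omega -> 'I_T).

Definition sample_index : finType := {k : 'I_T & 'I_(N k)}.

(* The sigma-algebras generated by the block indices, the oracle samples, the
   Gaussian vectors and the output index, in this order. *)
Definition method_sigma
    (z : 'I_T + sample_index + sample_index + unit) : set (set Omega) :=
  match z with
  | inl (inl (inl k)) => preimage_set_system setT (i k) setT
  | inl (inl (inr (existT k t))) => g_sigma_algebra_preimage (xi k t)
  | inl (inr (existT k t)) => g_sigma_algebra_preimage (u k t)
  | inr tt => preimage_set_system setT rho setT
  end.

(* (xi, u, i, rho) is the randomness of a run of T steps with block
   probabilities p, oracle law Q and output law pR. *)
Definition method_randomness (Q : probability Xi R) (p : 'I_b.+1 -> R)
    (pR : 'I_T -> R) : Prop :=
  [/\ forall (k : 'I_T) s, measurable (i k @^-1` [set s]) /\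
        P (i k @^-1` [set s]) = (p s)%:E,
      forall (k : 'I_T) (t : 'I_(N k)), same_law (xi k t) Q,
      forall (k : 'I_T) (t : 'I_(N k)), same_law (u k t) (std_gaussian n),
      forall k, measurable (rho @^-1` [set k]) /\
        P (rho @^-1` [set k]) = (pR k)%:E &
      mutually_independent P method_sigma].

End randomness.

End blocks.

(* Main.v *)
(* Let g_mu be the mean of the zeroth-order gradient. By Stein's identity g_mu(x)
   is the mean of grad f (x + mu u), so f_mu satisfies the block descent inequality
   with gradient g_mu, and |g_mu - grad f|^2 <= mu^2 Lf^2 n. Gaussian moments up to
   order six bound the second moment of the zeroth-order gradient by sigmat2, so a
   batch mean g of size N_k is unbiased for g_mu with variance at most sigmat2 / N_k.

   At a fixed x, the proximal step along g and the nonexpansiveness of the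
   generalized gradient in g give, after averaging over the block index,
     E[Phi_mu(x_+)] + (w_k / 4) |P(x, grad f x, alpha_k)|^2
       <= Phi_mu(x) + (w_k / 2) mu^2 Lf^2 n + 2 alpha_k (max p) sigmat2 / N_k,
   where w_k = alpha_k min_s p_s (1 - L_s alpha_k / 2): the term linear in g - g_mu
   has mean zero and the quadratic one is the variance. The iterate x_k is a
   function of the sources of the steps before k, which are independent of those
   of step k, so x may be replaced by x_k. Summing over k telescopes, and as R is
   independent of the run and takes the value k with probability w_k / sum w, the
   left-hand sides add up to the expectation at x_R; finally 2 n <= (n + 3)^3 / 2. *)

Require Import Defs.
From HB Require Import structures.
From mathcomp Require Import all_boot all_order all_algebra.
From mathcomp Require Import all_classical all_reals all_analysis.
From mathcomp Require Import measurable_realfun ring lra.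

Set Implicit Arguments.
Unset Strict Implicit.
Unset Printing Implicit Defensive.

Import Order.TTheory GRing.Theory Num.Theory.
Import numFieldNormedType.Exports.

Local Open Scope classical_set_scope.
Local Open Scope ring_scope.

(** * Euclidean geometry of column vectors *)

(** The noise [g - g_mu] and the proximal step along [g] come from the same sample, so their inner
    product is not centred. Replacing that step by the one along [g_mu] costs only [|g - g_mu|^2].
    This accounts for half of the factor 2 in the noise term; passing from P(x, g) to P(x, grad f)
    gives the other half. The mean gap of [Phi_mu] along the run is not known to be finite
    beforehand. Integrals over the run are therefore taken of nonnegative functions in the extended
    reals, and nothing is subtracted from them; integrability is used only at a fixed point x.
    Iterates are defined by a choice of minimizer, so their measurability has to be earned: the
    proximal point is a Lipschitz function of the single vector [g - grad phi x / alpha].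
    Independence is given as a product formula on events. It is extended to generated
    sigma-algebras, and freezing the iterate becomes Tonelli for the law of [w |-> (w, w)]. The
    Lipschitz bounds are assumed for almost every sample of [F]; those for [f] are recovered by
    testing the mean difference of gradients against itself. *)

Section dotc_theory.
Context {R : realType} {m : nat}.
Implicit Types (x y z : 'cV[R]_m) (a : R).

Lemma dotcC x y : dotc x y = dotc y x.
Proof. by apply: eq_bigr => j _; rewrite mulrC. Qed.

Lemma dotcDl x y z : dotc (x + y) z = dotc x z + dotc y z.
Proof. by rewrite -big_split; apply: eq_bigr => j _; rewrite mxE mulrDl. Qed.

Lemma dotcZl a x z : dotc (a *: x) z = a * dotc x z.
Proof. by rewrite mulr_sumr; apply: eq_bigr => j _; rewrite mxE mulrA. Qed.

Lemma dotcNl x z : dotc (- x) z = - dotc x z.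
Proof. by rewrite -scaleN1r dotcZl mulN1r. Qed.

Lemma dotcBl x y z : dotc (x - y) z = dotc x z - dotc y z.
Proof. by rewrite dotcDl dotcNl. Qed.

Lemma dotcDr x y z : dotc z (x + y) = dotc z x + dotc z y.
Proof. by rewrite dotcC dotcDl !(dotcC _ z). Qed.

Lemma dotcZr a x z : dotc z (a *: x) = a * dotc z x.
Proof. by rewrite dotcC dotcZl dotcC. Qed.

Lemma dotcNr x z : dotc z (- x) = - dotc z x.
Proof. by rewrite dotcC dotcNl dotcC. Qed.

Lemma dotcBr x y z : dotc z (x - y) = dotc z x - dotc z y.
Proof. by rewrite dotcDr dotcNr. Qed.

Lemma dotc0l x : dotc 0 x = 0.
Proof. by rewrite -(scale0r 0) dotcZl mul0r. Qed.

Lemma dotc0r x : dotc x 0 = 0.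
Proof. by rewrite dotcC dotc0l. Qed.

Lemma dotc_ge0 x : 0 <= dotc x x.
Proof. by apply: sumr_ge0 => j _; rewrite -expr2 sqr_ge0. Qed.

Lemma enorm_ge0 x : 0 <= enorm x.
Proof. exact: sqrtr_ge0. Qed.

Lemma sqr_enorm x : enorm x ^+ 2 = dotc x x.
Proof. by rewrite sqr_sqrtr// dotc_ge0. Qed.

Lemma sqr_enormE x : enorm x ^+ 2 = \sum_j x j 0 ^+ 2.
Proof. by rewrite sqr_enorm; apply: eq_bigr => j _; rewrite expr2. Qed.

Lemma enorm0 : enorm (0 : 'cV[R]_m) = 0.
Proof. by rewrite /enorm dotc0l sqrtr0. Qed.

Lemma enormN x : enorm (- x) = enorm x.
Proof. by rewrite /enorm dotcNl dotcNr opprK. Qed.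

Lemma enormZ a x : enorm (a *: x) = `|a| * enorm x.
Proof.
by rewrite /enorm dotcZl dotcZr mulrA -expr2 sqrtrM ?sqr_ge0// sqrtr_sqr.
Qed.

Lemma enormBC x y : enorm (x - y) = enorm (y - x).
Proof. by rewrite -enormN opprB. Qed.

Lemma coord_le_enorm x j : `|x j 0| <= enorm x.
Proof.
rewrite -sqrtr_sqr ler_wsqrtr// /dotc (bigD1 j)//= -expr2 lerDl sumr_ge0// => i _.
by rewrite -expr2 sqr_ge0.
Qed.

Lemma enorm_eq0 x : enorm x = 0 -> x = 0.
Proof.
move=> x0; apply/matrixP => j k; rewrite ord1 mxE.
by have := coord_le_enorm x j; rewrite x0 normr_le0 => /eqP.
Qed.

(** Cauchy-Schwarz: the squared norm of [enorm y *: x - enorm x *: y] equals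
    [2 |x| |y| (|x| |y| - <x, y>)], and both norms may be taken positive. *)
Lemma dotc_le_enorm x y : dotc x y <= enorm x * enorm y.
Proof.
have [x0|x0] := eqVneq (enorm x) 0.
  by rewrite (enorm_eq0 x0) dotc0l enorm0 mul0r.
have [y0|y0] := eqVneq (enorm y) 0.
  by rewrite (enorm_eq0 y0) dotc0r enorm0 mulr0.
have := dotc_ge0 (enorm y *: x - enorm x *: y).
rewrite !(dotcBl, dotcBr, dotcZl, dotcZr) -!sqr_enorm (dotcC y x) => h.
have {x0}x0 : 0 < enorm x by rewrite lt_neqAle eq_sym x0 enorm_ge0.
have {y0}y0 : 0 < enorm y by rewrite lt_neqAle eq_sym y0 enorm_ge0.
have xy0 := mulr_gt0 x0 y0.
suff : 0 <= 2 * (enorm x * enorm y) * (enorm x * enorm y - dotc x y).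
  by rewrite pmulr_rge0 ?subr_ge0// mulr_gt0.
by apply: le_trans h _; rewrite le_eqVlt; apply/orP; left; apply/eqP; ring.
Qed.

Lemma normr_dotc x y : `|dotc x y| <= enorm x * enorm y.
Proof.
by rewrite ler_norml dotc_le_enorm lerNl -dotcNl (le_trans (dotc_le_enorm _ _))// enormN.
Qed.

Lemma dotc_le_sqr x y : dotc x y <= enorm x ^+ 2 / 2 + enorm y ^+ 2 / 2.
Proof.
have := dotc_ge0 (x - y); rewrite !(dotcBl, dotcBr) -!sqr_enorm (dotcC y x).
by lra.
Qed.

Lemma sqr_enormD x y : enorm (x + y) ^+ 2 = enorm x ^+ 2 + 2 * dotc x y + enorm y ^+ 2.
Proof. by rewrite !sqr_enorm !(dotcDl, dotcDr) (dotcC y x); ring. Qed.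

Lemma sqr_enormD_le x y : enorm (x + y) ^+ 2 <= 2 * enorm x ^+ 2 + 2 * enorm y ^+ 2.
Proof. by rewrite sqr_enormD; have := dotc_le_sqr x y; lra. Qed.

Lemma ler_enormD x y : enorm (x + y) <= enorm x + enorm y.
Proof.
rewrite -(@ler_pXn2r _ 2) ?nnegrE ?addr_ge0 ?enorm_ge0//.
by rewrite sqr_enormD; have := dotc_le_enorm x y; lra.
Qed.

Lemma delta_dotc j x : dotc (delta_mx j 0) x = x j 0.
Proof.
rewrite /dotc (bigD1 j)//= mxE !eqxx mul1r big1 ?addr0// => i ij.
by rewrite mxE (negbTE ij) mul0r.
Qed.

Lemma cvE x : x = \sum_j x j 0 *: delta_mx j 0.
Proof.
apply/matrixP => i k; rewrite ord1 summxE (bigD1 i)//= !mxE !eqxx mulr1 big1 ?addr0// => j ij.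
by rewrite !mxE eq_sym (negbTE ij) mulr0.
Qed.

Lemma normr_le_enorm x : `|x| <= enorm x.
Proof.
rewrite {1}/Num.norm/= mx_normrE; apply/bigmax_leP; split; first exact: enorm_ge0.
by move=> [j k] _ /=; rewrite ord1 coord_le_enorm.
Qed.

Lemma continuous_dotc x : continuous (dotc x).
Proof.
apply: (@continuous_big R^o _ +%R 0 xpredT _ 'cV[R]_m _ (fun j y => x j 0 * y j 0)).
  exact: (@add_continuous R^o).
by move=> j _ y; apply: continuousM; [exact: cst_continuous|exact: coord_continuous].
Qed.

Lemma continuous_dotc2 : continuous (fun x => dotc x x).
Proof.
apply: (@continuous_big R^o _ +%R 0 xpredT _ 'cV[R]_m _ (fun j y => y j 0 * y j 0)).
  exact: (@add_continuous R^o).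
by move=> j _ y; apply: continuousM; exact: coord_continuous.
Qed.

Lemma continuous_enorm : continuous (@enorm R m).
Proof.
move=> x; apply: (cvg_comp (fun z => dotc z z) Num.sqrt); first exact: continuous_dotc2.
exact: sqrt_continuous.
Qed.

Lemma is_derive_dotc x y v : is_derive y v (dotc x) (dotc x v).
Proof.
have lx : linear (dotc x : _ -> R^o) by move=> a u w; rewrite dotcDr dotcZr.
pose L := GRing.isLinear.Build _ _ _ _ (dotc x : _ -> R^o) lx.
pose dl : {linear 'cV[R]_m -> R^o} := HB.pack (dotc x : _ -> R^o) L.
have df : differentiable (dl : _ -> R^o) y by apply: linear_differentiable; exact: continuous_dotc.
apply: DeriveDef; first exact: diff_derivable.
by rewrite deriveE// (_ : dotc x = dl)// diff_lin//; exact: continuous_dotc.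
Qed.

End dotc_theory.

Lemma dotcE {R : realType} {n : nat} (x y : 'cV[R]_n) : dotc x y = (x^T *m y) 0 0.
Proof. by rewrite mxE; apply: eq_bigr => j _; rewrite mxE. Qed.

Lemma dotc_mulmx {R : realType} {k n : nat} (A : 'M[R]_(k, n)) (x : 'cV[R]_n) (y : 'cV[R]_k) :
  dotc (A *m x) y = dotc x (A^T *m y).
Proof. by rewrite !dotcE trmx_mul mulmxA. Qed.

(** * Quadratic bounds from a Lipschitz gradient *)

Lemma nonexpansive_continuous {R : realType} (V W : normedModType R) (f : V -> W) :
  (forall x y, `|f x - f y| <= `|x - y|) -> continuous f.
Proof.
move=> fe x; apply/cvgrPdist_lt => e e0; near=> y.
apply: le_lt_trans (fe _ _) _; near: y.
by apply/nbhs_ballP; exists e => //= y; rewrite -ball_normE.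
Unshelve. all: by end_near. Qed.

(** The modulus may depend on the base point [x] and is only asked to be continuous at [x]. This
    covers bounds whose constant varies with [x], as for [gsmooth], besides the Lipschitz ones. *)
Lemma dominated_continuous {R : realType} (T : topologicalType) (f : T -> R)
    (k : T -> T -> R) :
  (forall x, {for x, continuous (k x)}) -> (forall x, k x x = 0) ->
  (forall x y, `|f x - f y| <= k x y) -> continuous f.
Proof.
move=> kc k0 fk x; apply/cvgrPdist_lt => e e0.
have /cvgrPdist_lt/(_ e e0) := kc x; apply: filterS => y.
rewrite k0 sub0r normrN => /(le_lt_trans (ler_norm _)).
exact/le_lt_trans/fk.
Qed.

Section gradient_line.
Context {R : realType} {m : nat}.
Implicit Types (x y v : 'cV[R]_m) (h : 'cV[R]_m -> R).

Lemma is_derive_grad h x v : differentiable h x -> is_derive x v h (dotc (grad h x) v).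
Proof.
move=> dh; apply: DeriveDef; first exact: diff_derivable.
rewrite deriveE// {1}(cvE v) linear_sum /dotc; apply: eq_bigr => j _.
by rewrite linearZ mxE deriveE// mulrC.
Qed.

Lemma is_derive_line h x v (t : R) d :
  is_derive (x + t *: v) v h d -> is_derive t 1 (fun s : R => h (x + s *: v)) d.
Proof.
move=> [dh hd].
have E : (fun s : R => s^-1 *: (((fun s => h (x + s *: v)) \o shift t) (s *: 1) - h (x + t *: v)))
       = (fun s : R => s^-1 *: ((h \o shift (x + t *: v)) (s *: v) - h (x + t *: v))).
  apply/funext => s /=; congr (_ *: (h _ - _)).
  by rewrite [s *: 1]mulr1 scalerDl addrCA.
apply: DeriveDef; first by rewrite /derivable E.
by rewrite /derive E.
Qed.

(** Subtracting from [g] a primitive of the bound [dg 0 + c * t] leaves a function with nonpositive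
    derivative on the unit interval. *)
Lemma le_line_quad (g dg : R -> R) (c : R) :
  (forall t : R, is_derive t 1 g (dg t)) ->
  (forall t : R, 0 <= t <= 1 -> dg t <= dg 0 + c * t) ->
  g 1 <= g 0 + dg 0 + c / 2.
Proof.
move=> gd le; pose k := fun t : R => g t - (dg 0 * t + c / 2 * t ^+ 2).
have kd (t : R) : is_derive t 1 k (dg t - (dg 0 + c * t)).
  have := gd t => gdt; apply: is_derive_eq.
  by rewrite /GRing.scale/=; field.
suff : k 1 <= k 0 by rewrite /k; lra.
have kc : continuous k.
  move=> t; have [dk _] := kd t.
  apply: (@differentiable_continuous R R R t k). apply/derivable1_diffP. exact: dk.
apply: (@ler0_derive1_nincr R k 0 1 _ _ _ 0 1) => //.
- move=> t; rewrite in_itv/= => /andP[t0 t1]; rewrite derive1E.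
  have [_ ->] := kd t; rewrite subr_le0; apply: le; lra.
- exact: continuous_subspaceT.
Qed.

(** The hypothesis is restricted to one segment in direction [v], so the lemma serves both the
    constant [Lf] and, along a block direction, the constant [L s]. *)
Lemma le_grad_quad h x v c : (forall y, differentiable h y) ->
  (forall t : R, 0 <= t <= 1 -> dotc (grad h (x + t *: v) - grad h x) v <= c * t) ->
  h (x + v) <= h x + dotc (grad h x) v + c / 2.
Proof.
move=> dh le.
have := @le_line_quad (fun t => h (x + t *: v)) (fun t => dotc (grad h (x + t *: v)) v) c.
rewrite scale1r scale0r addr0; apply.
  by move=> t; exact/is_derive_line/is_derive_grad.
by move=> t t01; have := le t t01; rewrite dotcBl; lra.
Qed.

Lemma ge_grad_quad h x v c : (forall y, differentiable h y) ->
  (forall t : R, 0 <= t <= 1 -> - (c * t) <= dotc (grad h (x + t *: v) - grad h x) v) ->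
  h x + dotc (grad h x) v - c / 2 <= h (x + v).
Proof.
move=> dh le.
have := @le_line_quad (fun t => - h (x + t *: v)) (fun t => - dotc (grad h (x + t *: v)) v) c.
rewrite scale1r scale0r addr0 => H.
suff : - h (x + v) <= - h x + - dotc (grad h x) v + c / 2 by lra.
apply: H.
  by move=> t; apply: is_deriveN; exact/is_derive_line/is_derive_grad.
by move=> t t01; have := le t t01; rewrite dotcBl; lra.
Qed.

Lemma lip_grad_quad h x v L : (forall y, differentiable h y) ->
  (forall y z, enorm (grad h y - grad h z) <= L * enorm (y - z)) ->
  `|h (x + v) - h x - dotc (grad h x) v| <= L / 2 * enorm v ^+ 2.
Proof.
move=> dh Lh.
have B t : 0 <= t <= 1 ->
    `|dotc (grad h (x + t *: v) - grad h x) v| <= L * enorm v ^+ 2 * t.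
  move=> /andP[t0 _]; apply: le_trans (normr_dotc _ _) _.
  rewrite expr2 mulrA mulrAC ler_wpM2r ?enorm_ge0//.
  apply: le_trans (Lh _ _) _.
  by rewrite addrC addKr enormZ (ger0_norm t0) mulrA mulrAC.
have h1 : h (x + v) <= h x + dotc (grad h x) v + L * enorm v ^+ 2 / 2.
  by apply: le_grad_quad => // t /B; rewrite ler_norml => /andP[].
have h2 : h x + dotc (grad h x) v - L * enorm v ^+ 2 / 2 <= h (x + v).
  by apply: ge_grad_quad => // t /B; rewrite ler_norml => /andP[].
rewrite ler_norml; lra.
Qed.

Lemma lip_grad_continuous h L :
  (forall y z, enorm (grad h y - grad h z) <= L * enorm (y - z)) ->
  forall v, continuous (fun y => dotc (grad h y) v).
Proof.
move=> Lh v; apply: (@dominated_continuous _ _ _ (fun x y => (L * enorm v) * enorm (x - y))).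
- move=> x; apply: continuousM; first exact: cst_continuous.
  apply: continuous_comp; last exact: continuous_enorm.
  by apply: continuousB; [exact: cst_continuous|by move=> ?].
- by move=> x; rewrite subrr enorm0 mulr0.
move=> x y; rewrite -dotcBl; apply: le_trans (normr_dotc _ _) _.
by rewrite mulrAC ler_wpM2r ?enorm_ge0.
Qed.

End gradient_line.

(** * Compactness and existence of minimizers *)

Section argmin_existence.
Context {R : realType} {m : nat}.
Implicit Types (x y v : 'cV[R]_m) (h : 'cV[R]_m -> R) (X : set 'cV[R]_m).

(** Bounded closed sets of row vectors are compact; [X] is the image of such a set under
    transposition, which is nonexpansive for the sup norm. *)
Lemma bounded_closed_compact_cv X (M : R) :
  closed X -> (forall x, X x -> enorm x <= M) -> compact X.
Proof.
move=> cX bX.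
have trc p q : continuous (@trmx R p q).
  apply: nonexpansive_continuous => x y; rewrite -linearB /=.
  rewrite {1}/Num.norm/= mx_normrE; apply/bigmax_leP; split => // -[i j] _ /=.
  rewrite !mxE /= {2}/Num.norm/= mx_normrE; apply/bigmax_geP; right.
  by exists (j, i) => //; rewrite !mxE.
have -> : X = (@trmx R 1 m) @` [set y : 'rV[R]_m | X y^T].
  apply/seteqP; split => [x Xx|_ [y Xy <-]//].
  by exists x^T; rewrite /= ?trmxK.
apply: continuous_compact; first exact/continuous_subspaceT/trc.
apply: bounded_closed_compact.
  exists M; split; first exact: num_real.
  move=> B MB y /= /bX yM; apply: (le_trans _ (ltW MB)).
  apply: le_trans yM; apply: le_trans (normr_le_enorm _).
  rewrite /Num.norm/= !mx_normrE; apply/bigmax_leP; split.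
    by apply/bigmax_geP; left.
  move=> [i j] _ /=; apply/bigmax_geP; right.
  by exists (j, i) => //; rewrite mxE.
by apply: preimage_closed => // ? _; exact: trc.
Qed.

(** Without a minimizer, the open sets [h y < h x] with [y] in [X] cover [X]. In a finite subcover,
    the centre with the least value of [h] lies in no member. *)
Lemma lsc_compact_argmin X h : compact X -> X !=set0 ->
  (forall a, closed [set x | h x <= a]) -> is_argmin X h !=set0.
Proof.
move=> cX [x0 Xx0] lsc; apply: contrapT => no.
have H x : X x -> exists2 y, X y & h y < h x.
  move=> Xx; apply: contrapT => H; apply: no; exists x; split => // y Xy.
  by rewrite leNgt; apply/negP => yx; apply: H; exists y.
move: cX; rewrite compact_cover => /(_ _ X (fun y => [set x | h y < h x])) [].
- move=> y _; rewrite (_ : mkset _ = ~` [set x | h x <= h y]) ?openC//.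
  by apply/seteqP; split => x /=; [rewrite ltNge => /negP|move=> /negP; rewrite -ltNge].
- by move=> x /H [y Xy yx]; exists y.
move=> D DX Xcov; have [y0 Dy0 _] := Xcov _ Xx0.
pose s : seq 'cV[R]_m := finmap.enum_fset D.
have Ds0 : (index y0 s < size s)%N by rewrite index_mem.
pose i0 := Ordinal Ds0.
case: (arg_minP (fun i : 'I_(size s) => h (nth y0 s i)) (isT : xpredT i0)) => i _ imin.
have Di : nth y0 s i \in s by rewrite mem_nth.
have /Xcov[z Dz /=] : X (nth y0 s i) by apply/set_mem/DX.
have zs : (index z s < size s)%N by rewrite index_mem.
by have := imin (Ordinal zs) isT; rewrite /= nth_index// leNgt => /negP.
Qed.

End argmin_existence.

(** * Strong convexity and proximal maps *)

Section strong_convexity.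
Context {R : realType} {m : nat}.
Implicit Types (x y v g : 'cV[R]_m) (h phi chi : 'cV[R]_m -> R) (X : set 'cV[R]_m).

Definition segment_closed X :=
  forall x y (t : R), X x -> X y -> 0 <= t <= 1 -> X (t *: x + (1 - t) *: y).

(** The modulus is a parameter, with [c = 0] for convexity, so that the moduli of the three terms of
    the proximal objective add up. *)
Definition strongly_convex (c : R) h :=
  forall x y (t : R), 0 <= t <= 1 ->
    h (t *: x + (1 - t) *: y) <=
      t * h x + (1 - t) * h y - c * (t * (1 - t) / 2) * enorm (x - y) ^+ 2.

Lemma convex_set_segment X : convex_set X -> segment_closed X.
Proof.
move=> cX x y t Xx Xy /andP[t0 t1]; apply/set_mem.
exact: (cX x y (Itv01 t0 t1) (mem_set Xx) (mem_set Xy)).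
Qed.

Lemma closed_convex_strongly chi : closed_convex chi -> strongly_convex 0 chi.
Proof.
move=> [_ cchi] x y t /andP[t0 t1]; rewrite !mul0r subr0.
exact: (cchi (Itv01 t0 t1) x y (in_setT _) (in_setT _)).
Qed.

Lemma strongly_convex1_strongly phi : strongly_convex1 phi -> strongly_convex 1 phi.
Proof. by move=> sc x y t t01; rewrite mul1r; exact: sc. Qed.

Lemma strongly_convex_dotc v : strongly_convex 0 (dotc v).
Proof. by move=> x y t _; rewrite !mul0r subr0 dotcDr !dotcZr. Qed.

Lemma strongly_convexD a b h k : strongly_convex a h -> strongly_convex b k ->
  strongly_convex (a + b) (fun x => h x + k x).
Proof. by move=> sh sk x y t t01; have := sh x y t t01; have := sk x y t t01; lra. Qed.

Lemma strongly_convexZ a b h : 0 <= b -> strongly_convex a h ->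
  strongly_convex (b * a) (fun x => b * h x).
Proof.
move=> b0 sh x y t t01; have := ler_wpM2l b0 (sh x y t t01).
by rewrite !mulrDr mulrN !mulrA ![b * t]mulrC ![b * (1 - t)]mulrC.
Qed.

(* If y is far from x0, the value at distance 1 on the segment from x0 to y is
   at least the minimum over the unit ball around x0, and strong convexity then
   forces h x0 <= h y. Hence a minimizer over a large ball is global. *)
Lemma strongly_convex_argmin_ex c h X : 0 < c -> strongly_convex c h ->
  (forall a, closed [set x | h x <= a]) ->
  closed X -> segment_closed X -> X !=set0 -> is_argmin X h !=set0.
Proof.
move=> c0 sh lsc cX sX [x0 Xx0].
have cball r : closed [set x | enorm (x - x0) <= r].
  rewrite (_ : mkset _ = (fun x => enorm (x - x0)) @^-1` [set z | z <= r])//.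
  apply: preimage_closed; last exact: closed_le.
  move=> x _; apply: continuous_comp; last exact: continuous_enorm.
  by apply: continuousB; [move=> ?|exact: cst_continuous].
pose K r := X `&` [set x | enorm (x - x0) <= r].
have cK r : compact (K r).
  apply: (@bounded_closed_compact_cv _ _ _ (r + enorm x0)).
    exact: closedI.
  move=> x [_ /= xr]; rewrite -[x](subrK x0).
  by apply: le_trans (ler_enormD _ _) _; rewrite lerD2r.
have K0 r : 0 <= r -> K r x0 by move=> r0; split => //=; rewrite subrr enorm0.
have [|z0 [Kz0 z0min]] := @lsc_compact_argmin _ _ (K 1) h (cK 1) _ lsc.
  by exists x0; exact: K0.
pose D := h x0 - h z0.
have D0 : 0 <= D by rewrite subr_ge0 z0min//; exact: K0.
(* At distance [r] from [x0], strong convexity gives [h y >= h x0 + r * (c * (r - 1) / 2 - D)]; the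
   bracket is nonnegative once [r >= B]. *)
pose B := 1 + 2 * D / c.
have B1 : 1 <= B by rewrite lerDl divr_ge0 ?mulr_ge0// ltW.
have [|z [[Xz _] zmin]] := @lsc_compact_argmin _ _ (K B) h (cK B) _ lsc.
  by exists x0; apply: K0; lra.
exists z; split => // y Xy.
have [yB|yB] := leP (enorm (y - x0)) B; first exact: zmin.
have zx0 : h z <= h x0 := zmin _ (K0 B (le_trans ler01 B1)).
apply: le_trans zx0 _.
set r := enorm (y - x0) in yB *.
have r1 : 1 < r by lra.
have r0 : 0 < r by lra.
have rV01 : 0 <= r^-1 <= 1 by rewrite invr_ge0 ltW//= invf_le1// ltW.
have := sh y x0 r^-1 rV01; rewrite -/r.
have : h z0 <= h (r^-1 *: y + (1 - r^-1) *: x0).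
  apply: z0min; split; first exact: sX.
  rewrite /= scalerBl scale1r [x0 - _]addrC addrA addrK -scalerBr enormZ -/r.
  by rewrite gtr0_norm ?invr_gt0// mulVf// gt_eqF.
move=> /le_trans/[apply].
rewrite -(ler_pM2l r0); set w := r^-1.
have -> : r * (w * h y + (1 - w) * h x0 - c * (w * (1 - w) / 2) * r ^+ 2) =
          h y + (r - 1) * h x0 - c * ((r - 1) / 2) * r.
  by rewrite /w; field; rewrite gt_eqF.
move=> le.
have : 0 <= r * (c * (r - 1) / 2 - D).
  apply: mulr_ge0; first exact: ltW.
  have : 2 * D < (r - 1) * c by rewrite -ltr_pdivrMr//; move: yB; rewrite /B; lra.
  lra.
move: le; rewrite /D; lra.
Qed.

(** Moving from [z] towards [y] by a fraction [t], minimality and strong convexity give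
    [(1 - t) * A <= h y - h z], where [A] is the quadratic term; the claim is the limit at
    [t = 0]. *)
Lemma strongly_convex_argmin_gap c h X z y : strongly_convex c h -> segment_closed X ->
  is_argmin X h z -> X y -> h z + c / 2 * enorm (y - z) ^+ 2 <= h y.
Proof.
move=> sh sX [Xz zmin] Xy.
set A := c / 2 * _; have hzy := zmin _ Xy.
rewrite leNgt; apply/negP => lt.
pose e := A - (h y - h z); have e0 : 0 < e by rewrite /e; lra.
have A0 : 0 < A by rewrite /e in e0; lra.
(* With a deficit [e], this fraction makes [- e + t * A = - e / 2] negative, so no limit has to be
   taken. *)
pose t := e / (2 * A).
have A2 : 0 < 2 * A by lra.
have t0 : 0 < t by rewrite divr_gt0.
have t1 : t <= 1 by rewrite ler_pdivrMr// /e; lra.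
have t01 : 0 <= t <= 1 by rewrite ltW.
have := le_trans (zmin _ (sX _ _ _ Xy Xz t01)) (sh y z t t01).
have -> : c * (t * (1 - t) / 2) * enorm (y - z) ^+ 2 = t * (1 - t) * A by rewrite /A; lra.
move=> le; have {le} : 0 <= t * (h y - h z - (1 - t) * A) by lra.
rewrite pmulr_rge0//.
have -> : h y - h z - (1 - t) * A = - e + t * A by rewrite /e; lra.
have -> : t * A = e / 2 by rewrite /t; field; rewrite gt_eqF.
lra.
Qed.

(** Strong convexity on the segment says that [k] is nonpositive on the unit interval. Since
    [k 0 = 0], its derivative at 0 is nonpositive, and this is the claim. *)
Lemma bregman_ge phi x y : strongly_convex 1 phi -> differentiable phi x ->
  enorm (y - x) ^+ 2 / 2 <= bregman phi y x.
Proof.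
move=> sp dp; rewrite /bregman; set D := enorm _ ^+ 2; set v := y - x.
pose k (t : R) := phi (x + t *: v) - (phi x + t * (phi y - phi x) - t * (1 - t) / 2 * D).
have kle (t : R) : 0 <= t <= 1 -> k t <= 0.
  move=> t01; have := sp y x t t01; rewrite -/D /k mul1r.
  have -> : t *: y + (1 - t) *: x = x + t *: v.
    by rewrite /v scalerBr scalerBl scale1r addrC -!addrA; congr (_ + _); rewrite addrC.
  lra.
have kd : is_derive (0 : R) (1 : R) k (dotc (grad phi x) v - (phi y - phi x) + D / 2).
  have d1 : is_derive (0 : R) (1 : R) (fun t : R => phi (x + t *: v)) (dotc (grad phi x) v).
    by apply: is_derive_line; rewrite scale0r addr0; exact: is_derive_grad.
  rewrite /k; apply: is_derive_eq.
  by rewrite /GRing.scale/=; field.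
suff : dotc (grad phi x) v - (phi y - phi x) + D / 2 <= 0 by lra.
have [dk <-] := kd.
have k0 : k 0 = 0 by rewrite /k scale0r addr0; lra.
rewrite leNgt; apply/negP => d0.
have /cvgr_gt/(_ _ d0) := dk => /nbhs_ballP[e /= e0 He].
pose t := Order.min (e / 2) 1.
have t0 : 0 < t by rewrite lt_min ltr01 divr_gt0.
have te : ball 0 e t.
  rewrite /ball/= sub0r normrN gtr0_norm// (@le_lt_trans _ _ (e / 2))//.
    by rewrite ge_min lexx.
  by rewrite ltr_pdivrMr// ltr_pMr// ltr1n.
have := He t te (lt0r_neq0 t0).
rewrite /= [t *: 1]mulr1 addr0 k0 subr0 pmulr_rgt0 ?invr_gt0// ltNge kle//.
by rewrite ltW//= ge_min lexx orbT.
Qed.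

End strong_convexity.

Lemma continuous_pairing (T U V : topologicalType) (f : T -> U) (g : T -> V) :
  continuous f -> continuous g -> continuous (fun x => (f x, g x)).
Proof. by move=> cf cg x; apply: cvg_pair; [exact: cf|exact: cg]. Qed.

(** * The proximal map: Lipschitz dependence and descent *)

Section prox_theory.
Context {R : realType} {m : nat}.
Variables (X : set 'cV[R]_m) (phi chi : 'cV[R]_m -> R) (alpha : R).
Hypotheses (cX : closed X) (sX : segment_closed X) (X0 : X !=set0).
Hypotheses (cchi : closed_convex chi) (dphi : forall y, differentiable phi y).
Hypotheses (sphi : strongly_convex1 phi) (alpha0 : 0 < alpha).
Implicit Types x y v w g : 'cV[R]_m.

(** The proximal objective up to a constant: the centre [x] and the direction [g] enter only through
    the linear form [v = g - alpha^-1 *: grad phi x]. *)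
Definition prox_obj v y := dotc v y + alpha^-1 * phi y + chi y.

Definition prox_lin v := get (is_argmin X (prox_obj v)).

(** The two objectives differ by a constant, so they have the same set of minimizers and [get]
    returns the same point. Lipschitz bounds and measurability of [prox] are then read off
    [prox_lin]. *)
Lemma proxE x g : prox X phi chi x g alpha = prox_lin (g - alpha^-1 *: grad phi x).
Proof.
rewrite /prox /prox_lin; congr get; apply/seteqP.
have E y : dotc g y + alpha^-1 * bregman phi y x + chi y =
    prox_obj (g - alpha^-1 *: grad phi x) y
    + (alpha^-1 * (dotc (grad phi x) x - phi x)).
  by rewrite /bregman /prox_obj dotcBl dotcZl dotcBr; ring.
by split => z [Xz zmin]; split => // y Xy; have := zmin y Xy; rewrite !E lerD2r.
Qed.

Let strongly_convex_obj v : strongly_convex alpha^-1 (prox_obj v).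
Proof.
rewrite (_ : alpha^-1 = 0 + alpha^-1 * 1 + 0); last by rewrite addr0 add0r mulr1.
apply: strongly_convexD; last exact: closed_convex_strongly.
apply: strongly_convexD; first exact: strongly_convex_dotc.
apply: strongly_convexZ; last exact: strongly_convex1_strongly.
by rewrite invr_ge0 ltW.
Qed.

(** The sublevel set is the preimage of the closed epigraph of [chi] under a continuous map, since
    the other terms are continuous and can be moved to the right-hand side. *)
Let closed_obj v (a : R) : closed [set y | prox_obj v y <= a].
Proof.
rewrite (_ : mkset _ = (fun y => (y, a - (dotc v y + alpha^-1 * phi y))) @^-1`
  [set z : 'cV[R]_m * R | chi z.1 <= z.2]); last first.
  by apply/seteqP; split => y /=; rewrite /prox_obj lerBrDl.
apply: preimage_closed; last by case: cchi.
have c1 : continuous (fun y => alpha^-1 * phi y).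
  move=> y; apply: (@continuousM R _ (fun=> alpha^-1) phi y); first exact: cst_continuous.
  by apply: (@differentiable_continuous R _ R^o y phi); exact: dphi.
have c2 : continuous (fun y => dotc v y + alpha^-1 * phi y).
  by move=> y; apply: (@continuousD R R^o); [exact: continuous_dotc|exact: c1].
have c3 : continuous (fun y => a - (dotc v y + alpha^-1 * phi y)).
  by move=> y; apply: (@continuousB R R^o _ (fun=> a) (fun y => dotc v y + alpha^-1 * phi y)); [exact: cst_continuous|exact: c2].
by move=> y _; apply: continuous_pairing => // ?.
Qed.

Lemma prox_lin_argmin v : is_argmin X (prox_obj v) (prox_lin v).
Proof.
have [] := @strongly_convex_argmin_ex R m alpha^-1 (prox_obj v) X _
  (strongly_convex_obj v) (@closed_obj v) cX sX X0; first by rewrite invr_gt0.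
by move=> z; exact: getI.
Qed.

(** Adding the strong convexity gaps of the two minimizers, each tested at the other, leaves
    [alpha^-1 * d ^+ 2 <= <v - w, yw - yv>]; Cauchy-Schwarz concludes. *)
Lemma prox_lin_lipschitz v w :
  enorm (prox_lin v - prox_lin w) <= alpha * enorm (v - w).
Proof.
have [Xv _] := prox_lin_argmin v; have [Xw _] := prox_lin_argmin w.
have := strongly_convex_argmin_gap (strongly_convex_obj v) sX (prox_lin_argmin v) Xw.
have := strongly_convex_argmin_gap (strongly_convex_obj w) sX (prox_lin_argmin w) Xv.
rewrite (enormBC (prox_lin w)) /prox_obj; set d := enorm (_ - _); set yv := prox_lin v.
set yw := prox_lin w => h1 h2.
have h3 : alpha^-1 * d ^+ 2 <= dotc (v - w) (yw - yv).
  by rewrite dotcBl !dotcBr; lra.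
have h4 : alpha^-1 * d ^+ 2 <= enorm (v - w) * d.
  by apply: le_trans h3 (le_trans (dotc_le_enorm _ _) _); rewrite (enormBC yw).
have [->|d0] := eqVneq d 0; first by rewrite mulr_ge0 ?enorm_ge0 ?ltW.
have {}d0 : 0 < d by rewrite lt_neqAle eq_sym d0 enorm_ge0.
by move: h4; rewrite expr2 mulrA ler_pM2r// ler_pdivrMl.
Qed.

Lemma prox_in x g : X (prox X phi chi x g alpha).
Proof. by rewrite proxE; case: (prox_lin_argmin (g - alpha^-1 *: grad phi x)). Qed.

Lemma prox_lipschitz x g g' :
  enorm (prox X phi chi x g alpha - prox X phi chi x g' alpha) <= alpha * enorm (g - g').
Proof.
rewrite !proxE; apply: le_trans (prox_lin_lipschitz _ _) _.
by rewrite opprB addrCA addrA subrKC addrC.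
Qed.

(** The minimizer is compared with [x] itself. Half of the quadratic term is the strong convexity
    gap, the other half is the lower bound on the Bregman distance. *)
Lemma prox_descent x g : X x -> forall y, y = prox X phi chi x g alpha ->
  chi y - chi x + alpha^-1 * enorm (x - y) ^+ 2 <= dotc g (x - y).
Proof.
move=> Xx y yE; have := strongly_convex_argmin_gap
  (strongly_convex_obj _) sX (prox_lin_argmin (g - alpha^-1 *: grad phi x)) Xx.
rewrite -proxE -yE /prox_obj !dotcBl !dotcZl => h.
have := bregman_ge y (strongly_convex1_strongly sphi) (dphi x).
rewrite /bregman enormBC => h2.
have a0 : 0 <= alpha^-1 by rewrite invr_ge0 ltW.
have := ler_wpM2l a0 h2.
rewrite !dotcBr; lra.
Qed.

End prox_theory.

(** * Stein's identity and Gaussian moments *)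

Section std_normal.
Context {R : realType}.
Local Notation mu := (@lebesgue_measure R).
Local Notation normal := (normal_prob (0 : R) 1).
Local Notation pdf := (normal_pdf (0 : R) 1).

Lemma normal_pdf01E z : pdf z = normal_peak 1 * expR (- z ^+ 2 / 2).
Proof. by rewrite normal_pdfE ?oner_neq0// /normal_fun subr0 expr1n. Qed.

(** The Radon-Nikodym derivative of the normal law agrees almost everywhere with [pdf], as both have
    the same integral over every measurable set. *)
Lemma ge0_integral_normal_prob (f : R -> \bar R) :
  measurable_fun setT f -> (forall z, (0 <= f z)%E) ->
  (\int[normal]_z f z = \int[mu]_z (f z * (pdf z)%:E))%E.
Proof.
move=> mf f0; pose g := Radon_Nikodym_SigmaFinite.f normal mu.
have dom : normal `<< mu by exact: normal_prob_dominates.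
have mpdf : measurable_fun setT (EFin \o pdf).
  by apply/measurable_EFinP; exact: measurable_normal_pdf.
have gi := Radon_Nikodym_SigmaFinite.f_integrable dom.
rewrite -(Radon_Nikodym_SigmaFinite.change_of_variables dom)//=.
apply: ae_eq_integral => //.
- by apply: emeasurable_funM => //; exact: (measurable_int mu).
- exact: emeasurable_funM.
apply: ae_eqe_mul2l => /=; apply: integral_ae_eq => //.
by move=> E _ mE; rewrite -Radon_Nikodym_SigmaFinite.f_integral.
Qed.

Lemma integral_normal_prob (f : R -> \bar R) : normal.-integrable setT f ->
  (\int[normal]_z f z = \int[mu]_z (f z * (pdf z)%:E))%E.
Proof.
move=> fi; have mf := measurable_int _ fi.
have dom : normal `<< mu by exact: normal_prob_dominates.
have mpdf : measurable_fun setT (EFin \o pdf).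
  by apply/measurable_EFinP; exact: measurable_normal_pdf.
rewrite -(Radon_Nikodym_change_of_variables dom)//=.
apply: ae_eq_integral => //.
- by apply: emeasurable_funM => //; apply: (measurable_int mu); exact: Radon_Nikodym_integrable.
- exact: emeasurable_funM.
apply: ae_eqe_mul2l => /=; apply: integral_ae_eq => //.
- exact: Radon_Nikodym_integrable.
by move=> E _ mE; rewrite -Radon_Nikodym_integral.
Qed.

(** For positive [m] and [c = 4 m], [1 + z^2 <= c (1 + z^2 / c) <= c exp(z^2 / c)], and the [m]-th
    power of the exponential is [exp(z^2 / 4)]. *)
Lemma poly_le_expR (m : nat) : exists2 K : R, 0 < K &
  forall z : R, (1 + z ^+ 2) ^+ m <= K * expR (z ^+ 2 / 4).
Proof.
case: m => [|m].
  exists 1 => // z; rewrite expr0 mul1r -[leLHS]expR0 ler_expR.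
  by rewrite divr_ge0 ?sqr_ge0.
pose c : R := 4 * m.+1%:R; have c0 : 0 < c by rewrite mulr_gt0 ?ltr0n.
exists (c ^+ m.+1); first exact: exprn_gt0.
move=> z; have -> : z ^+ 2 / 4 = m.+1%:R * (z ^+ 2 / c).
  have H (a : R) : a != 0 -> z ^+ 2 / 4 = a * (z ^+ 2 / (4 * a)) by move=> a0; field.
  by rewrite /c; apply: H; rewrite pnatr_eq0.
rewrite expRM_natl -exprMn lerXn2r ?nnegrE ?addr_ge0 ?sqr_ge0 ?mulr_ge0 ?expR_ge0 ?(ltW c0)//.
apply: (@le_trans _ _ (c * (1 + z ^+ 2 / c))); last first.
  by rewrite ler_pM2l// expR_ge1Dx.
rewrite mulrDr mulr1 mulrCA divff ?gt_eqF// mulr1 lerD2r /c.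
have : (1 : R) <= m.+1%:R by rewrite ler1n.
lra.
Qed.

(** Half of the Gaussian decay is given up to absorb polynomials; what remains is a multiple of the
    normal density of variance 2, whose integrability is known. *)
Lemma expR_normal_pdf (z : R) : expR (z ^+ 2 / 4) * pdf z =
  normal_peak 1 / normal_peak (Num.sqrt 2) * normal_pdf 0 (Num.sqrt 2) z.
Proof.
have s0 : Num.sqrt 2 != 0 :> R by rewrite gt_eqF// sqrtr_gt0.
rewrite normal_pdf01E normal_pdfE// mulrA divfK ?gt_eqF ?normal_peak_gt0//.
by rewrite mulrCA -expRD /normal_fun subr0 sqr_sqrtr//; congr (_ * expR _); field.
Qed.

Section poly_growth.
Variables (h : R -> R) (C : R) (m : nat).
Hypothesis mh : measurable_fun setT h.
Hypothesis hC : forall z, `|h z| <= C * (1 + z ^+ 2) ^+ m.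

Lemma poly_growth_pdf :
  exists2 K : R, 0 <= K & forall z, `|h z * pdf z| <= K * normal_pdf 0 (Num.sqrt 2) z.
Proof.
have [K K0 HK] := poly_le_expR m.
have [c c0 cE] : exists2 c : R, 0 <= c & forall z,
    expR (z ^+ 2 / 4) * pdf z = c * normal_pdf 0 (Num.sqrt 2) z.
  exists (normal_peak 1 / normal_peak (Num.sqrt 2)); last exact: expR_normal_pdf.
  by rewrite divr_ge0 ?normal_peak_ge0.
exists (`|C| * K * c); first by rewrite mulr_ge0// mulr_ge0// ltW.
move=> z; rewrite -(mulrA (`|C| * K)) -cE mulrA normrM [`|pdf z|]ger0_norm ?normal_pdf_ge0//.
rewrite ler_wpM2r ?normal_pdf_ge0//; apply: le_trans (hC z) _.
apply: (@le_trans _ _ (`|C| * (1 + z ^+ 2) ^+ m)).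
  by rewrite ler_wpM2r ?ler_norm// exprn_ge0// addr_ge0// sqr_ge0.
by rewrite -mulrA ler_wpM2l.
Qed.

Lemma integrable_poly_growth_pdf : mu.-integrable setT (fun z => (h z * pdf z)%:E).
Proof.
have [K K0 HK] := poly_growth_pdf.
have := integrableZl (measurableT) K (integrable_normal_pdf (0 : R) (Num.sqrt 2)).
apply: le_integrable => //.
  apply/measurable_EFinP; apply: measurable_funM => //.
  exact: measurable_normal_pdf.
by move=> z _; rewrite /= lee_fin (le_trans (HK z))// ler_norm.
Qed.

Lemma integrable_poly_growth : normal.-integrable setT (EFin \o h).
Proof.
apply/integrableP; split; first exact/measurable_EFinP.
rewrite ge0_integral_normal_prob//; last first.
  by apply: measurableT_comp => //; exact/measurable_EFinP.
have /integrableP[_] := integrable_poly_growth_pdf.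
congr (_ < _)%E; apply: eq_integral => z _ /=.
by rewrite normrM EFinM [`|pdf z|]ger0_norm ?normal_pdf_ge0.
Qed.

Lemma integral_poly_growth :
  (\int[normal]_z (h z)%:E = \int[mu]_z (h z * pdf z)%:E)%E.
Proof.
by rewrite integral_normal_prob ?integrable_poly_growth.
Qed.

End poly_growth.

End std_normal.

(** * Stein's identity in one variable *)

Section stein1.
Context {R : realType}.
Local Notation mu := (@lebesgue_measure R).
Local Notation normal := (normal_prob (0 : R) 1).
Local Notation pdf := (normal_pdf (0 : R) 1).

Lemma is_derive_normal_pdf (z : R) : is_derive z 1 pdf (- z * pdf z).
Proof.
have -> : pdf = (fun z => normal_peak 1 * expR (- z ^+ 2 / 2)) by apply/funext => y; exact: normal_pdf01E.
have e2 : is_derive z (1 : R) (fun y : R => - y ^+ 2 / 2) (- z).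
  by apply: is_derive_eq; rewrite /GRing.scale/=; field.
have e3 : is_derive z (1 : R) (fun y : R => expR (- y ^+ 2 / 2)) (- z * expR (- z ^+ 2 / 2)).
  by rewrite mulrC; apply: (@is_derive1_comp _ expR (fun y : R => - y ^+ 2 / 2)).
by apply: is_derive_eq; rewrite /GRing.scale/=; ring.
Qed.

(** These are the boundary terms of the integration by parts; the boolean [s] selects the end of the
    line. *)
Lemma poly_growth_pdf_cvg0 (h : R -> R) (C : R) (m : nat) : (forall z, `|h z| <= C * (1 + z ^+ 2) ^+ m) ->
  forall s : bool, (fun n : nat => h ((-1) ^+ s * n.+1%:R) * pdf ((-1) ^+ s * n.+1%:R)) @ \oo --> (0 : R).
Proof.
move=> hC s; have [K K0 HK] := poly_growth_pdf hC.
have s0 : Num.sqrt 2 != 0 :> R by rewrite gt_eqF// sqrtr_gt0.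
pose c : R := K * normal_peak (Num.sqrt 2).
have c0 : 0 <= c by rewrite mulr_ge0// normal_peak_ge0.
apply/cvgr0Pnorm_le => e e0; near=> n.
apply: le_trans (HK _) _; rewrite normal_pdfE// mulrA -/c /normal_fun subr0 sqr_sqrtr//.
rewrite exprMn sqrr_sign mul1r.
(* [exp(- a^2 / 4) <= 1 / a] follows from [a <= 1 + a^2 / 4 <= exp(a^2 / 4)], whose first inequality
   is [(a - 2)^2 >= 0]. *)
apply: (@le_trans _ _ (c * n.+1%:R^-1)).
  rewrite ler_wpM2l// mulNr expRN lef_pV2 ?posrE ?expR_gt0//.
  apply: le_trans (expR_ge1Dx _).
  have := sqr_ge0 (n.+1%:R - 2 : R); set a : R := n.+1%:R; rewrite -mulr_natl sqrrB; lra.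
near: n.
have : (fun n : nat => c * harmonic n) @ \oo --> c * 0.
  by apply: cvgMr; exact: cvg_harmonic.
rewrite mulr0 => /cvgr0Pnorm_le/(_ e e0); apply: filterS => n.
exact/le_trans/ler_norm.
Unshelve. all: by end_near. Qed.

Variables (h h' : R -> R) (C : R) (m : nat).
Hypothesis hh' : forall z : R, is_derive z 1 h (h' z).
Hypothesis ch' : continuous h'.
Hypothesis hC : forall z, `|h z| <= C * (1 + z ^+ 2) ^+ m.
Hypothesis h'C : forall z, `|h' z| <= C * (1 + z ^+ 2) ^+ m.

Let ch : continuous h.
Proof.
move=> z; have [dh _] := hh' z.
by apply: (@differentiable_continuous R R R z h); apply/derivable1_diffP.
Qed.

Lemma id_mul_poly_growth z : `|z * h z| <= C * (1 + z ^+ 2) ^+ m.+1.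
Proof.
rewrite normrM exprS mulrCA; apply: ler_pM => //.
have [z1|z1] := leP `|z| 1; first by rewrite (le_trans z1)// lerDl sqr_ge0.
by rewrite -real_normK ?num_real//; nra.
Qed.

Let mh : measurable_fun setT h.
Proof. exact: continuous_measurable_fun. Qed.

Let mh' : measurable_fun setT h'.
Proof. exact: continuous_measurable_fun. Qed.

Let mzh : measurable_fun setT (fun z : R => z * h z).
Proof. exact: measurable_funM. Qed.

Let k z := h' z * pdf z - z * h z * pdf z.

Let ik : mu.-integrable setT (EFin \o k).
Proof.
have i1 := integrable_poly_growth_pdf mh' h'C.
have i2 := integrable_poly_growth_pdf mzh id_mul_poly_growth.
by have := integrableB measurableT i1 i2; apply: eq_integrable.
Qed.

Let ck : continuous k.
Proof.
move=> z; apply: (@continuousB R R^o _ (fun z => h' z * pdf z) (fun z => z * h z * pdf z)).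
  by apply: continuousM; [exact: ch'|apply: continuous_normal_pdf; rewrite oner_neq0].
apply: continuousM; last by apply: continuous_normal_pdf; rewrite oner_neq0.
by apply: continuousM; [move=> ?|exact: ch].
Qed.

Let dF (z : R) : is_derive z 1 (fun z : R => h z * pdf z) (k z).
Proof.
have := hh' z => hz; have := is_derive_normal_pdf z => pz.
by apply: is_derive_eq; rewrite /k /GRing.scale/=; ring.
Qed.

Let I n : set R := `[- n.+1%:R, n.+1%:R].

Let int_I n : (\int[mu]_(z in I n) (k z)%:E =
  (h n.+1%:R * pdf n.+1%:R - h (- n.+1%:R) * pdf (- n.+1%:R))%:E)%E.
Proof.
have cF : continuous (fun z => h z * pdf z).
  by move=> z; apply: continuousM; [exact: ch|apply: continuous_normal_pdf; rewrite oner_neq0].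
rewrite /I (@continuous_FTC2 _ _ (fun z => h z * pdf z))//.
- by rewrite gtrN.
- exact: continuous_subspaceT.
- split.
  + by move=> z _; have [] := dF z.
  + by apply: cvg_at_right_filter; exact: cF.
  + by apply: cvg_at_left_filter; exact: cF.
- by move=> z _; rewrite derive1E; have [_ ->] := dF z.
Qed.

(** [k] is the derivative of [h * pdf]. Its integral over a symmetric interval is a difference of
    boundary terms tending to 0, and tends to the full integral by dominated convergence. *)
Let int_k : (\int[mu]_z (k z)%:E = 0)%E.
Proof.
have mI n : measurable (I n) by exact: measurable_itv.
have lim1 : (fun n => \int[mu]_(z in I n) (k z)%:E)%E @ \oo --> (\int[mu]_z (k z)%:E)%E.
  rewrite (_ : (fun n => _) = (fun n => \int[mu]_z ((EFin \o k) \_ (I n)) z)%E); last first.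
    by apply/funext => n; rewrite -integral_mkcond.
  have [|||||//] := @dominated_convergence _ _ _ mu setT measurableT
      (fun n => (EFin \o k) \_ (I n)) (EFin \o k) (abse \o (EFin \o k)).
  - move=> n; apply/(measurable_restrictT _ (mI n)).
    by apply: measurable_funTS; exact: measurable_int ik.
  - exact: measurable_int ik.
  - apply: aeW => z _; apply: cvg_near_cst; near=> n.
    rewrite patchE mem_set// /I /= in_itv/= -ler_norml.
    near: n; exists (`|Num.ceil `|z| |)%N => // n /= zn.
    rewrite (le_trans (ceil_ge _))// (@le_trans _ _ (`|Num.ceil `|z| |%N%:R))//.
      by rewrite natr_absz ler_int ler_norm.
    by rewrite ler_nat (leq_trans zn).
  - exact: integrable_abse.
  - apply: aeW => z n _; rewrite patchE; case: ifPn => //= _.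
    by rewrite normr0 lee_fin.
rewrite -(cvg_lim _ lim1)//; apply/cvg_lim => //.
pose A (b : bool) (n : nat) : R := h ((-1) ^+ b * n.+1%:R) * pdf ((-1) ^+ b * n.+1%:R).
have cA : (fun n => A false n - A true n) @ \oo --> (0 : R).
  have := cvgB (poly_growth_pdf_cvg0 hC false) (poly_growth_pdf_cvg0 hC true).
  by rewrite subr0; exact.
rewrite (_ : (fun n => _) = (fun n => (A false n - A true n)%:E)); last first.
  by apply/funext => n; rewrite int_I /A expr0 expr1 !mul1r mulN1r.
by apply/fine_cvgP; split; [exact: nearW|exact: cA].
Unshelve. all: by end_near. Qed.

Lemma stein1 : (\int[normal]_z (h' z)%:E = \int[normal]_z (z * h z)%:E)%E.
Proof.
rewrite (integral_poly_growth mh' h'C) (integral_poly_growth mzh id_mul_poly_growth).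
have i1 := integrable_poly_growth_pdf mh' h'C.
have i2 := integrable_poly_growth_pdf mzh id_mul_poly_growth.
have sub0 (x y : \bar R) : x \is a fin_num -> y \is a fin_num -> (x - y = 0)%E -> x = y.
  by move: x y => [x||] [y||]//= _ _ [] /eqP; rewrite subr_eq0 => /eqP ->.
apply: sub0.
- exact: (integrable_fin_num measurableT i1).
- exact: (integrable_fin_num measurableT i2).
by rewrite -integralB// -int_k; apply: eq_integral.
Qed.

End stein1.

(** * Measurability of vector-valued maps *)

Section measurable_cv.
Context {R : realType}.

Definition measurable_cv {d} {T : measurableType d} {n} (g : T -> 'cV[R]_n) :=
  forall j, measurable_fun setT (fun w => g w j 0).

(** A countable union, so that coordinatewise measurability is enough to make preimages of open sets
    measurable. *)
Lemma open_rational_cubes n (U : set 'cV[R]_n) : open U ->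
  let cube (p : {ffun 'I_n -> rat} * nat) :=
    [set x : 'cV[R]_n | forall j, `|x j 0 - ratr (p.1 j)| < p.2.+1%:R^-1] in
  U = \bigcup_(p in [set p | cube p `<=` U]) cube p.
Proof.
move=> oU cube; apply/seteqP; split=> [x Ux|x [p /= pU /pU//]].
have /nbhs_ballP[e /= e0 xe] : nbhs x U by exact: open_nbhs_nbhs.
have /ltr_add_invr[k] : 0 < e / 2 by rewrite divr_gt0.
rewrite add0r => ke.
have q_ j : {q : rat | `|x j 0 - ratr q| < k.+1%:R^-1}.
  apply: cid; have /rat_in_itvoo[q] : x j 0 - k.+1%:R^-1 < x j 0 + k.+1%:R^-1.
    by rewrite ltrBlDr -addrA ltrDl addr_gt0// invr_gt0.
  by rewrite in_itv/= => /andP[q1 q2]; exists q; rewrite ltr_distlC q1.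
exists ([ffun j => sval (q_ j)], k); last first.
  by move=> j /=; rewrite ffunE; case: (q_ j).
move=> y /= yq; apply: xe; rewrite mx_norm_ball /ball_/=.
apply: (@le_lt_trans _ _ (k.+1%:R^-1 + k.+1%:R^-1)); last by rewrite [ltRHS]splitr ltrD.
rewrite /Num.norm/= mx_normrE; apply/bigmax_leP; split=> [|[j l] _ /=].
  by rewrite addr_ge0// invr_ge0.
rewrite ord1 !mxE; apply: le_trans (ler_distD (ratr (sval (q_ j))) _ _) _.
apply: lerD; first by case: (q_ j) => q /= /ltW.
by have := yq j; rewrite ffunE distrC => /ltW.
Qed.

Section fixed_domain.
Context {d} {T : measurableType d} {n : nat}.
Implicit Types g : T -> 'cV[R]_n.

Lemma measurable_cv_open g (U : set 'cV[R]_n) : measurable_cv g -> open U ->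
  measurable (g @^-1` U).
Proof.
move=> mg oU; rewrite (open_rational_cubes oU) preimage_bigcup.
rewrite bigcup_mkcond; apply: countable_bigcupT_measurable; first exact: countableP.
move=> [q k]; case: ifPn => // _.
rewrite (_ : _ @^-1` _ = \bigcap_(j in [set: 'I_n])
  ((fun w => g w j 0 - ratr (q j)) @^-1` `](- k.+1%:R^-1), (k.+1%:R^-1)[)).
  apply: fin_bigcap_measurable => // j _; rewrite -[X in measurable X]setTI.
  by apply: measurable_funB => //; exact: mg.
apply/seteqP; split => [x xq j _|x xq j].
  by rewrite /= in_itv/= -ltr_norml; exact: xq.
by have := xq j I; rewrite /= in_itv/= -ltr_norml.
Qed.

Lemma measurable_cv_closed g (U : set 'cV[R]_n) : measurable_cv g -> closed U ->
  measurable (g @^-1` U).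
Proof.
move=> mg cU; rewrite -[X in measurable X]setCK; apply: measurableC.
by rewrite preimage_setC; apply: measurable_cv_open => //; exact: closed_openC.
Qed.

(** Stated for closed sublevel sets because [chi] is given as closed convex, through its epigraph;
    continuous functions are a special case. *)
Lemma measurable_cv_lsc g (h : 'cV[R]_n -> R) : measurable_cv g ->
  (forall a, closed [set x | h x <= a]) -> measurable_fun setT (h \o g).
Proof.
move=> mg ch mD; apply: (measurability _ (RGenOInfty.measurableE R)) => //.
move=> /= _ [_ [a ->]] <-; apply: measurableI => //.
rewrite -[X in measurable X]setCK; apply: measurableC.
rewrite (_ : ~` _ = g @^-1` [set x | h x <= a]); first exact: measurable_cv_closed.
apply/seteqP; split => x /=; rewrite in_itv/= andbT leNgt; first by move/negP.
by move=> /negP.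
Qed.

Lemma measurable_cv_continuous g (h : 'cV[R]_n -> R) : measurable_cv g ->
  continuous h -> measurable_fun setT (h \o g).
Proof.
move=> mg ch; apply: measurable_cv_lsc => // a.
by apply: (preimage_closed _ (@closed_le _ a)) => x _; exact: ch.
Qed.

Lemma measurable_cv_cst c : measurable_cv (fun _ : T => c : 'cV[R]_n).
Proof. by move=> j; exact: measurable_cst. Qed.

Lemma measurable_cvD g g' : measurable_cv g -> measurable_cv g' ->
  measurable_cv (fun w => g w + g' w).
Proof.
move=> mg mg' j; under eq_fun do rewrite mxE.
by apply: measurable_funD; [exact: mg|exact: mg'].
Qed.

Lemma measurable_cvZ (a : T -> R) g : measurable_fun setT a -> measurable_cv g ->
  measurable_cv (fun w => a w *: g w).
Proof.
move=> ma mg j; under eq_fun do rewrite mxE.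
by apply: measurable_funM; last exact: mg.
Qed.

Lemma measurable_cvB g g' : measurable_cv g -> measurable_cv g' ->
  measurable_cv (fun w => g w - g' w).
Proof.
move=> mg mg' j; under eq_fun do rewrite !mxE.
by apply: measurable_funB; [exact: mg|exact: mg'].
Qed.

Lemma measurable_cv_sum I (s : seq I) (G : I -> T -> 'cV[R]_n) :
  (forall t, measurable_cv (G t)) -> measurable_cv (fun w => \sum_(t <- s) G t w).
Proof.
move=> mG j; under eq_fun do rewrite summxE.
by apply: measurable_sum => t; exact: mG.
Qed.

Lemma measurable_dotc g g' : measurable_cv g -> measurable_cv g' ->
  measurable_fun setT (fun w => dotc (g w) (g' w)).
Proof.
move=> mg mg'; apply: measurable_sum => j.
by apply: measurable_funM; [exact: mg|exact: mg'].
Qed.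

Lemma measurable_sqr_enorm g : measurable_cv g ->
  measurable_fun setT (fun w => enorm (g w) ^+ 2).
Proof.
by move=> mg; under eq_fun do rewrite sqr_enorm; exact: measurable_dotc.
Qed.

(** The passage to tuples, on which the joint measurability of [F] is stated. *)
Lemma measurable_cv_tuple g : measurable_cv g ->
  measurable_fun setT (fun w => [tuple g w j 0 | j < n]).
Proof.
move=> mg; apply/measurable_fun_tnthP => j.
by rewrite (_ : _ \o _ = fun w => g w j 0)//; apply/funext => w /=; rewrite tnth_mktuple.
Qed.

Lemma tcol_tuple (x : 'cV[R]_n) : tcol [tuple x j 0 | j < n] = x.
Proof. by apply/matrixP => j k; rewrite ord1 mxE tnth_mktuple. Qed.

(** Each coordinate of the gradient is a pointwise limit of difference quotients with step
    [1 / (k + 1)], and each quotient is measurable because [h] is continuous. *)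
Lemma measurable_cv_grad g (h : 'cV[R]_n -> R) : measurable_cv g ->
  (forall x, differentiable h x) -> measurable_cv (fun w => grad h (g w)).
Proof.
move=> mg dh j; pose r (k : nat) : R := k.+1%:R^-1.
have ch : continuous h by move=> x; apply: (@differentiable_continuous R _ R^o); exact: dh.
apply: (@measurable_fun_cvg _ _ _ _
  (fun k w => (r k)^-1 * (h (r k *: delta_mx j 0 + g w) - h (g w)))) => //.
  move=> k; apply: measurable_funM => //; apply: measurable_funB.
    apply: (measurable_cv_continuous (g := fun w => r k *: delta_mx j 0 + g w)) => //.
    by apply: measurable_cvD => //; exact: measurable_cv_cst.
  exact: measurable_cv_continuous.
move=> w _; rewrite mxE /derive.
have dd : derivable h (g w) (delta_mx j 0) by exact: diff_derivable.
have r0 : r k @[k --> \oo] --> (0 : R)^'.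
  move=> A /nbhs_ballP[e /= e0 eA].
  have /cvgr0Pnorm_lt/(_ e e0) := @cvg_harmonic R; apply: filterS => k /= ke.
  apply: eA; first by rewrite /ball/= sub0r normrN.
  by rewrite /r invr_eq0 pnatr_eq0.
exact: (cvg_comp _ _ r0 dd).
Qed.

End fixed_domain.

End measurable_cv.

(** * Stein's identity in several variables *)

Section stein_tuple.
Context {R : realType}.
Local Notation normal := (normal_prob (0 : R) 1).
Local Notation gaussian := (@std_gaussian R).

(* A bound by a product of weights survives fixing one coordinate, which is
   what the induction on the dimension needs. *)
Definition gweight n (m : nat) (t : n.-tuple R) : R := (\prod_i (1 + tnth t i ^+ 2)) ^+ m.

Definition upd n (t : n.-tuple R) (j : 'I_n) (z : R) : n.-tuple R :=
  [tuple if i == j then z else tnth t i | i < n].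

Lemma gweight_ge0 n m (t : n.-tuple R) : 0 <= gweight m t.
Proof. by rewrite exprn_ge0// prodr_ge0// => j _; rewrite addr_ge0// sqr_ge0. Qed.

Lemma tnth_tcons0 n (z : R) (t : n.-tuple R) : tnth (tcons (z, t)) ord0 = z.
Proof. by rewrite tnth0. Qed.

Lemma tnth_tconsS n (z : R) (t : n.-tuple R) j :
  tnth (tcons (z, t)) (lift ord0 j) = tnth t j.
Proof. by rewrite tnthS. Qed.

Lemma gweight_tcons n m z (t : n.-tuple R) :
  gweight m (tcons (z, t)) = (1 + z ^+ 2) ^+ m * gweight m t.
Proof.
rewrite /gweight big_ord_recl tnth_tcons0 exprMn; congr (_ * _ ^+ _).
by apply: eq_bigr => j _; rewrite tnth_tconsS.
Qed.

Lemma upd_tcons0 n z y (t : n.-tuple R) : upd (tcons (z, t)) ord0 y = tcons (y, t).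
Proof.
apply: eq_from_tnth => j; rewrite tnth_mktuple.
case: (unliftP ord0 j) => [k ->|->]; last by rewrite eqxx tnth_tcons0.
by rewrite !tnth_tconsS.
Qed.

Lemma upd_tconsS n z y (t : n.-tuple R) j :
  upd (tcons (z, t)) (lift ord0 j) y = tcons (z, upd t j y).
Proof.
apply: eq_from_tnth => k; rewrite tnth_mktuple.
case: (unliftP ord0 k) => [k' ->|->]; last by rewrite !tnth_tcons0.
by rewrite !tnth_tconsS tnth_mktuple (inj_eq lift_inj).
Qed.

Lemma measurable_gweight n m : measurable_fun setT (@gweight n m).
Proof.
apply: measurable_funX; apply: measurable_prod => j _.
by apply: measurable_funD => //; apply: measurable_funX; exact: measurable_tnth.
Qed.

Lemma measurable_tcons_l n z : measurable_fun setT (fun t : n.-tuple R => tcons (z : measurableTypeR R, t)).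
Proof. exact: measurableT_comp (@measurable_tcons R n) (pair1_measurable _). Qed.

(** The weight factorizes over the first coordinate and the rest, so Tonelli reduces the claim to a
    one-dimensional moment and the induction hypothesis. *)
Lemma integral_gweight n m : (\int[gaussian n]_t (gweight m t)%:E < +oo)%E.
Proof.
elim: n => [|n IH].
  rewrite integral_dirac//=; last by apply/measurable_EFinP; exact: measurable_gweight.
  by rewrite diracT mul1e ltry.
rewrite ge0_integral_distribution//=; last 2 first.
- by apply/measurable_EFinP; exact: measurable_gweight.
- by move=> t; rewrite lee_fin gweight_ge0.
rewrite fubini_tonelli1//=; last 2 first.
- apply/measurable_EFinP.
  exact: (measurableT_comp (@measurable_gweight n.+1 m) (@measurable_tcons R n)).
- by move=> t; rewrite lee_fin gweight_ge0.
have -> : (\int[normal]_z fubini_F (gaussian n) (fun z0 => (gweight m (tcons z0))%:E) z =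
    \int[normal]_z (((1 + z ^+ 2) ^+ m)%:E * \int[gaussian n]_t (gweight m t)%:E))%E.
  apply: eq_integral => z _; rewrite -ge0_integralZl//.
  - by apply: eq_integral => t _; rewrite gweight_tcons EFinM.
  - by apply/measurable_EFinP; exact: measurable_gweight.
  - by move=> t _; rewrite lee_fin gweight_ge0.
  - by rewrite lee_fin exprn_ge0// addr_ge0// sqr_ge0.
have IH0 : (0 <= \int[gaussian n]_t (gweight m t)%:E)%E.
  by apply: integral_ge0 => t _; rewrite lee_fin gweight_ge0.
have i0 : normal.-integrable setT (fun z : measurableTypeR R => ((1 + z ^+ 2) ^+ m)%:E).
  apply: (@integrable_poly_growth _ (fun z : R => (1 + z ^+ 2) ^+ m) 1 m).
    by apply: measurable_funX; apply: measurable_funD => //; exact: measurable_funX.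
  by move=> z; rewrite mul1r ger0_norm// exprn_ge0// addr_ge0// sqr_ge0.
rewrite ge0_integralZr//.
- rewrite lte_mul_pinfty//; last exact: (integrable_fin_num measurableT i0).
  by apply: integral_ge0 => z _; rewrite lee_fin exprn_ge0// addr_ge0// sqr_ge0.
- exact: measurable_int i0.
- by move=> z _; rewrite lee_fin exprn_ge0// addr_ge0// sqr_ge0.
Qed.

Lemma integrable_gweight n m C (h : n.-tuple R -> R) : measurable_fun setT h ->
  (forall t, `|h t| <= C * gweight m t) -> (gaussian n).-integrable setT (EFin \o h).
Proof.
move=> mh hC.
have i0 : (gaussian n).-integrable setT (EFin \o @gweight n m).
  apply/integrableP; split; first by apply/measurable_EFinP; exact: measurable_gweight.
  under eq_integral do rewrite /= ger0_norm ?gweight_ge0//.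
  exact: integral_gweight.
have := integrableZl measurableT C i0; apply: le_integrable => //.
  exact/measurable_EFinP.
by move=> t _; rewrite /= lee_fin (le_trans (hC t))// ler_norm.
Qed.

Lemma gweightC_ge0 n m C (h : n.-tuple R -> R) :
  (forall t, `|h t| <= C * gweight m t) -> 0 <= C.
Proof.
move=> hC; have := le_trans (normr_ge0 _) (hC [tuple of nseq n 0]).
rewrite /gweight big1 ?expr1n ?mulr1// => j _.
by rewrite (tnth_nth 0) nth_nseq ltn_ord expr0n addr0.
Qed.

Lemma gweightM n m C (h : n.-tuple R -> R) j : (forall t, `|h t| <= C * gweight m t) ->
  forall t, `|tnth t j * h t| <= C * gweight m.+1 t.
Proof.
move=> hC t; rewrite normrM /gweight exprS mulrCA; apply: ler_pM => //.
rewrite (bigD1 j)//=; set a := tnth t j.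
have a1 : `|a| <= 1 + a ^+ 2.
  have [z1|z1] := leP `|a| 1; first by rewrite (le_trans z1)// lerDl sqr_ge0.
  by rewrite -real_normK ?num_real//; nra.
apply: le_trans a1 _; rewrite ler_peMr ?addr_ge0 ?sqr_ge0//.
elim/big_ind: _ => // [x y x1 y1|k _]; last by rewrite lerDl sqr_ge0.
by rewrite (le_trans x1)// ler_peMr// (le_trans _ x1).
Qed.

Lemma integral_std_gaussianS n (h : n.+1.-tuple R -> R) C m : measurable_fun setT h ->
  (forall t, `|h t| <= C * gweight m t) ->
  [/\ (normal \x gaussian n)%E.-integrable setT (fun z => (h (tcons z))%:E) &
  (\int[gaussian n.+1]_t (h t)%:E = \int[normal \x gaussian n]_z (h (tcons z))%:E)%E].
Proof.
move=> mh hC.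
have mht : measurable_fun setT (fun z => (h (@tcons R n z))%:E).
  by apply/measurable_EFinP; exact: measurableT_comp mh (@measurable_tcons R n).
have i0 : (normal \x gaussian n)%E.-integrable setT (fun z => (h (tcons z))%:E).
  apply/integrableP; split => //.
  have /integrableP[_] := integrable_gweight mh hC.
  rewrite ge0_integral_distribution//.
  by apply/measurableT_comp => //; exact/measurable_EFinP.
split => //; rewrite integral_distribution//; exact/measurable_EFinP.
Qed.

(** Induction on the dimension by Fubini. If [j] is the first coordinate, the others are frozen and
    the one-dimensional identity applies; otherwise the first one is frozen. The weight of what is
    frozen goes into the constant [C]. *)
Lemma stein_tuple n (j : 'I_n) (h h' : n.-tuple R -> R) C m :
  measurable_fun setT h -> measurable_fun setT h' ->
  (forall t, `|h t| <= C * gweight m t) -> (forall t, `|h' t| <= C * gweight m t) ->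
  (forall t (z : R), is_derive z 1 (fun y => h (upd t j y)) (h' (upd t j z))) ->
  (forall t, continuous (fun z => h' (upd t j z))) ->
  (\int[gaussian n]_t (h' t)%:E = \int[gaussian n]_t (tnth t j * h t)%:E)%E.
Proof.
elim: n => [|n IH] in j h h' C m *; first by case: j.
move=> mh mh' hC h'C dh ch'.
have C0 := gweightC_ge0 hC.
have mth : measurable_fun setT (fun t : n.+1.-tuple R => tnth t j * h t).
  by apply: measurable_funM => //; exact: measurable_tnth.
have [i1 ->] := integral_std_gaussianS mh' h'C.
have [i2 ->] := integral_std_gaussianS mth (gweightM j hC).
case: (unliftP ord0 j) => [k jk|j0]; last first.
  rewrite -!integral21_prod_meas1//; apply: eq_integral => t _.
  have S := @stein1 R (fun z => h (tcons (z, t))) (fun z => h' (tcons (z, t))) (C * gweight m t) m.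
  rewrite [RHS](_ : _ = (\int[normal]_z (z * h (tcons (z, t)))%:E)%E); last first.
    by apply: eq_integral => z _ /=; rewrite j0 tnth_tcons0.
  apply: S.
  - by move=> z; have := dh (tcons (z, t)) z; rewrite j0 upd_tcons0; under eq_fun do rewrite upd_tcons0.
  - by have := ch' (tcons (0, t)); rewrite j0; under eq_fun do rewrite upd_tcons0.
  - by move=> z; apply: le_trans (hC _) _; rewrite gweight_tcons mulrA mulrAC.
  - by move=> z; apply: le_trans (h'C _) _; rewrite gweight_tcons mulrA mulrAC.
rewrite -!integral12_prod_meas1//; apply: eq_integral => z _.
have S := IH k (fun t => h (tcons (z, t))) (fun t => h' (tcons (z, t))) (C * (1 + z ^+ 2) ^+ m) m.
rewrite [RHS](_ : _ = (\int[gaussian n]_t (tnth t k * h (tcons (z, t)))%:E)%E); last first.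
  by apply: eq_integral => t _ /=; rewrite jk tnth_tconsS.
apply: S.
- by apply: measurableT_comp => //; exact: measurable_tcons_l.
- by apply: measurableT_comp => //; exact: measurable_tcons_l.
- by move=> t; apply: le_trans (hC _) _; rewrite gweight_tcons mulrA.
- by move=> t; apply: le_trans (h'C _) _; rewrite gweight_tcons mulrA.
- move=> t y; have := dh (tcons (z, t)) y; rewrite jk upd_tconsS.
  by under eq_fun do rewrite upd_tconsS.
- by move=> t; have := ch' (tcons (z, t)); rewrite jk; under eq_fun do rewrite upd_tconsS.
Qed.

End stein_tuple.

(** * Gaussian means of functions of polynomial growth *)

Section gaussian_moments.
Context {R : realType} {n : nat}.
Local Notation gaussian := (@std_gaussian R n).
Implicit Types (h k : 'cV[R]_n -> R) (g : 'cV[R]_n).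

(** A class closed under sums, products and powers whose members are measurable and integrable, so
    that every integrability condition below is settled by the shape of the integrand. *)
Definition poly_growth h :=
  continuous h /\ exists C m, forall x, `|h x| <= C * (1 + enorm x ^+ 2) ^+ m.

Definition gmean h : R := \int[gaussian]_t h (tcol t).

Lemma measurable_cv_tcol : measurable_cv (@tcol R n).
Proof. by move=> j; under eq_fun do rewrite mxE; exact: measurable_tnth. Qed.

(** Expanding the product of the [1 + t_j^2] gives [1 + sum_j t_j^2] plus nonnegative terms. *)
Lemma enorm_gweight m (t : n.-tuple R) : (1 + enorm (tcol t) ^+ 2) ^+ m <= gweight m t.
Proof.
rewrite /gweight lerXn2r ?nnegrE ?addr_ge0 ?sqr_ge0//.
  by rewrite prodr_ge0// => j _; rewrite addr_ge0// sqr_ge0.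
have tE j : tcol t j 0 ^+ 2 = tnth t j ^+ 2 by rewrite mxE.
rewrite sqr_enormE (eq_bigr _ (fun j _ => tE j)).
suff [] : 0 <= \sum_j tnth t j ^+ 2 /\
    1 + \sum_j tnth t j ^+ 2 <= \prod_j (1 + tnth t j ^+ 2) by [].
apply: (big_ind2 (fun a p => 0 <= a /\ 1 + a <= p)).
- by rewrite addr0.
- move=> a p b q [a0 ap] [b0 bq]; split; first exact: addr_ge0.
  by nra.
- by move=> j _; rewrite sqr_ge0.
Qed.

Lemma poly_growth_measurable h : poly_growth h ->
  measurable_fun setT (fun t : n.-tuple R => h (tcol t)).
Proof. by case=> ch _; exact: (measurable_cv_continuous measurable_cv_tcol ch). Qed.

Lemma poly_growth_gweight h : poly_growth h ->
  exists2 C, 0 <= C & exists m, forall t, `|h (tcol t)| <= C * gweight m t.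
Proof.
move=> [_ [C [m hC]]]; exists `|C| => //; exists m => t; apply: le_trans (hC _) _.
apply: (@le_trans _ _ (`|C| * (1 + enorm (tcol t) ^+ 2) ^+ m)).
  by rewrite ler_wpM2r ?ler_norm// exprn_ge0// addr_ge0// sqr_ge0.
by rewrite ler_wpM2l// enorm_gweight.
Qed.

Lemma poly_growth_integrable h : poly_growth h ->
  gaussian.-integrable setT (fun t => (h (tcol t))%:E).
Proof.
move=> pgh; have [C _ [m hC]] := poly_growth_gweight pgh.
exact: (integrable_gweight (poly_growth_measurable pgh) hC).
Qed.

Lemma poly_growth_cst (c : R) : poly_growth (fun=> c).
Proof.
split; first exact: cst_continuous.
by exists `|c|, 0%N => x; rewrite expr0 mulr1.
Qed.

Let weight_le (x : 'cV[R]_n) C m m' : (m <= m')%N ->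
  C * (1 + enorm x ^+ 2) ^+ m <= `|C| * (1 + enorm x ^+ 2) ^+ m'.
Proof.
move=> mm'; have e1 : 1 <= 1 + enorm x ^+ 2 by rewrite lerDl sqr_ge0.
apply: (@le_trans _ _ (`|C| * (1 + enorm x ^+ 2) ^+ m)).
  by rewrite ler_wpM2r ?ler_norm// exprn_ge0// (le_trans _ e1).
by rewrite ler_wpM2l// ler_weXn2l.
Qed.

Lemma poly_growthD h k : poly_growth h -> poly_growth k -> poly_growth (fun x => h x + k x).
Proof.
move=> [ch [C [m hC]]] [ck [D [p kD]]]; split.
  by move=> x; apply: (@continuousD R R^o); [exact: ch|exact: ck].
exists (`|C| + `|D|), (m + p)%N => x; rewrite mulrDl.
apply: le_trans (ler_normD _ _) _; apply: lerD.
  by apply: le_trans (hC x) _; apply: weight_le; rewrite leq_addr.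
by apply: le_trans (kD x) _; apply: weight_le; rewrite leq_addl.
Qed.

Lemma poly_growthM h k : poly_growth h -> poly_growth k -> poly_growth (fun x => h x * k x).
Proof.
move=> [ch [C [m hC]]] [ck [D [p kD]]]; split.
  by move=> x; apply: continuousM; [exact: ch|exact: ck].
exists (`|C| * `|D|), (m + p)%N => x; rewrite exprD mulrACA normrM.
apply: ler_pM => //.
  by apply: le_trans (hC x) _; exact: weight_le.
by apply: le_trans (kD x) _; exact: weight_le.
Qed.

Lemma poly_growthX h p : poly_growth h -> poly_growth (fun x => h x ^+ p).
Proof.
move=> pgh; elim: p => [|p IH]; first exact: poly_growth_cst.
by under eq_fun do rewrite exprS; exact: poly_growthM.
Qed.

Lemma poly_growth_sqr_enorm : poly_growth (fun x => enorm x ^+ 2).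
Proof.
split; first by under eq_fun do rewrite sqr_enorm; exact: continuous_dotc2.
by exists 1, 1%N => x; rewrite mul1r expr1 ger0_norm ?sqr_ge0// lerDr.
Qed.

Lemma poly_growth_dotc g : poly_growth (dotc g).
Proof.
split; first exact: continuous_dotc.
exists (enorm g), 1%N => x; apply: le_trans (normr_dotc _ _) _.
rewrite ler_wpM2l ?enorm_ge0// expr1.
by have := sqr_ge0 (enorm x - 1); rewrite sqrrB; have := enorm_ge0 x; lra.
Qed.

Lemma poly_growth_coord j : poly_growth (fun x => x j 0).
Proof.
rewrite (_ : (fun x => _) = dotc (delta_mx j 0)); first exact: poly_growth_dotc.
by apply/funext => x; rewrite delta_dotc.
Qed.

Lemma gmeanE h : poly_growth h ->
  ((gmean h)%:E = \int[gaussian]_t (h (tcol t))%:E)%E.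
Proof.
move=> pgh; rewrite /gmean /Rintegral fineK//.
exact: (integrable_fin_num measurableT (poly_growth_integrable pgh)).
Qed.

Lemma gmeanD h k : poly_growth h -> poly_growth k ->
  gmean (fun x => h x + k x) = gmean h + gmean k.
Proof. by move=> ph pk; rewrite /gmean RintegralD//; exact: poly_growth_integrable. Qed.

Lemma gmeanZ (a : R) h : poly_growth h -> gmean (fun x => a * h x) = a * gmean h.
Proof. by move=> ph; rewrite /gmean RintegralZl//; exact: poly_growth_integrable. Qed.

Lemma gmean_cst (a : R) : gmean (fun=> a) = a.
Proof. by rewrite /gmean Rintegral_cst//= probability_setT mulr1. Qed.

Lemma le_gmean h k : poly_growth h -> poly_growth k -> (forall x, h x <= k x) ->
  gmean h <= gmean k.
Proof. by move=> ph pk hk; apply: le_Rintegral => //; exact: poly_growth_integrable. Qed.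

Lemma poly_growth_sum I (s : seq I) (H : I -> 'cV[R]_n -> R) :
  (forall i, poly_growth (H i)) -> poly_growth (fun x => \sum_(i <- s) H i x).
Proof.
move=> pH; elim: s => [|i s IH].
  by under eq_fun do rewrite big_nil; exact: poly_growth_cst.
by under eq_fun do rewrite big_cons; exact: poly_growthD.
Qed.

Lemma gmean_sum I (s : seq I) (H : I -> 'cV[R]_n -> R) :
  (forall i, poly_growth (H i)) ->
  gmean (fun x => \sum_(i <- s) H i x) = \sum_(i <- s) gmean (H i).
Proof.
move=> pH; elim: s => [|i s IH].
  by rewrite big_nil; under eq_fun do rewrite big_nil; exact: gmean_cst.
rewrite big_cons; under eq_fun do rewrite big_cons.
by rewrite gmeanD ?IH//; exact: poly_growth_sum.
Qed.

Lemma stein h h' j : poly_growth h -> poly_growth h' ->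
  (forall x, is_derive x (delta_mx j 0) h (h' x)) ->
  gmean h' = gmean (fun x => x j 0 * h x).
Proof.
move=> ph ph' hh'.
have [C C0 [m hC]] := poly_growth_gweight ph.
have [D D0 [p hD]] := poly_growth_gweight ph'.
have pth := poly_growthM (poly_growth_coord j) ph.
have wl a b (t : n.-tuple R) : gweight a t <= gweight (a + b) t.
  rewrite /gweight ler_weXn2l ?leq_addr//.
  elim/big_ind: _ => // [x y x1 y1|k _]; last by rewrite lerDl sqr_ge0.
  by rewrite (le_trans x1)// ler_peMr// (le_trans _ x1).
have updE (t : n.-tuple R) (y : R) :
    tcol (upd t j y) = tcol (upd t j 0) + y *: delta_mx j 0.
  apply/matrixP => i l; rewrite ord1 !mxE !tnth_mktuple eqxx andbT.
  by case: eqP => _; rewrite ?mulr1 ?add0r ?mulr0 ?addr0.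
rewrite /gmean /Rintegral; congr fine.
rewrite [RHS](_ : _ = (\int[gaussian]_t (tnth t j * h (tcol t))%:E)%E); last first.
  by apply: eq_integral => t _ /=; rewrite mxE.
(* The identity on tuples asks for one bound on both functions; adding constants and exponents
   provides it, as the weight is at least 1. *)
apply: (@stein_tuple R n j (h \o @tcol R n) (h' \o @tcol R n) (C + D) (m + p)).
- exact: poly_growth_measurable.
- exact: poly_growth_measurable.
- move=> t; apply: le_trans (hC t) _; apply: ler_pM; rewrite ?gweight_ge0 ?lerDl//.
- move=> t; apply: le_trans (hD t) _; apply: ler_pM; rewrite ?gweight_ge0 ?lerDr//.
  by rewrite addnC.
- move=> t z; rewrite /= updE; under eq_fun do rewrite /= updE.
  by apply: is_derive_line.
- move=> t; under eq_fun do rewrite /= updE.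
  case: ph' => ch' _; move=> z.
  apply: (@continuous_comp _ _ _ (fun z : R => tcol (upd t j 0) + z *: delta_mx j 0) h'); last exact: ch'.
  apply: continuousD; first exact: cst_continuous.
  by apply: continuousZl.
Qed.

End gaussian_moments.

(** * Gaussian moments *)

Section moments.
Context {R : realType} {n : nat}.
Implicit Types (h k : 'cV[R]_n -> R) (g : 'cV[R]_n).
Local Notation sq := (fun x : 'cV[R]_n => enorm x ^+ 2).

Lemma is_derive_sqr_enorm (x v : 'cV[R]_n) : is_derive x v sq (2 * dotc x v).
Proof.
have E : sq = (\sum_j (fun x : 'cV[R]_n => dotc (delta_mx j 0) x ^+ 2)).
  apply/funext => y; rewrite fct_sumE sqr_enormE.
  by apply: eq_bigr => j _; rewrite delta_dotc.
have d j : is_derive x v (fun x : 'cV[R]_n => dotc (delta_mx j 0) x ^+ 2)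
    (2 * (x j 0 * v j 0)).
  have dj := is_derive_dotc (delta_mx j 0) x v.
  by apply: is_derive_eq; rewrite !delta_dotc /GRing.scale/=; ring.
rewrite E; apply: is_derive_eq.
by rewrite mulr_sumr.
Qed.

(** Stein's identity for a vector field [H]: the right-hand side is the mean of its divergence. Each
    moment below comes from one choice of field. *)
Lemma gmean_stein_sum (H H' : 'I_n -> 'cV[R]_n -> R) :
  (forall j, poly_growth (H j)) -> (forall j, poly_growth (H' j)) ->
  (forall j x, is_derive x (delta_mx j 0) (H j) (H' j x)) ->
  gmean (fun x => \sum_j x j 0 * H j x) = \sum_j gmean (H' j).
Proof.
move=> pH pH' dH; rewrite gmean_sum; last first.
  by move=> j; apply: poly_growthM => //; exact: poly_growth_coord.
by apply: eq_bigr => j _; rewrite -(stein (pH j) (pH' j) (dH j)).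
Qed.

(** The field is [<g, x> g], of constant divergence [|g|^2]. *)
Lemma gmean_sqr_dotc g : gmean (fun x => dotc g x ^+ 2) = enorm g ^+ 2.
Proof.
have -> : (fun x => dotc g x ^+ 2) = (fun x => \sum_j x j 0 * (g j 0 * dotc g x)).
  apply/funext => x; rewrite expr2 {1}/dotc mulr_suml.
  by apply: eq_bigr => j _; ring.
transitivity (\sum_j gmean (fun x : 'cV[R]_n => g j 0 * g j 0)); last first.
  by under eq_bigr do rewrite gmean_cst; rewrite sqr_enorm.
apply: gmean_stein_sum.
- by move=> j; apply: poly_growthM; [exact: poly_growth_cst|exact: poly_growth_dotc].
- by move=> j; exact: poly_growth_cst.
- move=> j x; have dg := is_derive_dotc g x (delta_mx j 0).
  by apply: is_derive_eq; rewrite dotcC delta_dotc.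
Qed.

(** The field is [|x|^(2p) x], of divergence [(n + 2p) |x|^(2p)]. At [p = 0] the truncated exponent
    [p.-1] is multiplied by [p%:R = 0]. *)
Lemma gmean_sqr_enorm_pow p : gmean (fun x : 'cV[R]_n => enorm x ^+ 2 ^+ p.+1) =
  (n + p.*2)%:R * gmean (fun x : 'cV[R]_n => enorm x ^+ 2 ^+ p).
Proof.
have pq := @poly_growth_sqr_enorm R n.
have -> : (fun x : 'cV[R]_n => enorm x ^+ 2 ^+ p.+1) =
    (fun x => \sum_j x j 0 * (x j 0 * (enorm x ^+ 2) ^+ p)).
  apply/funext => x; rewrite exprS {1}sqr_enormE mulr_suml.
  by apply: eq_bigr => j _; ring.
transitivity (\sum_j gmean (fun x : 'cV[R]_n =>
    (enorm x ^+ 2) ^+ p + (2 * p%:R) * (x j 0 ^+ 2 * (enorm x ^+ 2) ^+ p.-1))).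
  apply: gmean_stein_sum.
- by move=> j; apply: poly_growthM; [exact: poly_growth_coord|exact: poly_growthX].
- move=> j; apply: poly_growthD; first exact: poly_growthX.
  apply: poly_growthM; first exact: poly_growth_cst.
  apply: poly_growthM; last exact: poly_growthX.
  by apply: poly_growthX; exact: poly_growth_coord.
- move=> j x; have dq := is_derive_sqr_enorm x (delta_mx j 0).
  have dj := is_derive_dotc (delta_mx j 0) x (delta_mx j 0).
  have D := is_deriveM dj (is_deriveX p dq).
  rewrite (_ : (fun x : 'cV[R]_n => _) = dotc (delta_mx j 0) * sq ^+ p); last first.
    by apply/funext => y; rewrite !fctE delta_dotc.
  apply: is_derive_eq.
  rewrite (dotcC x) !delta_dotc mxE !eqxx exprfctE /GRing.scale/=.
  by rewrite mulr1 addrC; congr (_ + _); ring.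
have pX q : poly_growth (fun x : 'cV[R]_n => (enorm x ^+ 2) ^+ q) by exact: poly_growthX.
have pj j : poly_growth (fun x : 'cV[R]_n => x j 0 ^+ 2 * (enorm x ^+ 2) ^+ p.-1).
  by apply: poly_growthM => //; apply: poly_growthX; exact: poly_growth_coord.
have pjZ j : poly_growth (fun x : 'cV[R]_n => (2 * p%:R) * (x j 0 ^+ 2 * (enorm x ^+ 2) ^+ p.-1)).
  by apply: poly_growthM => //; exact: poly_growth_cst.
under eq_bigr do rewrite gmeanD// gmeanZ//.
rewrite big_split/= sumr_const card_ord -mulr_sumr -gmean_sum//.
rewrite natrD [RHS]mulrDl [in RHS]mulr_natl; congr (_ + _).
case: p {pq pj pjZ} => [|p]; first by rewrite mulr0 !mul0r.
congr (_ * _); first by rewrite -natrM mul2n.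
by congr gmean; apply/funext => x; rewrite -mulr_suml -sqr_enormE -exprS.
Qed.

Lemma gmean_sqr_enorm : gmean (fun x : 'cV[R]_n => enorm x ^+ 2) = n%:R.
Proof.
have := gmean_sqr_enorm_pow 0; rewrite double0 addn0 => E.
under eq_fun do rewrite -[_ ^+ 2]expr1; rewrite E.
by under eq_fun do rewrite expr0; rewrite gmean_cst mulr1.
Qed.

Lemma gmean_enorm6 : gmean (fun x : 'cV[R]_n => (enorm x ^+ 2) ^+ 3) =
  n%:R * (n%:R + 2) * (n%:R + 4).
Proof.
rewrite gmean_sqr_enorm_pow gmean_sqr_enorm_pow.
under eq_fun do rewrite expr1; rewrite gmean_sqr_enorm (_ : 2.*2 = 4)%N// (_ : 1.*2 = 2)%N// !natrD; ring.
Qed.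

(** The field is [<g, x>^2 x], of divergence [(n + 2) <g, x>^2]. *)
Lemma gmean_sqr_dotc_sqr_enorm g :
  gmean (fun x => dotc g x ^+ 2 * enorm x ^+ 2) = (n%:R + 2) * enorm g ^+ 2.
Proof.
have pg := poly_growth_dotc g.
have -> : (fun x => dotc g x ^+ 2 * enorm x ^+ 2) =
    (fun x => \sum_j x j 0 * (x j 0 * dotc g x ^+ 2)).
  apply/funext => x; rewrite sqr_enormE mulr_sumr.
  by apply: eq_bigr => j _; ring.
have pj j : poly_growth (fun x : 'cV[R]_n => x j 0 * (g j 0 * dotc g x)).
  apply: poly_growthM; first exact: poly_growth_coord.
  by apply: poly_growthM => //; exact: poly_growth_cst.
transitivity (\sum_j gmean (fun x => dotc g x ^+ 2 + 2 * (x j 0 * (g j 0 * dotc g x)))).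
  apply: gmean_stein_sum.
- by move=> j; apply: poly_growthM; [exact: poly_growth_coord|exact: poly_growthX].
- move=> j; apply: poly_growthD; first exact: poly_growthX.
  by apply: poly_growthM => //; exact: poly_growth_cst.
- move=> j x; have dg := is_derive_dotc g x (delta_mx j 0).
  have dj := is_derive_dotc (delta_mx j 0) x (delta_mx j 0).
  rewrite (_ : (fun x : 'cV[R]_n => _) =
    (fun x : 'cV[R]_n => dotc (delta_mx j 0) x * dotc g x ^+ 2)); last first.
    by apply/funext => y; rewrite delta_dotc.
  apply: is_derive_eq.
  rewrite (dotcC g (delta_mx j 0)) !delta_dotc mxE !eqxx /GRing.scale/=; ring.
have pj2 j : poly_growth (fun x : 'cV[R]_n => 2 * (x j 0 * (g j 0 * dotc g x))).
  by apply: poly_growthM => //; exact: poly_growth_cst.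
have p2 : poly_growth (fun x => dotc g x ^+ 2) by exact: poly_growthX.
under eq_bigr do rewrite gmeanD// gmeanZ//.
rewrite big_split/= sumr_const card_ord -mulr_sumr -gmean_sum//.
rewrite (_ : (fun x => \sum_(i < n) _) = (fun x => dotc g x ^+ 2)); last first.
  apply/funext => x; rewrite expr2 {2}/dotc mulr_suml.
  by apply: eq_bigr => j _; ring.
by rewrite gmean_sqr_dotc -mulr_natl; ring.
Qed.

End moments.

(** * Gaussian smoothing *)

Section smoothing.
Context {R : realType} {n : nat}.
Variables (f : 'cV[R]_n -> R) (Lf mu : R).
Hypotheses (df : forall x, differentiable f x) (mu0 : 0 < mu) (Lf0 : 0 < Lf).
Hypothesis Lip : forall x y, enorm (grad f x - grad f y) <= Lf * enorm (x - y).
Implicit Types x v w : 'cV[R]_n.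

(* The mean of the zeroth-order gradient of h. By Stein's identity it is also
   the mean of grad h (x + mu v), so it can be used as the gradient of the
   smoothing without differentiating under the integral. *)
Definition gsmooth_grad (h : 'cV[R]_n -> R) x : 'cV[R]_n :=
  \col_j gmean (fun v => v j 0 * ((h (x + mu *: v) - h x) / mu)).

Lemma poly_growth_le (h k : 'cV[R]_n -> R) : continuous h -> poly_growth k ->
  (forall x, `|h x| <= k x) -> poly_growth h.
Proof.
move=> ch [_ [C [m kC]]] hk; split => //; exists C, m => x.
by apply: le_trans (hk x) (le_trans (ler_norm _) (kC x)).
Qed.

Let cf : continuous f.
Proof. by move=> x; apply: (@differentiable_continuous R _ R^o); exact: df. Qed.

Let shift_continuous x : continuous (fun v : 'cV[R]_n => x + mu *: v).
Proof.
by move=> v; apply: continuousD; [exact: cst_continuous|exact: continuousZl_tmp].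
Qed.

Lemma poly_growth_shift x : poly_growth (fun v => f (x + mu *: v)).
Proof.
pose k v := `|f x| + enorm (grad f x) * mu * (1 + enorm v ^+ 2)
           + Lf / 2 * mu ^+ 2 * enorm v ^+ 2.
have pq := @poly_growth_sqr_enorm R n.
apply: (@poly_growth_le _ k).
- by move=> v; apply: continuous_comp; [exact: shift_continuous|exact: cf].
- apply: poly_growthD; last by apply: poly_growthM => //; exact: poly_growth_cst.
  apply: poly_growthD; first exact: poly_growth_cst.
  apply: poly_growthM; first exact: poly_growth_cst.
  by apply: poly_growthD => //; exact: poly_growth_cst.
- move=> v; have := lip_grad_quad x (mu *: v) df Lip.
  rewrite enormZ (gtr0_norm mu0) exprMn mulrA => B.
  have D := normr_dotc (grad f x) (mu *: v).
  have E : enorm (grad f x) * enorm (mu *: v) <= enorm (grad f x) * mu * (1 + enorm v ^+ 2).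
    rewrite enormZ (gtr0_norm mu0) mulrA ler_wpM2l ?mulr_ge0 ?enorm_ge0// ?(ltW mu0)//.
    by have := sqr_ge0 (enorm v - 1); rewrite sqrrB; have := enorm_ge0 v; lra.
  have -> : f (x + mu *: v) = f x + dotc (grad f x) (mu *: v)
      + (f (x + mu *: v) - f x - dotc (grad f x) (mu *: v)) by ring.
  apply: le_trans (ler_normD _ _) _; apply: lerD => //.
  apply: le_trans (ler_normD _ _) _; apply: lerD => //.
  exact: le_trans E.
Qed.

Lemma poly_growth_grad_shift x w : poly_growth (fun v => dotc (grad f (x + mu *: v)) w).
Proof.
have pq := @poly_growth_sqr_enorm R n.
apply: (@poly_growth_le _ (fun v =>
   (enorm (grad f x) + Lf * mu * (1 + enorm v ^+ 2)) * enorm w)).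
- move=> v; apply: (@continuous_comp _ _ _ (fun v => x + mu *: v) (fun y => dotc (grad f y) w)).
    exact: shift_continuous.
  exact: (lip_grad_continuous Lip).
- apply: poly_growthM; last exact: poly_growth_cst.
  apply: poly_growthD; first exact: poly_growth_cst.
  apply: poly_growthM; first exact: poly_growth_cst.
  by apply: poly_growthD => //; exact: poly_growth_cst.
move=> v; apply: le_trans (normr_dotc _ _) _; rewrite ler_wpM2r ?enorm_ge0//.
rewrite -[grad f (x + _)](subrK (grad f x)) addrC; apply: le_trans (ler_enormD _ _) _.
rewrite lerD2l; apply: le_trans (Lip _ _) _.
rewrite addrC addKr enormZ (gtr0_norm mu0) mulrA ler_wpM2l ?mulr_ge0// ?(ltW mu0) ?(ltW Lf0)//.
by have := sqr_ge0 (enorm v - 1); rewrite sqrrB; have := enorm_ge0 v; lra.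
Qed.

(** Stein's identity in each coordinate for [v |-> (f (x + mu v) - f x) / mu], whose derivative is
    the coordinate of [grad f (x + mu v)] because the two factors [mu] cancel. *)
Lemma dotc_gsmooth_grad x w :
  dotc (gsmooth_grad f x) w = gmean (fun v => dotc (grad f (x + mu *: v)) w).
Proof.
have pj j : poly_growth (fun v => dotc (grad f (x + mu *: v)) (delta_mx j 0)).
  exact: poly_growth_grad_shift.
have ph : poly_growth (fun v => (f (x + mu *: v) - f x) / mu).
  apply: poly_growthM; last exact: poly_growth_cst.
  by apply: poly_growthD; [exact: poly_growth_shift|exact: poly_growth_cst].
have S j : gmean (fun v => dotc (grad f (x + mu *: v)) (delta_mx j 0)) = gsmooth_grad f x j 0.
  rewrite mxE; apply: stein => // v.
  have d1 : is_derive v (delta_mx j 0 : 'cV[R]_n) (fun v => f (x + mu *: v))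
      (mu * dotc (grad f (x + mu *: v)) (delta_mx j 0)).
    have dg := is_derive_grad (mu *: delta_mx j 0) (df (x + mu *: v)).
    have E : (fun h : R => h^-1 *: (((fun v => f (x + mu *: v)) \o shift v) (h *: delta_mx j 0)
             - f (x + mu *: v)))
           = (fun h : R => h^-1 *: ((f \o shift (x + mu *: v)) (h *: (mu *: delta_mx j 0))
             - f (x + mu *: v))).
      apply/funext => h /=; congr (_ *: (f _ - _)).
      by rewrite scalerDr addrCA !scalerA (mulrC mu).
    case: dg => dg1 dg2; rewrite dotcZr in dg2.
    by apply: DeriveDef; rewrite ?/derivable ?/derive E.
  apply: is_derive_eq; rewrite /GRing.scale/=; field; exact: lt0r_neq0.
rewrite (_ : (fun v => dotc _ w) =
    (fun v => \sum_j w j 0 * dotc (grad f (x + mu *: v)) (delta_mx j 0))); last first.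
  apply/funext => v; apply: eq_bigr => j _.
  by rewrite (dotcC _ (delta_mx j 0)) delta_dotc mulrC.
rewrite gmean_sum; last first.
  by move=> j; apply: poly_growthM => //; exact: poly_growth_cst.
by apply: eq_bigr => j _; rewrite gmeanZ// S mulrC.
Qed.

(** The inequality is assumed at every base point with the same [d] and [c], hence can be averaged
    over [x + mu v]. It is used with block displacements and with arbitrary ones. *)
Lemma gsmooth_block_descent x d c :
  (forall y, f (y + d) <= f y + dotc (grad f y) d + c) ->
  gsmooth mu f (x + d) <= gsmooth mu f x + dotc (gsmooth_grad f x) d + c.
Proof.
move=> H; rewrite dotc_gsmooth_grad.
have p1 := poly_growth_shift x; have p2 := poly_growth_grad_shift x d.
have p3 := poly_growthD p1 p2; have p4 := @poly_growth_cst R n c.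
have -> : gsmooth mu f x + gmean (fun v => dotc (grad f (x + mu *: v)) d) + c =
    gmean (fun v => f (x + mu *: v) + dotc (grad f (x + mu *: v)) d + c).
  by rewrite (gmeanD p3 p4) (gmeanD p1 p2) gmean_cst.
rewrite [leLHS](_ : _ = gmean (fun v => f (x + d + mu *: v)))//.
apply: le_gmean.
- exact: poly_growth_shift.
- by apply: poly_growthD; [exact: poly_growthD|exact: poly_growth_cst].
- by move=> v; have := H (x + mu *: v); rewrite addrAC.
Qed.

(** Testing the error [D] against itself, [|D|^2] is the mean of
    [<grad f (x + mu v) - grad f x, D>], at most [|D|^2 / 2] plus half the mean of
    [Lf^2 mu^2 |v|^2]; the first term is absorbed. *)
Lemma sqr_gsmooth_grad_err x :
  enorm (gsmooth_grad f x - grad f x) ^+ 2 <= Lf ^+ 2 * mu ^+ 2 * n%:R.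
Proof.
set D := gsmooth_grad f x - grad f x.
have pq := @poly_growth_sqr_enorm R n.
have p2 := poly_growth_grad_shift x D.
have E : enorm D ^+ 2 = gmean (fun v => dotc (grad f (x + mu *: v)) D - dotc (grad f x) D).
  rewrite sqr_enorm {1}/D dotcBl dotc_gsmooth_grad gmeanD//; last exact: poly_growth_cst.
  by rewrite gmean_cst.
have : enorm D ^+ 2 <= gmean (fun v => enorm D ^+ 2 / 2 + (Lf ^+ 2 * mu ^+ 2 / 2) * enorm v ^+ 2).
  rewrite {1}E; apply: le_gmean.
  - by apply: poly_growthD => //; exact: poly_growth_cst.
  - apply: poly_growthD; first exact: poly_growth_cst.
    by apply: poly_growthM => //; exact: poly_growth_cst.
  move=> v; rewrite -dotcBl; apply: le_trans (dotc_le_sqr _ _) _; rewrite addrC lerD2l.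
  have := Lip (x + mu *: v) x; rewrite [x + _]addrC addrK enormZ (gtr0_norm mu0) => Lv.
  have : enorm (grad f (mu *: v + x) - grad f x) ^+ 2 <= (Lf * (mu * enorm v)) ^+ 2.
    by rewrite lerXn2r ?nnegrE ?enorm_ge0// (le_trans (enorm_ge0 _) Lv).
  by rewrite !exprMn; lra.
rewrite gmeanD; [|exact: poly_growth_cst|by apply: poly_growthM => //; exact: poly_growth_cst].
by rewrite gmean_cst gmeanZ// gmean_sqr_enorm; lra.
Qed.

End smoothing.

(** * The stochastic oracle *)

Section oracle_mean.
Context {R : realType} {n : nat} {d : measure_display} {Xi : measurableType d}.
Variables (Q : probability Xi R) (F : 'cV[R]_n -> Xi -> R) (f : 'cV[R]_n -> R).
Hypothesis gradFf : forall x j,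
  Q.-integrable setT (fun z => (grad (F ^~ z) x j 0)%:E) /\
  ('E_Q[fun z => (grad (F ^~ z) x j 0)%R] = (grad f x j 0)%:E)%E.
Implicit Types x y w : 'cV[R]_n.

Lemma measurable_cv_gradF x : measurable_cv (fun z => grad (F ^~ z) x).
Proof.
by move=> j; have [/(measurable_int Q)] := gradFf x j; move/measurable_EFinP.
Qed.

Lemma integrable_dotc_gradF x w :
  Q.-integrable setT (fun z => (dotc (grad (F ^~ z) x) w)%:E).
Proof.
rewrite (_ : (fun z => _) =
    (fun z => \sum_j (w j 0)%:E * (grad (F ^~ z) x j 0)%:E)%E); last first.
  apply/funext => z; rewrite /dotc sumEFin; congr _%:E.
  by apply: eq_bigr => j _; rewrite mulrC.
by apply: integrable_sum => // j _; apply: integrableZl => //; have [] := gradFf x j.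
Qed.

Lemma mean_dotc_gradF x w :
  (\int[Q]_z (dotc (grad (F ^~ z) x) w)%:E = (dotc (grad f x) w)%:E)%E.
Proof.
under eq_integral => z _.
  rewrite (_ : (dotc _ w)%:E = \sum_j (w j 0)%:E * (grad (F ^~ z) x j 0)%:E)%E; last first.
    rewrite /dotc sumEFin; congr _%:E.
    by apply: eq_bigr => j _; rewrite mulrC.
  over.
rewrite integral_sum//; last first.
  by move=> j; apply: integrableZl => //; have [] := gradFf x j.
rewrite /dotc -sumEFin; apply: eq_bigr => j _; have [ij Ej] := gradFf x j.
rewrite integralZl//; move: Ej; rewrite unlock /= => ->.
by rewrite -EFinM mulrC.
Qed.

(** Testing the mean difference [D] against itself turns a bound on almost every sample into
    [|D|^2 <= c |D|]. The matrix [A] is the identity for the full bound and the transpose of [Umx s]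
    for the block bounds. *)
Lemma mean_grad_lipschitz k (A : 'M[R]_(k, n)) x y (c : R) : 0 <= c ->
  {ae Q, forall z, enorm (A *m grad (F ^~ z) x - A *m grad (F ^~ z) y) <= c} ->
  enorm (A *m grad f x - A *m grad f y) <= c.
Proof.
move=> c0 ae; set D := A *m _ - _; pose w := A^T *m D.
have adj (v : 'cV[R]_n) : dotc v w = dotc (A *m v) D by rewrite dotc_mulmx.
have E : enorm D ^+ 2 = dotc (grad f x) w - dotc (grad f y) w.
  by rewrite !adj -dotcBl sqr_enorm.
have : ((enorm D ^+ 2)%:E <= (c * enorm D)%:E)%E.
  rewrite E EFinB -(mean_dotc_gradF x w) -(mean_dotc_gradF y w).
  rewrite -integralB//; try exact: integrable_dotc_gradF.
  rewrite [leRHS](_ : _ = \int[Q]_z (c * enorm D)%:E)%E; last first.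
    by rewrite integral_cst//= probability_setT mule1.
  have cD : 0 <= c * enorm D by rewrite mulr_ge0// enorm_ge0.
  set h := (fun z => (dotc (grad (F ^~ z) x) w)%:E - (dotc (grad (F ^~ z) y) w)%:E)%E.
  have ih : Q.-integrable setT h by apply: integrableB => //; exact: integrable_dotc_gradF.
  (* The integrand is replaced by its positive part, since the comparison under an almost sure bound
     is made for nonnegative functions. *)
  apply: (@le_trans _ _ (\int[Q]_z (h^\+ z)%E)%E).
    apply: le_integral => //; first exact: integrable_funepos.
    by move=> z _; rewrite funeposE le_max lexx.
  apply: ae_ge0_le_integral => //.
  - by apply: measurable_funepos; exact: measurable_int ih.
  - apply: filterS ae => z le _; rewrite funeposE ge_max; apply/andP; split; last by rewrite lee_fin.
    rewrite /h -EFinB lee_fin !adj -dotcBl.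
    by apply: le_trans (dotc_le_enorm _ _) _; rewrite ler_wpM2r// enorm_ge0.
rewrite lee_fin expr2; have [->//|D0] := eqVneq (enorm D) 0.
by rewrite ler_pM2r// lt_neqAle eq_sym D0 enorm_ge0.
Qed.

End oracle_mean.

(** * Mean and second moment of the zeroth-order gradient *)

Section zeroth_order_gradient.
Context {R : realType} {n : nat} {d : measure_display} {Xi : measurableType d}.
Variables (Q : probability Xi R) (F : 'cV[R]_n -> Xi -> R) (f : 'cV[R]_n -> R).
Variables (Lf mu sigma M : R) (x : 'cV[R]_n).
Local Notation gaussian := (@std_gaussian R n).
Hypothesis mF : measurable_fun setT (fun z : n.-tuple R * Xi => F (tcol z.1) z.2).
Hypotheses (Lf0 : 0 < Lf) (mu0 : 0 < mu).
Hypothesis df : forall x, differentiable f x.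
Hypothesis Lip : forall x y, enorm (grad f x - grad f y) <= Lf * enorm (x - y).
Hypothesis Ff : forall x,
  Q.-integrable setT (EFin \o F x) /\ ('E_Q[F x] = (f x)%:E)%E.
Hypothesis gradFf : forall x j,
  Q.-integrable setT (fun z => (grad (F ^~ z) x j 0)%:E) /\
  ('E_Q[fun z => (grad (F ^~ z) x j 0)%R] = (grad f x j 0)%:E)%E.
Hypothesis varF : ('E_Q[fun z => (enorm (grad (F ^~ z) x - grad f x) ^+ 2)%R]
           <= (sigma ^+ 2)%:E)%E.
Hypothesis LipF : {ae Q, forall z, (forall x, differentiable (F ^~ z) x) /\
   forall x y, enorm (grad (F ^~ z) x - grad (F ^~ z) y) <= Lf * enorm (x - y)}.
Hypothesis gradM : enorm (grad f x) <= M.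

Definition zo_variance : R :=
  4 * (n%:R + 4) * (2 * M ^+ 2 + sigma ^+ 2 + mu ^+ 2 * Lf ^+ 2 * (n%:R + 4) ^+ 2).

Definition zo_grad (p : n.-tuple R * Xi) : 'cV[R]_n :=
  ((F (x + mu *: tcol p.1) p.2 - F x p.2) / mu) *: tcol p.1.

Lemma measurable_F {d'} {T : measurableType d'} (g : T -> 'cV[R]_n) (zeta : T -> Xi) :
  measurable_cv g -> measurable_fun setT zeta ->
  measurable_fun setT (fun w => F (g w) (zeta w)).
Proof.
move=> mg mz.
rewrite (_ : (fun w => _) = (fun z : n.-tuple R * Xi => F (tcol z.1) z.2) \o
   (fun w => ([tuple g w j 0 | j < n], zeta w))); last first.
  by apply/funext => w /=; rewrite tcol_tuple.
apply: measurableT_comp => //; apply: measurable_fun_pair => //.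
exact: measurable_cv_tuple.
Qed.

Lemma measurable_cv_Gmu {d'} {T : measurableType d'} (g v : T -> 'cV[R]_n) (zeta : T -> Xi) :
  measurable_cv g -> measurable_cv v -> measurable_fun setT zeta ->
  measurable_cv (fun w => ((F (g w + mu *: v w) (zeta w) - F (g w) (zeta w)) / mu) *: v w).
Proof.
move=> mg mv mz; apply: measurable_cvZ => //; apply: measurable_funM => //.
apply: measurable_funB; apply: measurable_F => //.
by apply: measurable_cvD => //; apply: measurable_cvZ.
Qed.

Lemma measurable_cv_comp {d1 d2} {T1 : measurableType d1} {T2 : measurableType d2} {m}
  (g : T2 -> 'cV[R]_m) (h : T1 -> T2) :
  measurable_cv g -> measurable_fun setT h -> measurable_cv (g \o h).
Proof. by move=> mg mh j; exact: (measurableT_comp (mg j) mh). Qed.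

Lemma measurable_cv_zo_grad : measurable_cv zo_grad.
Proof.
apply: (measurable_cv_Gmu (g := fun=> x) (v := fun p => tcol p.1) (zeta := snd)).
- exact: measurable_cv_cst.
- exact: (measurable_cv_comp measurable_cv_tcol measurable_fst).
- exact: measurable_snd.
Qed.

(** The difference quotient is [<grad F, v>] plus a remainder of size at most [Lf mu |v|^2 / 2]; the
    square of the sum is at most twice the sum of squares. *)
Lemma zo_grad_bound z (v : 'cV[R]_n) : (forall x, differentiable (F ^~ z) x) ->
  (forall x y, enorm (grad (F ^~ z) x - grad (F ^~ z) y) <= Lf * enorm (x - y)) ->
  enorm (((F (x + mu *: v) z - F x z) / mu) *: v) ^+ 2 <=
  2 * (dotc (grad (F ^~ z) x) v ^+ 2 * enorm v ^+ 2)
  + Lf ^+ 2 * mu ^+ 2 / 2 * (enorm v ^+ 2) ^+ 3.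
Proof.
move=> dz Lz; have := lip_grad_quad x (mu *: v) dz Lz.
rewrite dotcZr enormZ (gtr0_norm mu0) exprMn.
set q := F _ z - F x z; set a := dotc _ v; set e := enorm v => B.
rewrite enormZ exprMn real_normK ?num_real// -/e.
have -> : (q / mu) ^+ 2 = (a + (q - mu * a) / mu) ^+ 2.
  by congr (_ ^+ 2); field; rewrite gt_eqF.
have C : ((q - mu * a) / mu) ^+ 2 <= (Lf / 2 * mu * e ^+ 2) ^+ 2.
  have r0 : 0 <= Lf / 2 * mu * e ^+ 2.
    by rewrite mulr_ge0 ?sqr_ge0// mulr_ge0 ?(ltW mu0)// mulr_ge0 ?(ltW Lf0)// invr_ge0.
  rewrite -(@real_normK _ ((q - mu * a) / mu)) ?num_real// lerXn2r ?nnegrE//.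
  rewrite normrM [`|mu^-1|]gtr0_norm ?invr_gt0// ler_pdivrMr//; apply: le_trans B _.
  by rewrite le_eqVlt; apply/orP; left; apply/eqP; ring.
set r := (q - mu * a) / mu in C *.
have D : (a + r) ^+ 2 <= 2 * a ^+ 2 + 2 * (Lf / 2 * mu * e ^+ 2) ^+ 2.
  by have := sqr_ge0 (a - r); rewrite sqrrB sqrrD; lra.
apply: le_trans (ler_wpM2r (sqr_ge0 e) D) _.
by rewrite le_eqVlt; apply/orP; left; apply/eqP; field.
Qed.

(** The Gaussian vector is integrated first, at a fixed oracle sample, because the Lipschitz bound
    holds for almost every sample. Then [|grad F|^2] is at most [2 |grad F - grad f|^2 + 2 M^2], and
    the variance bound applies. *)
Lemma zo_grad_second_moment :
  (\int[gaussian \x Q]_p (enorm (zo_grad p) ^+ 2)%:E <= zo_variance%:E)%E.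
Proof.
have mG2 : measurable_fun setT (fun p => (enorm (zo_grad p) ^+ 2)%:E).
  by apply/measurable_EFinP; exact: measurable_sqr_enorm measurable_cv_zo_grad.
rewrite fubini_tonelli2//; last by move=> p; rewrite lee_fin sqr_ge0.
pose B (z : Xi) : R := 4 * (n%:R + 2) * (enorm (grad (F ^~ z) x - grad f x) ^+ 2)
  + (4 * (n%:R + 2) * M ^+ 2 + Lf ^+ 2 * mu ^+ 2 / 2 * (n%:R * (n%:R + 2) * (n%:R + 4))).
have c0 : 0 <= 4 * (n%:R + 2) :> R by rewrite mulr_ge0// addr_ge0.
have c1 : 0 <= 4 * (n%:R + 2) * M ^+ 2 + Lf ^+ 2 * mu ^+ 2 / 2 * (n%:R * (n%:R + 2) * (n%:R + 4)).
  apply: addr_ge0; first by rewrite mulr_ge0// sqr_ge0.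
  apply: mulr_ge0; first by rewrite divr_ge0// mulr_ge0// sqr_ge0.
  by rewrite mulr_ge0// ?addr_ge0// mulr_ge0// addr_ge0.
have mB1 : measurable_fun setT (fun z => (enorm (grad (F ^~ z) x - grad f x) ^+ 2)).
  apply: measurable_sqr_enorm; apply: measurable_cvB; last exact: measurable_cv_cst.
  exact: (measurable_cv_gradF gradFf).
apply: (@le_trans _ _ (\int[Q]_z (B z)%:E)%E).
  apply: ae_ge0_le_integral => //.
  - by move=> z _; apply: integral_ge0 => t _; rewrite lee_fin sqr_ge0.
  - by apply: measurable_fun_fubini_tonelli_G => // p; rewrite lee_fin sqr_ge0.
  - by move=> z _; rewrite lee_fin addr_ge0// mulr_ge0// sqr_ge0.
  - apply/measurable_EFinP; apply: measurable_funD => //.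
    by apply: measurable_funM.
  - apply: filterS LipF => z [dz Lz] _.
    have pq := @poly_growth_sqr_enorm R n.
    have pd := poly_growthX 2 (poly_growth_dotc (grad (F ^~ z) x)).
    have pdq := poly_growthM pd pq; have p6 := poly_growthX 3 pq.
    have p1 := poly_growthM (@poly_growth_cst R n 2) pdq.
    have p2 := poly_growthM (@poly_growth_cst R n (Lf ^+ 2 * mu ^+ 2 / 2)) p6.
    have p12 := poly_growthD p1 p2.
    apply: (@le_trans _ _ (\int[gaussian]_t (2 * (dotc (grad (F ^~ z) x) (tcol t) ^+ 2 * enorm (tcol t) ^+ 2)
       + Lf ^+ 2 * mu ^+ 2 / 2 * (enorm (tcol t) ^+ 2) ^+ 3)%:E)%E).
      apply: ge0_le_integral => //.
      - by move=> t _; rewrite lee_fin sqr_ge0.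
      - by apply: measurableT_comp mG2 (pair2_measurable z).
      - by apply/measurable_EFinP; exact: (poly_growth_measurable p12).
      - by move=> t _; rewrite lee_fin; exact: zo_grad_bound.
    rewrite -(gmeanE p12) lee_fin (gmeanD p1 p2) !gmeanZ// gmean_enorm6 gmean_sqr_dotc_sqr_enorm.
    rewrite /B.
    have : enorm (grad (F ^~ z) x) ^+ 2 <=
        2 * enorm (grad (F ^~ z) x - grad f x) ^+ 2 + 2 * M ^+ 2.
      rewrite -[X in enorm X ^+ 2 <= _](subrK (grad f x)).
      apply: le_trans (sqr_enormD_le _ _) _; rewrite lerD2l ler_pM2l//.
      by rewrite lerXn2r ?nnegrE ?enorm_ge0// (le_trans (enorm_ge0 _) gradM).
    move=> H; have n2 : 0 <= n%:R + 2 :> R by rewrite addr_ge0.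
    have := ler_wpM2l n2 H; lra.
under eq_integral do rewrite /B EFinD.
have mB2 : measurable_fun setT (fun z => (4 * (n%:R + 2) * enorm (grad (F ^~ z) x - grad f x) ^+ 2)%:E).
  by apply/measurable_EFinP; apply: measurable_funM.
rewrite ge0_integralD//; last first.
  by move=> z _; rewrite lee_fin mulr_ge0// sqr_ge0.
rewrite integral_cst//= probability_setT mule1.
under eq_integral do rewrite EFinM.
rewrite ge0_integralZl//; last 2 first.
- by apply/measurable_EFinP.
- by move=> z _; rewrite lee_fin sqr_ge0.
move: varF; rewrite unlock /= => v.
apply: (@le_trans _ _ ((4 * (n%:R + 2))%:E * (sigma ^+ 2)%:E + (4 * (n%:R + 2) * M ^+ 2 +
   Lf ^+ 2 * mu ^+ 2 / 2 * (n%:R * (n%:R + 2) * (n%:R + 4)))%:E)%E).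
  by rewrite leeD2r// lee_wpmul2l.
rewrite -EFinM -EFinD lee_fin /zo_variance.
have a0 : 0 <= Lf ^+ 2 * mu ^+ 2 by rewrite mulr_ge0// sqr_ge0.
have b0 : 0 <= n%:R :> R by [].
have M0 := sqr_ge0 M; have s0 := sqr_ge0 sigma.
set N : R := n%:R in b0 *.
have h1 : 4 * (N + 2) * sigma ^+ 2 <= 4 * (N + 4) * sigma ^+ 2 by rewrite ler_wpM2r//; lra.
have h2 : 4 * (N + 2) * M ^+ 2 <= 4 * (N + 4) * (2 * M ^+ 2).
  by rewrite mulrA ler_wpM2r//; lra.
have h3 : Lf ^+ 2 * mu ^+ 2 / 2 * (N * (N + 2) * (N + 4)) <=
    4 * (N + 4) * (mu ^+ 2 * Lf ^+ 2 * (N + 4) ^+ 2).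
  have -> : 4 * (N + 4) * (mu ^+ 2 * Lf ^+ 2 * (N + 4) ^+ 2) =
    (Lf ^+ 2 * mu ^+ 2) * (4 * (N + 4) ^+ 3) by ring.
  rewrite -mulrA ler_wpM2l//; nra.
lra.
Qed.

Lemma zo_grad_integrable w :
  (gaussian \x Q)%E.-integrable setT (fun p => (dotc (zo_grad p) w)%:E).
Proof.
have mG2 : measurable_fun setT (fun p => (enorm (zo_grad p) ^+ 2)%:E).
  by apply/measurable_EFinP; exact: measurable_sqr_enorm measurable_cv_zo_grad.
have i2 : (gaussian \x Q)%E.-integrable setT (fun p => (enorm (zo_grad p) ^+ 2)%:E).
  apply/integrableP; split => //; under eq_integral do rewrite gee0_abs ?lee_fin ?sqr_ge0//.
  by apply: le_lt_trans zo_grad_second_moment _; rewrite ltry.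
have i1 : (gaussian \x Q)%E.-integrable setT (fun=> (enorm w ^+ 2)%:E).
  exact: (@finite_measure_integrable_cst _ _ _ (gaussian \x Q : probability _ _)%E).
apply: le_integrable (integrableD measurableT i2 i1) => //.
  apply/measurable_EFinP; apply: measurable_dotc; last exact: measurable_cv_cst.
  exact: measurable_cv_zo_grad.
move=> p _; rewrite /= lee_fin [leRHS]ger0_norm ?addr_ge0 ?sqr_ge0//.
apply: le_trans (normr_dotc _ _) _.
have := sqr_ge0 (enorm (zo_grad p) - enorm w); rewrite sqrrB.
have := sqr_ge0 (enorm (zo_grad p)); have := sqr_ge0 (enorm w); have := enorm_ge0 w.
have := enorm_ge0 (zo_grad p); nra.
Qed.

(** Integrating the oracle sample first replaces [F] by [f] at a fixed direction; what remains is
    the definition of [gsmooth_grad] tested against [w]. *)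
Lemma zo_grad_mean w :
  (\int[gaussian \x Q]_p (dotc (zo_grad p) w)%:E = (dotc (gsmooth_grad mu f x) w)%:E)%E.
Proof.
rewrite -integral12_prod_meas1; last exact: zo_grad_integrable.
have ps := poly_growth_shift df mu0 Lip x.
have ph : poly_growth (fun v => (f (x + mu *: v) - f x) / mu).
  apply: poly_growthM; last exact: poly_growth_cst.
  by apply: poly_growthD => //; exact: poly_growth_cst.
have pj j : poly_growth (fun v : 'cV[R]_n => v j 0 * ((f (x + mu *: v) - f x) / mu)).
  by apply: poly_growthM => //; exact: poly_growth_coord.
have pwj j : poly_growth (fun v : 'cV[R]_n => w j 0 * (v j 0 * ((f (x + mu *: v) - f x) / mu))).
  by apply: poly_growthM => //; exact: poly_growth_cst.
have -> : dotc (gsmooth_grad mu f x) w =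
    gmean (fun v => \sum_j w j 0 * (v j 0 * ((f (x + mu *: v) - f x) / mu))).
  by rewrite gmean_sum//; apply: eq_bigr => j _; rewrite gmeanZ// mxE mulrC.
rewrite gmeanE; last exact: poly_growth_sum.
apply: eq_integral => t _; rewrite /fubini_F /zo_grad /=.
have [i1 E1] := Ff (x + mu *: tcol t); have [i0 E0] := Ff x.
rewrite unlock /= in E1; rewrite unlock /= in E0.
transitivity (\int[Q]_z ((dotc (tcol t) w / mu)%:E * ((F (x + mu *: tcol t) z)%:E - (F x z)%:E)))%E.
  by apply: eq_integral => z _; rewrite -EFinB -EFinM dotcZl; congr _%:E; ring.
rewrite integralZl//; last by apply: integrableB.
rewrite integralB// E1 E0 -EFinB -EFinM; congr _%:E.
rewrite {1}/dotc mulr_suml mulr_suml; apply: eq_bigr => j _; ring.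
Qed.

End zeroth_order_gradient.

(** * Decoupling independent groups of sources *)

Section decoupling.
Context {d : measure_display} {Omega : measurableType d} {R : realType}.
Variables (P : probability Omega R) (G1 G2 : set (set Omega)).
Hypotheses (mG1 : G1 `<=` measurable) (mG2 : G2 `<=` measurable).
Hypotheses (IG1 : setI_closed G1) (IG2 : setI_closed G2).
Hypotheses (TG1 : G1 setT) (TG2 : G2 setT).
Hypothesis indep : forall A B, G1 A -> G2 B -> P (A `&` B) = (P A * P B)%E.

Lemma sigma_measurable (G : set (set Omega)) : G `<=` measurable ->
  <<s G >> `<=` measurable.
Proof.
by move=> GM; apply: smallest_sub => //; exact: sigma_algebra_measurable.
Qed.

(** [A |-> P (A /\ B)] and [A |-> P A * P B] are finite measures that agree on a pi-system
    containing the whole space. Two uses, one per factor, extend independence to both generated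
    sigma-algebras. *)
Let half_unique (G : set (set Omega)) (B : set Omega) : measurable B ->
  G `<=` measurable -> setI_closed G -> G setT ->
  (forall A, G A -> P (A `&` B) = (P A * P B)%E) ->
  forall A, <<s G >> A -> P (A `&` B) = (P A * P B)%E.
Proof.
move=> mB GM GI GT GE A GA.
have PB0 : 0 <= fine (P B) by rewrite fine_ge0.
rewrite -[LHS]/(mrestr P mB A).
have PBE : P B = (fine (P B))%:E by rewrite fineK// fin_num_measure.
have -> : (P A * P B)%E = mscale (NngNum PB0) P A by rewrite /mscale/= -PBE muleC.
apply: (@g_sigma_algebra_measure_unique _ _ _ G GM (fun=> setT)) => //.
- by rewrite bigcup_const//; exists 0%N.
- by move=> C GC; rewrite /= /mrestr /mscale/= -PBE muleC GE.
- move=> _; rewrite /= /mrestr setTI; apply: le_lt_trans (probability_le1 P mB) _.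
  by rewrite ltry.
Qed.

Lemma indep_sigma A B : <<s G1 >> A -> <<s G2 >> B -> P (A `&` B) = (P A * P B)%E.
Proof.
move=> sA sB; apply: half_unique (sA) => //; first exact: (sigma_measurable mG2).
move=> C GC; rewrite setIC muleC; apply: half_unique (sB) => //; first exact: mG1.
by move=> D GD; rewrite setIC muleC indep.
Qed.

Local Notation O1 := (g_sigma_algebraType G1).
Local Notation O2 := (g_sigma_algebraType G2).

(** The identity, seen as a random variable with values in [Omega] equipped with a smaller
    sigma-algebra. Independence of the two sigma-algebras becomes a statement on the law of the pair
    [diag]. *)
Definition to1 (w : Omega) : O1 := w.
Definition to2 (w : Omega) : O2 := w.
Definition diag (w : Omega) : O1 * O2 := (to1 w, to2 w).

Lemma measurable_to1 : measurable_fun setT to1.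
Proof. by move=> _ A mA; rewrite setTI; exact: (sigma_measurable mG1). Qed.

Lemma measurable_to2 : measurable_fun setT to2.
Proof. by move=> _ A mA; rewrite setTI; exact: (sigma_measurable mG2). Qed.

Lemma measurable_diag : measurable_fun setT diag.
Proof. by apply: measurable_fun_pair; [exact: measurable_to1|exact: measurable_to2]. Qed.

HB.instance Definition _ := @isMeasurableFun.Build _ _ _ _ to1 measurable_to1.
HB.instance Definition _ := @isMeasurableFun.Build _ _ _ _ to2 measurable_to2.
HB.instance Definition _ := @isMeasurableFun.Build _ _ _ _ diag measurable_diag.

Let P1 : probability O1 R := distribution P to1.
Let P2 : probability O2 R := distribution P to2.
Let P12 : probability (O1 * O2)%type R := distribution P diag.

Let law_diag (X : set (O1 * O2)) : measurable X -> (P1 \x P2)%E X = P12 X.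
Proof.
apply: product_measure_unique => A B mA mB.
by rewrite /P12 /P1 /P2 /= /distribution /pushforward -indep_sigma.
Qed.

(* The law of w |-> (w, w) on the product of the two sigma-algebras is the
   product law, so Tonelli applies. *)
Lemma decouple_ge0 (H : O1 * O2 -> \bar R) : measurable_fun setT H ->
  (forall p, (0 <= H p)%E) ->
  (\int[P]_w H (diag w) = \int[P]_w1 \int[P]_w2 H (to1 w1, to2 w2))%E.
Proof.
move=> mH H0.
rewrite -[LHS](ge0_integral_distribution (P := P) diag mH H0).
rewrite (eq_measure_integral (P1 \x P2)%E); last by move=> A mA _; exact/esym/law_diag.
rewrite fubini_tonelli1// (ge0_integral_distribution (P := P) to1); last 2 first.
- exact: measurable_fun_fubini_tonelli_F.
- by move=> w; apply: integral_ge0.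
apply: eq_integral => w _ /=; rewrite /fubini_F.
rewrite (ge0_integral_distribution (P := P) to2)//.
exact: measurableT_comp mH (pair1_measurable _).
Qed.

Lemma measurable_decouple (H : O1 * O2 -> \bar R) : measurable_fun setT H ->
  (forall p, (0 <= H p)%E) ->
  measurable_fun setT (fun w1 : O1 => \int[P]_w2 H (w1, to2 w2))%E.
Proof.
move=> mH H0; have := @measurable_fun_fubini_tonelli_F _ _ _ _ _ P2 H mH H0.
congr measurable_fun; apply/funext => w; rewrite /fubini_F.
rewrite (ge0_integral_distribution (P := P) to2)//.
exact: measurableT_comp mH (pair1_measurable _).
Qed.

Lemma decouple_integrable (H : O1 * O2 -> \bar R) : measurable_fun setT H ->
  P.-integrable setT (H \o diag) ->
  (\int[P]_w H (diag w) = \int[P1]_w1 \int[P2]_w2 H (w1, w2))%E.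
Proof.
move=> mH iH.
rewrite -[LHS](@integral_distribution _ _ _ _ _ P diag H mH iH).
rewrite (eq_measure_integral (P1 \x P2)%E); last by move=> A mA _; exact/esym/law_diag.
rewrite -integral12_prod_meas1//.
apply/integrableP; split => //.
have mHa : measurable_fun setT (abse \o H) by exact: measurableT_comp.
rewrite (eq_measure_integral P12); last by move=> A mA _; exact: law_diag.
rewrite (ge0_integral_distribution (P := P) diag)//.
by have /integrableP[] := iH.
Qed.

(** By Fubini [A] is frozen to a constant vector, against which [B] has mean zero. *)
Lemma decouple_orthogonal n (A : O1 -> 'cV[R]_n) (B : O2 -> 'cV[R]_n) :
  measurable_cv A -> measurable_cv B ->
  P.-integrable setT (fun w => (dotc (A (to1 w)) (B (to2 w)))%:E) ->
  (forall v, P.-integrable setT (fun w => (dotc v (B (to2 w)))%:E)) ->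
  (forall v, \int[P]_w (dotc v (B (to2 w)))%:E = 0)%E ->
  (\int[P]_w (dotc (A (to1 w)) (B (to2 w)))%:E = 0)%E.
Proof.
move=> mA mB iAB iB B0.
pose H (p : O1 * O2) := (dotc (A p.1) (B p.2))%:E.
have mH : measurable_fun setT H.
  apply/measurable_EFinP; apply: measurable_dotc => j.
    exact: measurableT_comp (mA j) measurable_fst.
  exact: measurableT_comp (mB j) measurable_snd.
rewrite (decouple_integrable mH iAB); apply: integral0_eq => w _.
transitivity (\int[P]_w2 ((fun w2 : O2 => H (w, w2)) \o to2) w2)%E; last exact: (B0 (A w)).
apply: integral_distribution.
- exact: measurableT_comp mH (pair1_measurable _).
- exact: (iB (A w)).
Qed.

(** Used to split on the value of a discrete variable, the block index or the output index, that is
    independent of the integrand. *)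
Lemma decouple_indic (A : set Omega) (Psi : O2 -> \bar R) : <<s G1 >> A ->
  measurable_fun setT Psi -> (forall w, (0 <= Psi w)%E) ->
  (\int[P]_w ((\1_A w)%:E * Psi (to2 w)) = P A * \int[P]_w Psi (to2 w))%E.
Proof.
move=> sA mPsi Psi0; have mA := sigma_measurable mG1 sA.
pose H (p : O1 * O2) := ((\1_(A : set O1) p.1)%:E * Psi p.2)%E.
have I0 : (0 <= \int[P]_w Psi (to2 w))%E by apply: integral_ge0.
have H0 p : (0 <= H p)%E by rewrite mule_ge0// lee_fin.
have mH : measurable_fun setT H.
  apply: emeasurable_funM; last by apply: (measurableT_comp mPsi); exact: measurable_snd.
  apply/measurable_EFinP.
  by apply: (measurableT_comp _ measurable_fst); apply: measurable_indic.
rewrite (decouple_ge0 mH H0).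
have mPsi2 : measurable_fun setT (Psi \o to2) by exact: measurableT_comp mPsi measurable_to2.
transitivity (\int[P]_w ((\1_A w)%:E * \int[P]_w Psi (to2 w)))%E.
  by apply: eq_integral => w _; rewrite /H/= ge0_integralZl// lee_fin.
rewrite ge0_integralZr//; last by apply/measurable_EFinP; exact: measurable_indic.
by rewrite integral_indic// setIT.
Qed.

End decoupling.

(** * Groups of mutually independent sources *)

Section grouping.
Context {d : measure_display} {Omega : measurableType d} {R : realType}.
Variables (P : probability Omega R) (I : finType) (S : I -> set (set Omega)).
Hypotheses (mS : forall j, S j `<=` measurable) (IS : forall j, setI_closed (S j)).
Hypotheses (TS : forall j, S j setT) (indS : mutually_independent P S).

(* A pi-system generating the sigma-algebra of the sources in J. *)
Definition group_sys (J : {set I}) : set (set Omega) :=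
  [set A | exists2 B : I -> set Omega, (forall j, j \in J -> S j (B j)) &
     A = \bigcap_(j in [set` J]) B j].

Lemma group_sys_measurable J : group_sys J `<=` measurable.
Proof.
move=> _ [B SB ->]; apply: fin_bigcap_measurable => // j jJ.
exact: (mS (SB j jJ)).
Qed.

Lemma group_sys_setI J : setI_closed (group_sys J).
Proof.
move=> _ _ [B SB ->] [C SC ->]; exists (fun j => B j `&` C j).
  by move=> j jJ; apply: IS; [exact: SB|exact: SC].
by rewrite bigcapI.
Qed.

Lemma group_sys_setT J : group_sys J setT.
Proof. by exists (fun=> setT) => //; rewrite bigcapT. Qed.

Lemma sub_group_sys (J : {set I}) j : j \in J -> S j `<=` group_sys J.
Proof.
move=> jJ A SA; exists (fun k => if k == j then A else setT).
  by move=> k kJ; case: eqP => [->//|_]; exact: TS.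
apply/seteqP; split => [w Aw k _|w H]; first by case: eqP.
by have := H j jJ; rewrite eqxx.
Qed.

(** The two families of events are glued into one indexed by the union of the groups; mutual
    independence is used for the union and for each group. *)
Lemma group_sys_indep (J1 J2 : {set I}) A B : [disjoint J1 & J2]%B ->
  group_sys J1 A -> group_sys J2 B -> P (A `&` B) = (P A * P B)%E.
Proof.
move=> J12 [A_ SA ->] [B_ SB ->]; pose C j := if j \in J1 then A_ j else B_ j.
have SC j : j \in J1 :|: J2 -> S j (C j).
  by rewrite inE /C; case: ifPn => [/SA|_ /= /SB].
have C1 j : j \in J1 -> C j = A_ j by rewrite /C => ->.
have C2 j : j \in J2 -> C j = B_ j.
  by rewrite /C => jJ2; case: ifPn => // /(disjointFr J12); rewrite jJ2.
have -> : \bigcap_(j in [set` J1]) A_ j `&` \bigcap_(j in [set` J2]) B_ j =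
    \bigcap_(j in [set` J1 :|: J2]) C j.
  apply/seteqP; split => [w [HA HB] j|w H].
    by rewrite /= inE => /orP[jJ|jJ]; [rewrite C1//; exact: HA|rewrite C2//; exact: HB].
  split => j jJ.
    by rewrite -C1//; apply: H; rewrite /= inE (_ : j \in J1).
  by rewrite -C2//; apply: H; rewrite /= inE (_ : j \in J2)// orbT.
rewrite indS// indS// indS// (eq_bigl [in [predU J1 & J2]]); last first.
  by move=> j; rewrite !inE.
rewrite bigU//=; congr (_ * _)%E; apply: eq_bigr => j jJ; [by rewrite C1|by rewrite C2].
Qed.

Local Notation O J := (g_sigma_algebraType (group_sys J)).

Lemma group_sigma_measurable J (A : set Omega) : <<s group_sys J >> A -> measurable A.
Proof. by apply: sigma_measurable; exact: group_sys_measurable. Qed.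

Lemma group_measurable_fun J {d'} {T : measurableType d'} (h : Omega -> T) :
  measurable_fun setT (h : O J -> T) -> measurable_fun setT h.
Proof.
move=> mh _ B mB; rewrite setTI; apply: (@group_sigma_measurable J).
by have := mh measurableT B mB; rewrite setTI.
Qed.

Lemma group_measurable_member (J : {set I}) j {d'} {T : measurableType d'} (h : Omega -> T) :
  j \in J -> g_sigma_algebra_preimage h `<=` S j -> measurable_fun setT (h : O J -> T).
Proof.
move=> jJ hS _ B mB; rewrite setTI; apply: sub_sigma_algebra.
by apply: (sub_group_sys jJ); apply: hS; exists B => //; rewrite setTI.
Qed.

Variables J1 J2 : {set I}.
Hypothesis J12 : [disjoint J1 & J2]%B.

Let indJ A B : group_sys J1 A -> group_sys J2 B -> P (A `&` B) = (P A * P B)%E.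
Proof. exact: group_sys_indep. Qed.

Let mG J := @group_sys_measurable J.
Let IG J := @group_sys_setI J.

Lemma group_decouple (H : O J1 * O J2 -> \bar R) : measurable_fun setT H ->
  (forall p, (0 <= H p)%E) ->
  (\int[P]_w H (w, w) = \int[P]_w1 \int[P]_w2 H (w1, w2))%E.
Proof.
exact: (decouple_ge0 (@mG J1) (@mG J2) (@IG J1) (@IG J2)
  (group_sys_setT J1) (group_sys_setT J2) indJ).
Qed.

Lemma group_measurable_decouple (H : O J1 * O J2 -> \bar R) : measurable_fun setT H ->
  (forall p, (0 <= H p)%E) ->
  measurable_fun setT (fun w1 : O J1 => \int[P]_w2 H (w1, w2))%E.
Proof. exact: (measurable_decouple P (@mG J2)). Qed.

Lemma group_orthogonal n (A B : Omega -> 'cV[R]_n) :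
  measurable_cv (A : O J1 -> 'cV[R]_n) -> measurable_cv (B : O J2 -> 'cV[R]_n) ->
  P.-integrable setT (fun w => (dotc (A w) (B w))%:E) ->
  (forall v, P.-integrable setT (fun w => (dotc v (B w))%:E)) ->
  (forall v, \int[P]_w (dotc v (B w))%:E = 0)%E ->
  (\int[P]_w (dotc (A w) (B w))%:E = 0)%E.
Proof.
exact: (decouple_orthogonal (@mG J1) (@mG J2) (@IG J1) (@IG J2)
  (group_sys_setT J1) (group_sys_setT J2) indJ).
Qed.

Lemma group_indic (A : set Omega) (Psi : Omega -> \bar R) : <<s group_sys J1 >> A ->
  measurable_fun setT (Psi : O J2 -> \bar R) -> (forall w, (0 <= Psi w)%E) ->
  (\int[P]_w ((\1_A w)%:E * Psi w) = P A * \int[P]_w Psi w)%E.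
Proof.
exact: (decouple_indic (@mG J1) (@mG J2) (@IG J1) (@IG J2)
  (group_sys_setT J1) (group_sys_setT J2) indJ).
Qed.

End grouping.

(** * Block structure and the one-step inequality *)

Section block_algebra.
Context {R : realType} {b : nat} {n_ : 'I_b.+1 -> nat}.
Local Notation n := (\sum_s n_ s)%N.
Implicit Types (x y : 'cV[R]_n) (s : 'I_b.+1).

Lemma blkE s x : blk s x = submxcol x s.
Proof. by rewrite /blk /Umx tr_submxrow trmx1 submxcol_mul mul1mx. Qed.

Lemma blk_mxcol s (B : forall s, 'cV[R]_(n_ s)) : blk s (\mxcol_s B s) = B s.
Proof. by rewrite blkE mxcolK. Qed.

Lemma mxcol_blk x : \mxcol_s blk s x = x.
Proof. by under eq_mxcol do rewrite blkE; rewrite submxcolK. Qed.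

Lemma blkB s x y : blk s (x - y) = blk s x - blk s y.
Proof. exact: mulmxBr. Qed.

Lemma blkZ s a x : blk s (a *: x) = a *: blk s x.
Proof. by rewrite /blk -scalemxAr. Qed.

Lemma blk_sum s I (r : seq I) (G : I -> 'cV[R]_n) :
  blk s (\sum_(t <- r) G t) = \sum_(t <- r) blk s (G t).
Proof. exact: mulmx_sumr. Qed.

Lemma dotc_blk x y : dotc x y = \sum_s dotc (blk s x) (blk s y).
Proof.
rewrite dotcE -[x in LHS]mxcol_blk -[y in LHS]mxcol_blk tr_mxcol mul_mxrow_mxcol summxE.
by apply: eq_bigr => s _; rewrite dotcE.
Qed.

Lemma sqr_enorm_blk x : enorm x ^+ 2 = \sum_s enorm (blk s x) ^+ 2.
Proof. by rewrite sqr_enorm dotc_blk; apply: eq_bigr => s _; rewrite sqr_enorm. Qed.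

Lemma dotc_Umx s x (h : 'cV[R]_(n_ s)) : dotc x (Umx n_ s *m h) = dotc (blk s x) h.
Proof. by rewrite dotcC dotc_mulmx dotcC. Qed.

Lemma sum_Umx_blk x : x = \sum_s Umx n_ s *m blk s x.
Proof.
rewrite -[LHS]mul1mx -{1}(submxrowK (1%:M : 'M[R]_n)) -[x in LHS]mxcol_blk mul_mxrow_mxcol.
by apply: eq_bigr => s _.
Qed.

Lemma mxcol_update s (h : forall s, 'cV[R]_(n_ s)) x :
  \mxcol_s' (if s' == s then blk s' x + h s' else blk s' x) = x + Umx n_ s *m h s.
Proof.
rewrite (_ : Umx n_ s *m h s = \mxcol_s' (if s' == s then h s' else 0)); last first.
  apply/esym; apply: etrans (sum_Umx_blk _) _.
  apply: etrans; first exact: (bigD1 s).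
  rewrite /= blk_mxcol eqxx -[RHS]addr0; congr (_ + _); apply: big1 => s' ss'.
  by rewrite blk_mxcol (negbTE ss') mulmx0.
rewrite -[x in RHS]mxcol_blk -mxcolD; apply: eq_mxcol => s'.
by case: eqP => // _; rewrite addr0.
Qed.

Lemma bmin_le (g : 'I_b.+1 -> R) s : bmin g <= g s.
Proof. by rewrite /bmin; exact: bigmin_le_cond. Qed.

Lemma bmin_ge (g : 'I_b.+1 -> R) a : (forall s, a <= g s) -> a <= bmin g.
Proof. by move=> ag; rewrite /bmin; apply/bigmin_geP; split. Qed.

Lemma bmax_ge (g : 'I_b.+1 -> R) s : g s <= bmax g.
Proof. by rewrite /bmax; exact: le_bigmax_cond. Qed.

End block_algebra.

(** * Descent of one step from a fixed point *)

Section one_step.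
Context {R : realType} {b : nat} {n_ : 'I_b.+1 -> nat}.
Local Notation n := (\sum_s n_ s)%N.
Variables (X : forall s, set 'cV[R]_(n_ s)) (phi chi : forall s, 'cV[R]_(n_ s) -> R).
Variables (f : 'cV[R]_n -> R) (Lf mu : R) (L p : 'I_b.+1 -> R).
Hypotheses (cX : forall s, closed (@X s)) (sX : forall s, segment_closed (@X s)).
Hypotheses (cchi : forall s, closed_convex (@chi s)).
Hypotheses (dphi : forall s y, differentiable (@phi s) y).
Hypotheses (sphi : forall s, strongly_convex1 (@phi s)).
Hypotheses (Lf0 : 0 < Lf) (L0 : forall s, 0 < L s) (mu0 : 0 < mu).
Hypotheses (df : forall x, differentiable f x).
Hypothesis Lip : forall x y, enorm (grad f x - grad f y) <= Lf * enorm (x - y).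
Hypothesis blkLip : forall s x (h : 'cV[R]_(n_ s)),
  enorm (blk s (grad f (x + Umx n_ s *m h)) - blk s (grad f x)) <= L s * enorm h.
Hypotheses (p01 : forall s, 0 <= p s <= 1) (sp1 : \sum_s p s = 1).
Variables (a : R) (x : 'cV[R]_n).
Hypotheses (a0 : 0 < a) (aL : forall s, a <= 2 / L s).
Hypothesis Xx : block_prod X x.
Implicit Types g : 'cV[R]_n.

Local Notation Phi := (composite (gsmooth mu f) chi).
Local Notation gmu := (gsmooth_grad mu f x).
Local Notation P_ s g := (ggrad_blk X phi chi s x g a).

(** The update with block and direction as free parameters; the random block and the random batch
    are substituted later. *)
Definition block_step s y g : 'cV[R]_n :=
  \mxcol_s' (if s' == s then bprox X phi chi (blk s' y) (blk s' g) a else blk s' y).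

(** The unnormalized probability of the output index. *)
Definition step_weight : R := a * bmin (fun s => p s * (1 - L s / 2 * a)).

Let X0 s : @X s !=set0.
Proof. by exists (blk s x); exact: Xx. Qed.

Let y_ s g := bprox X phi chi (blk s x) (blk s g) a.

Let stepE s g : block_step s x g = x + Umx n_ s *m (y_ s g - blk s x).
Proof.
rewrite -(mxcol_update s (fun s => y_ s g - blk s x)); apply: eq_mxcol => s'.
by case: eqP => // _; rewrite addrC subrK.
Qed.

Let diffE s g : blk s x - y_ s g = a *: P_ s g.
Proof. by rewrite /ggrad_blk scalerA divff ?scale1r// gt_eqF. Qed.

Lemma block_step_in s g : block_prod X (block_step s x g).
Proof.
move=> s'; rewrite /block_step blk_mxcol; case: eqP => _; last exact: Xx.
by apply: prox_in.
Qed.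

Lemma ggrad_blk_lipschitz s g g' : enorm (P_ s g - P_ s g') <= enorm (blk s (g - g')).
Proof.
rewrite /ggrad_blk -scalerBr opprB addrC addrA subrK enormZ gtr0_norm ?invr_gt0//.
by rewrite ler_pdivrMl// enormBC (blkB s g g'); apply: prox_lipschitz.
Qed.

Let smooth_part s (h : 'cV[R]_(n_ s)) : gsmooth mu f (x + Umx n_ s *m h) <=
  gsmooth mu f x + dotc (blk s gmu) h + L s * enorm h ^+ 2 / 2.
Proof.
rewrite -dotc_Umx; apply: (gsmooth_block_descent df mu0 Lf0 Lip) => y.
apply: le_grad_quad => // t /andP[t0 _].
rewrite dotc_Umx blkB; apply: le_trans (dotc_le_enorm _ _) _.
rewrite expr2 mulrA mulrAC ler_wpM2r ?enorm_ge0// scalemxAr.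
apply: le_trans (blkLip _ _) _.
by rewrite enormZ (ger0_norm t0) mulrA mulrAC.
Qed.

Let chi_part s g : block_sum chi (block_step s x g) =
  block_sum chi x + (@chi s (y_ s g) - @chi s (blk s x)).
Proof.
rewrite /block_sum (bigD1 s)//= [in RHS](bigD1 s)//= /block_step blk_mxcol eqxx.
rewrite (eq_bigr (fun i => @chi i (blk i x))) => [|i is_].
  by rewrite /y_; ring.
by rewrite blk_mxcol (negbTE is_).
Qed.

(** The smooth part is expanded with [gmu] and the proximal inequality with [g], leaving
    [a * <delta, P_ s g>]. Exchanging [P_ s g] for [P_ s gmu] costs [|delta|^2] by nonexpansiveness,
    and the coefficient of [delta] no longer depends on [g]. *)
Lemma one_step_descent s g : let delta := blk s (g - gmu) in
  (Phi (block_step s x g) + a * (1 - L s / 2 * a) * enorm (P_ s g) ^+ 2 <=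
   Phi x + a * dotc delta (P_ s gmu) + a * enorm delta ^+ 2)%R : Prop.
Proof.
move=> delta.
(* The linear arithmetic is isolated on plain real variables, before the large terms are
   substituted. *)
have comb (F0 F1 c0 y1 y0 dg dm dl Q e l : R) : F1 <= F0 - a * dm + l * (a ^+ 2 * Q) / 2 ->
    y1 - y0 + a * Q <= a * dg -> a * (dg - dm) <= a * (dl + e) ->
    F1 + (c0 + (y1 - y0)) + a * (1 - l / 2 * a) * Q <= F0 + c0 + a * dl + a * e by lra.
have h1 := smooth_part (y_ s g - blk s x).
have h2 := prox_descent (@cX s) (@sX s) (X0 s) (@cchi s) (@dphi s) (@sphi s) a0 (g := blk s g)
  (Xx s) (erefl (y_ s g)).
have h3 := ggrad_blk_lipschitz s g gmu.
rewrite /composite chi_part stepE.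
have E1 : y_ s g - blk s x = - a *: P_ s g by rewrite scaleNr -diffE opprB.
rewrite E1 enormZ normrN (gtr0_norm a0) dotcZr in h1.
rewrite diffE enormZ (gtr0_norm a0) dotcZr !exprMn in h2.
rewrite E1.
have h4 : dotc delta (P_ s g) <= dotc delta (P_ s gmu) + enorm delta ^+ 2.
  rewrite -lerBlDl -dotcBr; apply: le_trans (dotc_le_enorm _ _) _.
  by rewrite expr2 ler_wpM2l ?enorm_ge0.
have h5 : dotc delta (P_ s g) = dotc (blk s g) (P_ s g) - dotc (blk s gmu) (P_ s g).
  by rewrite /delta blkB dotcBl.
have h6 := ler_wpM2l (ltW a0) h4.
have h7 : a^-1 * (a ^+ 2 * enorm (P_ s g) ^+ 2) = a * enorm (P_ s g) ^+ 2.
  by field; rewrite gt_eqF.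
rewrite h7 in h2; rewrite exprMn in h1; rewrite h5 in h6.
move: h1 h2 h6; rewrite mulNr.
exact: comb.
Qed.

Lemma step_weight_ge0 : 0 <= step_weight.
Proof.
apply: mulr_ge0; first exact: ltW.
apply: bmin_ge => s; apply: mulr_ge0; first by case/andP: (p01 s).
have := aL s; rewrite ler_pdivlMr ?L0// subr_ge0; lra.
Qed.

(** It lets the term [step_weight * |g - gmu|^2] be merged with the noise term of the descent
    inequality. *)
Lemma step_weight_le_bmax : step_weight <= a * bmax p.
Proof.
rewrite ler_pM2l//; apply: le_trans (bmin_le _ ord0) _; apply: le_trans (bmax_ge _ ord0).
rewrite ler_piMr//; first by case/andP: (p01 ord0).
by rewrite gerBl mulr_ge0 ?(ltW a0)// divr_ge0// ltW.
Qed.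

(** From [grad f] to [gmu], then from [gmu] to [g]: each passage doubles the squares and costs the
    squared distance of the directions, whence the coefficients 4, 4 and 2. *)
Lemma sqr_ggrad_le g :
  enorm (ggrad X phi chi x (grad f x) a) ^+ 2 <=
  4 * enorm (ggrad X phi chi x g a) ^+ 2 + 4 * enorm (g - gmu) ^+ 2
  + 2 * (Lf ^+ 2 * mu ^+ 2 * n%:R).
Proof.
have comb (A B C D E F G : R) : A <= 2 * B + 2 * C -> B <= 2 * D + 2 * E ->
    C <= F -> E <= G -> A <= 4 * D + 4 * G + 2 * F by lra.
have e := sqr_gsmooth_grad_err df mu0 Lf0 Lip x.
have blk_le s : enorm (P_ s (grad f x)) ^+ 2 <= 4 * enorm (P_ s g) ^+ 2
    + 4 * enorm (blk s (g - gmu)) ^+ 2 + 2 * enorm (blk s (gmu - grad f x)) ^+ 2.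
  have t1 := sqr_enormD_le (P_ s gmu) (P_ s (grad f x) - P_ s gmu).
  have t2 := sqr_enormD_le (P_ s g) (P_ s gmu - P_ s g).
  rewrite addrC subrK in t1; rewrite addrC subrK in t2.
  have t3 : enorm (P_ s (grad f x) - P_ s gmu) ^+ 2 <= enorm (blk s (gmu - grad f x)) ^+ 2.
    by rewrite enormBC lerXn2r ?nnegrE ?enorm_ge0// ggrad_blk_lipschitz.
  have t4 : enorm (P_ s gmu - P_ s g) ^+ 2 <= enorm (blk s (g - gmu)) ^+ 2.
    by rewrite enormBC lerXn2r ?nnegrE ?enorm_ge0// ggrad_blk_lipschitz.
  exact: comb t1 t2 t3 t4.
have blk_ggrad g' s : blk s (ggrad X phi chi x g' a) = P_ s g' by rewrite /ggrad blk_mxcol.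
rewrite (sqr_enorm_blk (ggrad X phi chi x (grad f x) a)).
rewrite (sqr_enorm_blk (ggrad X phi chi x g a)).
rewrite (sqr_enorm_blk (g - gmu)).
apply: (@le_trans _ _ (\sum_s (4 * enorm (P_ s g) ^+ 2
    + 4 * enorm (blk s (g - gmu)) ^+ 2 + 2 * enorm (blk s (gmu - grad f x)) ^+ 2))).
  by apply: ler_sum => s _; rewrite blk_ggrad.
rewrite !big_split/= -!mulr_sumr -(sqr_enorm_blk (gmu - grad f x)).
under [X in _ <= 4 * X + _ + _]eq_bigr do rewrite blk_ggrad.
by rewrite lerD2l ler_pM2l.
Qed.

(* The coefficient of the noise g - gmu in the averaged descent inequality; it
   is computed from gmu and not from g, so this term has mean zero. *)
Definition lin_coef : 'cV[R]_n := \mxcol_s (p s *: P_ s gmu).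

(** The sum weighted by [p] is the mean over the block index. The bound on the generalized gradient
    is used with factor [step_weight / 4], and its noise part adds a second copy of
    [a * bmax p * |g - gmu|^2]. Subtracting [Phistar] keeps the values at feasible points
    nonnegative. *)
Lemma one_step_mean (Phistar : R) g :
  \sum_s p s * (Phi (block_step s x g) - Phistar)
    + step_weight / 4 * enorm (ggrad X phi chi x (grad f x) a) ^+ 2 <=
  (Phi x - Phistar) + step_weight / 2 * (Lf ^+ 2 * mu ^+ 2 * n%:R)
    + a * dotc (g - gmu) lin_coef + 2 * a * bmax p * enorm (g - gmu) ^+ 2.
Proof.
have comb (w Gf Gg dd e lin S F0 B : R) : w * Gf <= w * (4 * Gg + 4 * dd + 2 * e) ->
    w * dd <= a * B * dd -> S + w * Gg <= F0 + a * lin + a * B * dd ->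
    S + w / 4 * Gf <= F0 + w / 2 * e + a * lin + 2 * a * B * dd by lra.
have block_comb (q F1 F0 l Q dl e B w : R) :
    q * (F1 + a * (1 - l / 2 * a) * Q) <= q * (F0 + a * dl + a * e) ->
    w * Q <= a * (q * (1 - l / 2 * a)) * Q -> a * (q * e) <= a * (B * e) ->
    q * (F1 - Phistar) + w * Q <= q * (F0 - Phistar) + a * (q * dl) + a * B * e by lra.
have w0 := step_weight_ge0; have wm := step_weight_le_bmax.
have d0 := sqr_ge0 (enorm (g - gmu)).
have h1 := ler_wpM2l w0 (sqr_ggrad_le g).
have h2 := ler_wpM2r d0 wm.
have pa s : 0 <= p s by case/andP: (p01 s).
have h3 : \sum_s p s * (Phi (block_step s x g) - Phistar)
    + \sum_s step_weight * enorm (P_ s g) ^+ 2 <=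
    \sum_s (p s * (Phi x - Phistar) + a * (p s * dotc (blk s (g - gmu)) (P_ s gmu))
     + a * bmax p * enorm (blk s (g - gmu)) ^+ 2).
  rewrite -big_split/=; apply: ler_sum => s _.
  have H := ler_wpM2l (pa s) (one_step_descent s g).
  have H2 : step_weight * enorm (P_ s g) ^+ 2 <=
      a * (p s * (1 - L s / 2 * a)) * enorm (P_ s g) ^+ 2.
    by rewrite ler_wpM2r ?sqr_ge0// ler_pM2l// bmin_le.
  have H3 : a * (p s * enorm (blk s (g - gmu)) ^+ 2) <=
      a * (bmax p * enorm (blk s (g - gmu)) ^+ 2).
    by rewrite ler_pM2l// ler_wpM2r ?sqr_ge0// bmax_ge.
  move: H H2 H3.
  exact: block_comb.
rewrite !big_split/= -!mulr_suml -!mulr_sumr sp1 mul1r -sqr_enorm_blk in h3.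
have E1 : \sum_s enorm (P_ s g) ^+ 2 = enorm (ggrad X phi chi x g a) ^+ 2.
  by rewrite sqr_enorm_blk; apply: eq_bigr => s _; rewrite /ggrad blk_mxcol.
have E2 : dotc (g - gmu) lin_coef = \sum_s p s * dotc (blk s (g - gmu)) (P_ s gmu).
  by rewrite dotc_blk; apply: eq_bigr => s _; rewrite blk_mxcol dotcZr.
rewrite E1 -E2 in h3; move: h1 h2 h3.
exact: comb.
Qed.

End one_step.

(** * Measurability of the iteration *)

Section gsmooth_continuous.
Context {R : realType} {n : nat}.
Variables (f : 'cV[R]_n -> R) (Lf mu : R).
Hypotheses (df : forall x, differentiable f x) (mu0 : 0 < mu) (Lf0 : 0 < Lf).
Hypothesis Lip : forall x y, enorm (grad f x - grad f y) <= Lf * enorm (x - y).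

(** The quadratic upper bound is used from [x] to [y] and from [y] to [x]; in the second, the
    gradient at [y] is controlled by the one at [x] through [Lip]. Continuity makes [Phi_mu]
    measurable along the run. *)
Lemma gsmooth_continuous : continuous (gsmooth mu f).
Proof.
pose e := Lf ^+ 2 * mu ^+ 2 * n%:R.
have ub x d : gsmooth mu f (x + d) <=
    gsmooth mu f x + dotc (gsmooth_grad mu f x) d + Lf / 2 * enorm d ^+ 2.
  apply: (gsmooth_block_descent df mu0 Lf0 Lip) => y.
  by have := lip_grad_quad y d df Lip; rewrite ler_norml; lra.
have gB x : enorm (gsmooth_grad mu f x) <= enorm (grad f x) + (1 + e).
  rewrite -[gsmooth_grad _ _ _](subrK (grad f x)) addrC.
  apply: le_trans (ler_enormD _ _) _; rewrite lerD2l.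
  have := sqr_gsmooth_grad_err df mu0 Lf0 Lip x; rewrite -/e.
  by set t := enorm _; have := sqr_ge0 (t - 1); rewrite sqrrB; have : 0 <= t := enorm_ge0 _; lra.
apply: (@dominated_continuous _ _ _ (fun x y =>
  (enorm (grad f x) + (1 + e)) * enorm (x - y) + (2 * Lf) * (enorm (x - y) * enorm (x - y)))).
- move=> x.
  have ce : {for x, continuous (fun y : 'cV[R]_n => enorm (x - y))}.
    apply: continuous_comp; last exact: continuous_enorm.
    by apply: continuousB; [exact: cst_continuous|move=> ?].
  apply: (@continuousD R R^o).
    by apply: continuousM => //; exact: cst_continuous.
  by apply: continuousM; [exact: cst_continuous|exact: continuousM].
- by move=> x; rewrite subrr enorm0 !mulr0 addr0.
move=> x y.
have h1 := ub x (y - x); have h2 := ub y (x - y).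
rewrite (addrC x) subrK (enormBC y) in h1; rewrite (addrC y) subrK in h2.
set t := enorm (x - y) in h1 h2 *; have t0 : 0 <= t := enorm_ge0 _.
have h3 : dotc (gsmooth_grad mu f x) (y - x) <= (enorm (grad f x) + (1 + e)) * t.
  apply: le_trans (dotc_le_enorm _ _) _; rewrite (enormBC y) ler_wpM2r//.
have h4 : dotc (gsmooth_grad mu f y) (x - y) <= (enorm (grad f x) + Lf * t + (1 + e)) * t.
  apply: le_trans (dotc_le_enorm _ _) _; rewrite ler_wpM2r//.
  apply: le_trans (gB y) _; rewrite lerD2r.
  rewrite -[X in enorm X <= _](subrK (grad f x)) addrC.
  by apply: le_trans (ler_enormD _ _) _; rewrite lerD2l (le_trans (Lip _ _))// enormBC.
have t2 : 0 <= Lf * (t * t) by rewrite mulr_ge0 ?(ltW Lf0)// mulr_ge0.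
rewrite ler_norml; lra.
Qed.

End gsmooth_continuous.

Section measurability.
Context {R : realType} {d : measure_display} {W : measurableType d}.

Lemma measurable_cv_mulmx k n (A : 'M[R]_(k, n)) (g : W -> 'cV[R]_n) :
  measurable_cv g -> measurable_cv (fun w => A *m g w).
Proof.
move=> mg j; under eq_fun do rewrite mxE.
by apply: measurable_sum => i; apply: measurable_funM => //; exact: mg.
Qed.

(** By [proxE], the chosen minimizer is a Lipschitz function of [g - a^-1 *: grad phi x], a
    measurable vector. *)
Lemma measurable_cv_prox m (X : set 'cV[R]_m) phi chi (a : R) (x g : W -> 'cV[R]_m) :
  closed X -> segment_closed X -> X !=set0 -> closed_convex chi ->
  (forall y, differentiable phi y) -> strongly_convex1 phi -> 0 < a ->
  measurable_cv x -> measurable_cv g ->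
  measurable_cv (fun w => prox X phi chi (x w) (g w) a).
Proof.
move=> cX sX X0 cchi dphi sphi a0 mx mg j.
under eq_fun do rewrite proxE.
apply: (measurable_cv_continuous (g := fun w => g w - a^-1 *: grad phi (x w))
  (h := fun v => prox_lin X phi chi a v j 0)).
  apply: measurable_cvB => //; apply: measurable_cvZ => //.
  exact: measurable_cv_grad.
apply: (@dominated_continuous R 'cV[R]_m (fun v => prox_lin X phi chi a v j 0)
  (fun v w => a * enorm (v - w))).
- move=> v; apply: continuousM; first exact: cst_continuous.
  apply: continuous_comp; last exact: continuous_enorm.
  by apply: continuousB; [exact: cst_continuous|move=> ?].
- by move=> v; rewrite subrr enorm0 mulr0.
move=> v w; apply: le_trans (prox_lin_lipschitz cX sX X0 cchi dphi sphi a0 v w).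
apply: le_trans (coord_le_enorm _ j).
by rewrite !mxE.
Qed.

Context {b : nat} {n_ : 'I_b.+1 -> nat}.
Local Notation n := (\sum_s n_ s)%N.

Lemma measurable_cv_mxcol (G : forall s, W -> 'cV[R]_(n_ s)) :
  (forall s, measurable_cv (G s)) -> measurable_cv (fun w => \mxcol_s G s w).
Proof. by move=> mG j; under eq_fun do rewrite mxE; exact: mG. Qed.

Lemma measurable_cv_blk s (g : W -> 'cV[R]_n) : measurable_cv g ->
  measurable_cv (fun w => blk s (g w)).
Proof. exact: measurable_cv_mulmx. Qed.

Lemma measurable_cv_if m (c : W -> bool) (g h : W -> 'cV[R]_m) :
  measurable (c @^-1` [set true]) -> measurable_cv g -> measurable_cv h ->
  measurable_cv (fun w => if c w then g w else h w).
Proof.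
move=> mc mg mh j.
rewrite (_ : (fun w => _) = (fun w => if c w then g w j 0 else h w j 0)); last first.
  by apply/funext => w; case: ifP.
apply: measurable_fun_ifT; [|exact: mg|exact: mh].
by apply: (measurable_fun_bool true); rewrite setTI.
Qed.

Variables (X : forall s, set 'cV[R]_(n_ s)) (phi chi : forall s, 'cV[R]_(n_ s) -> R).
Hypotheses (cX : forall s, closed (@X s)) (sX : forall s, segment_closed (@X s)).
Hypotheses (X0 : forall s, @X s !=set0) (cchi : forall s, closed_convex (@chi s)).
Hypotheses (dphi : forall s y, differentiable (@phi s) y).
Hypotheses (sphi : forall s, strongly_convex1 (@phi s)).

Lemma measurable_cv_bprox s a (x g : W -> 'cV[R]_(n_ s)) : 0 < a ->
  measurable_cv x -> measurable_cv g ->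
  measurable_cv (fun w => bprox X phi chi (x w) (g w) a).
Proof. by move=> a0 mx mg; apply: measurable_cv_prox. Qed.

Lemma measurable_cv_block_step a (iota : W -> 'I_b.+1) (x g : W -> 'cV[R]_n) : 0 < a ->
  (forall s, measurable (iota @^-1` [set s])) -> measurable_cv x -> measurable_cv g ->
  measurable_cv (fun w => block_step X phi chi a (iota w) (x w) (g w)).
Proof.
move=> a0 mi mx mg; apply: measurable_cv_mxcol => s.
apply: measurable_cv_if; last exact: measurable_cv_blk.
  rewrite (_ : _ @^-1` _ = iota @^-1` [set s])//.
  by apply/seteqP; split => w /=; [move/eqP => ->|move=> ->; rewrite eqxx].
by apply: measurable_cv_bprox => //; exact: measurable_cv_blk.
Qed.

Lemma measurable_cv_ggrad a (x g : W -> 'cV[R]_n) : 0 < a ->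
  measurable_cv x -> measurable_cv g ->
  measurable_cv (fun w => ggrad X phi chi (x w) (g w) a).
Proof.
move=> a0 mx mg; apply: measurable_cv_mxcol => s; apply: measurable_cvZ => //.
apply: measurable_cvB; first exact: measurable_cv_blk.
by apply: measurable_cv_bprox => //; exact: measurable_cv_blk.
Qed.

Lemma closed_convex_sublevel m (h : 'cV[R]_m -> R) : closed_convex h ->
  forall a : R, closed [set y | h y <= a].
Proof.
move=> [ch _] a.
rewrite (_ : mkset _ = (fun y => (y, a)) @^-1` [set z : 'cV[R]_m * R | h z.1 <= z.2])//.
apply: preimage_closed => // y _.
apply: (@continuous_pairing 'cV[R]_m 'cV[R]_m R id (fun=> a)) => // z; last exact: cst_continuous.
by move=> ?.
Qed.

Lemma measurable_composite (h : 'cV[R]_n -> R) (x : W -> 'cV[R]_n) : continuous h ->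
  measurable_cv x -> measurable_fun setT (fun w => composite h chi (x w)).
Proof.
move=> ch mx; apply: measurable_funD; first exact: (measurable_cv_continuous mx ch).
apply: measurable_sum => s.
apply: (@measurable_cv_lsc _ _ _ _ (fun w => blk s (x w)) (@chi s)).
  exact: measurable_cv_blk.
exact: closed_convex_sublevel.
Qed.

End measurability.

(** * Mini-batches *)

Section batch.
Context {R : realType} {n : nat} {dX : measure_display} {Xi : measurableType dX}.
Context {d : measure_display} {Omega : measurableType d}.
Variables (P : probability Omega R) (Idx : finType) (S : Idx -> set (set Omega)).
Hypotheses (mS : forall j, S j `<=` measurable) (IS : forall j, setI_closed (S j)).
Hypotheses (TS : forall j, S j setT) (indS : mutually_independent P S).
Variables (Q : probability Xi R) (F : 'cV[R]_n -> Xi -> R) (mu V : R).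
Variables (x g : 'cV[R]_n) (N : nat) (jx ju : 'I_N -> Idx).
Variables (xi : nat -> {RV P >-> Xi}) (u : nat -> {RV P >-> n.-tuple R}).
Hypotheses (jx_inj : injective jx) (ju_inj : injective ju).
Hypothesis jxu : forall t t', jx t != ju t'.
Hypothesis Sx : forall t : 'I_N, g_sigma_algebra_preimage (xi t) `<=` S (jx t).
Hypothesis Su : forall t : 'I_N, g_sigma_algebra_preimage (u t) `<=` S (ju t).
Hypothesis law_xi : forall t : 'I_N, same_law (xi t) Q.
Hypothesis law_u : forall t : 'I_N, same_law (u t) (std_gaussian n).
Local Notation gaussian := (@std_gaussian R n).
Hypothesis mF : measurable_fun setT (fun z : n.-tuple R * Xi => F (tcol z.1) z.2).
Hypothesis G2 : (\int[gaussian \x Q]_p (enorm (zo_grad F mu x p) ^+ 2)%:E <= V%:E)%E.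
Hypothesis iG : forall v,
  (gaussian \x Q)%E.-integrable setT (fun p => (dotc (zo_grad F mu x p) v)%:E).
Hypothesis EG : forall v,
  (\int[gaussian \x Q]_p (dotc (zo_grad F mu x p) v)%:E = (dotc g v)%:E)%E.

Let pair t (w : Omega) := (u t w, xi t w).

Let mpair t : measurable_fun setT (pair t).
Proof. by apply: measurable_fun_pair. Qed.

HB.instance Definition _ t := @isMeasurableFun.Build _ _ _ _ (pair t) (mpair t).

(** The Gaussian vector and the oracle sample of index [t] come from two distinct sources, so
    rectangles have product probability, which determines the joint law. *)
Lemma law_pair (t : 'I_N) (A : set (n.-tuple R * Xi)) : measurable A ->
  distribution P (pair t) A = (gaussian \x Q)%E A.
Proof.
move=> mA; apply/esym; move: A mA; apply: product_measure_unique => A B mA mB.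
transitivity (P (u t @^-1` A `&` xi t @^-1` B)); first by [].
rewrite (group_sys_indep indS (J1 := [set ju t]%SET) (J2 := [set jx t]%SET)).
- by congr (_ * _)%E; [exact: (law_u t mA)|exact: (law_xi t mB)].
- by rewrite disjoints1 inE eq_sym jxu.
- apply: (sub_group_sys TS (j := ju t)); first by rewrite inE.
  by apply: Su; exists A => //; rewrite setTI.
- apply: (sub_group_sys TS (j := jx t)); first by rewrite inE.
  by apply: Sx; exists B => //; rewrite setTI.
Qed.

Let G t w := zo_grad F mu x (pair t w).
Let D t w := G t w - g.

Let mcvG : measurable_cv (zo_grad F mu x).
Proof. exact: measurable_cv_zo_grad. Qed.

Lemma ge0_integral_pair (t : 'I_N) (h : n.-tuple R * Xi -> \bar R) :
  measurable_fun setT h -> (forall p, (0 <= h p)%E) ->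
  (\int[P]_w h (pair t w) = \int[gaussian \x Q]_p h p)%E.
Proof.
move=> mh h0; rewrite -(ge0_integral_distribution (P := P) (pair t) mh h0).
by apply: eq_measure_integral => A mA _; exact: law_pair.
Qed.

Lemma integrable_pair (t : 'I_N) (h : n.-tuple R * Xi -> \bar R) :
  (gaussian \x Q)%E.-integrable setT h -> P.-integrable setT (h \o pair t).
Proof.
move=> /integrableP[mh ih]; apply/integrableP; split; first exact: (measurableT_comp mh (mpair t)).
have mha : measurable_fun setT (abse \o h) by apply: measurableT_comp.
by rewrite (ge0_integral_pair t (h := abse \o h))// => p; exact: abse_ge0.
Qed.

Lemma integral_pair (t : 'I_N) (h : n.-tuple R * Xi -> \bar R) :
  (gaussian \x Q)%E.-integrable setT h ->
  (\int[P]_w h (pair t w) = \int[gaussian \x Q]_p h p)%E.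
Proof.
move=> ih; have mh := measurable_int _ ih.
rewrite -[LHS](@integral_distribution _ _ _ _ _ P (pair t) h mh (integrable_pair t ih)).
by apply: eq_measure_integral => A mA _; exact: law_pair.
Qed.

Lemma integrable_dotc_D (t : 'I_N) v : P.-integrable setT (fun w => (dotc v (D t w))%:E).
Proof.
have i1 := integrable_pair t (iG v).
have i2 : P.-integrable setT (fun=> (dotc g v)%:E) by exact: finite_measure_integrable_cst.
have := integrableB measurableT i1 i2; apply: eq_integrable => // w _.
by rewrite /= -EFinB -dotcBl dotcC.
Qed.

Lemma integral_dotc_D (t : 'I_N) v : (\int[P]_w (dotc v (D t w))%:E = 0)%E.
Proof.
have i1 := integrable_pair t (iG v).
have i2 : P.-integrable setT (fun=> (dotc g v)%:E) by exact: finite_measure_integrable_cst.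
transitivity (\int[P]_w ((dotc (G t w) v)%:E - (dotc g v)%:E))%E.
  by apply: eq_integral => w _; rewrite -EFinB -dotcBl dotcC.
rewrite integralB// (integral_pair t (iG v)) EG integral_cst//= probability_setT mule1.
by rewrite -EFinB subrr.
Qed.

Let mcvGt t : measurable_cv (G t).
Proof. exact: measurable_cv_comp. Qed.

Let mcvD t : measurable_cv (D t).
Proof. by apply: measurable_cvB => //; exact: measurable_cv_cst. Qed.

(** The variance is at most the second moment: [|D|^2 = |G|^2 - |g|^2 - 2 <g, D>], and the last term
    has mean zero. *)
Lemma sqr_enorm_D (t : 'I_N) : P.-integrable setT (fun w => (enorm (D t w) ^+ 2)%:E) /\
  (\int[P]_w (enorm (D t w) ^+ 2)%:E <= V%:E)%E.
Proof.
have mG2 : measurable_fun setT (fun p => (enorm (zo_grad F mu x p) ^+ 2)%:E).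
  by apply/measurable_EFinP; exact: measurable_sqr_enorm.
have iG2 : P.-integrable setT (fun w => (enorm (G t w) ^+ 2)%:E).
  apply/integrableP; split; first exact: (measurableT_comp mG2 (mpair t)).
  under eq_integral do rewrite gee0_abs ?lee_fin ?sqr_ge0//.
  rewrite (ge0_integral_pair t (h := fun p => (enorm (zo_grad F mu x p) ^+ 2)%:E))//; last first.
    by move=> p; rewrite lee_fin sqr_ge0.
  by apply: le_lt_trans G2 _; rewrite ltry.
have iDg := integrable_dotc_D t g.
have E w : ((enorm (G t w) ^+ 2)%:E - (enorm g ^+ 2)%:E - 2%:E * (dotc g (D t w))%:E
    = (enorm (D t w) ^+ 2)%:E)%E.
  rewrite -EFinM -!EFinB; congr _%:E; rewrite /D !sqr_enorm !(dotcBl, dotcBr).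
  by rewrite (dotcC _ g); ring.
have i2 : P.-integrable setT (fun=> (enorm g ^+ 2)%:E) by exact: finite_measure_integrable_cst.
have i3 := integrableZl measurableT 2 iDg.
have i4 := integrableB measurableT iG2 i2.
have i5 := integrableB measurableT i4 i3.
split; first by apply: eq_integrable i5 => // w _; exact: E.
under eq_integral do rewrite -E.
rewrite integralB// integralB// integralZl// integral_dotc_D mule0 sube0.
rewrite (ge0_integral_pair t (h := fun p => (enorm (zo_grad F mu x p) ^+ 2)%:E))//; last first.
  by move=> p; rewrite lee_fin sqr_ge0.
apply: le_trans G2; rewrite integral_cst//= probability_setT mule1.
by rewrite leeBlDl// leeDr// lee_fin sqr_ge0.
Qed.

Lemma integrable_dotc2 (A B : Omega -> 'cV[R]_n) : measurable_cv A -> measurable_cv B ->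
  P.-integrable setT (fun w => (enorm (A w) ^+ 2)%:E) ->
  P.-integrable setT (fun w => (enorm (B w) ^+ 2)%:E) ->
  P.-integrable setT (fun w => (dotc (A w) (B w))%:E).
Proof.
move=> mA mB iA iB; apply: le_integrable (integrableD measurableT iA iB) => //.
  by apply/measurable_EFinP; exact: measurable_dotc.
move=> w _; rewrite /= lee_fin [leRHS]ger0_norm ?addr_ge0 ?sqr_ge0//.
apply: le_trans (normr_dotc _ _) _.
have comb (a b : R) : 0 <= a -> 0 <= b -> a * b <= a ^+ 2 + b ^+ 2.
  by move=> a0 b0; have := sqr_ge0 (a - b); rewrite sqrrB; nra.
by apply: comb; exact: enorm_ge0.
Qed.

Let Sm m w := \sum_(t < m) D t w.

Let mcv_group_D (J : {set Idx}) (t : 'I_N) : jx t \in J -> ju t \in J ->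
  measurable_cv (D t : g_sigma_algebraType (group_sys S J) -> 'cV[R]_n).
Proof.
move=> tx tu; apply: measurable_cvB; last exact: measurable_cv_cst.
apply: (measurable_cv_comp mcvG (h := pair t : g_sigma_algebraType (group_sys S J) -> _)).
apply: measurable_fun_pair.
  exact: (group_measurable_member TS tu (@Su t)).
exact: (group_measurable_member TS tx (@Sx t)).
Qed.

(** Variances of independent centred vectors add up: the partial sum and the next term depend on
    disjoint groups of sources, so the cross term vanishes. *)
Lemma sqr_enorm_batch_sum m : (m <= N)%N ->
  P.-integrable setT (fun w => (enorm (Sm m w) ^+ 2)%:E) /\
  (\int[P]_w (enorm (Sm m w) ^+ 2)%:E <= (m%:R * V)%:E)%E.
Proof.
elim: m => [_|m IH mN].
  have E w : (enorm (Sm 0 w) ^+ 2)%:E = 0%E :> \bar R.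
    by rewrite /Sm big_ord0 enorm0 expr0n.
  under eq_integral do rewrite E; under eq_fun do rewrite E.
  by rewrite integral0 mul0r; split => //; exact: integrable0.
have [iS leS] := IH (ltnW mN); pose t := Ordinal mN.
have [iD leD] := sqr_enorm_D t.
have mSm : measurable_cv (Sm m) by exact: measurable_cv_sum.
have iSD := integrable_dotc2 mSm (mcvD t) iS iD.
(* The sources of the first [m] samples; [J2] holds the two sources of the sample of index [m]. *)
pose J1 := [set j | [exists s : 'I_N, (s < m)%N && ((j == jx s) || (j == ju s))]]%SET.
pose J2 := [set jx t; ju t]%SET.
have J12 : [disjoint J1 & J2]%B.
  apply/pred0P => j /=; apply/negP; rewrite !inE => /andP[/existsP[s /andP[sm /orP[]/eqP->]]].
    rewrite (negbTE (jxu _ _)) orbF => /eqP/jx_inj st.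
    by rewrite st ltnn in sm.
  rewrite eq_sym (negbTE (jxu _ _)) => /eqP/ju_inj st.
  by rewrite st ltnn in sm.
have orth : (\int[P]_w (dotc (Sm m w) (D t w))%:E = 0)%E.
  apply: (@group_orthogonal _ _ _ P Idx S mS IS TS indS J1 J2 J12 n (Sm m) (D t)).
  - apply: measurable_cv_sum => s.
    have sN : (s < N)%N by exact: ltn_trans (ltn_ord s) mN.
    apply: (@mcv_group_D _ (Ordinal sN)); rewrite inE; apply/existsP; exists (Ordinal sN).
      by rewrite /= ltn_ord eqxx.
    by rewrite /= ltn_ord eqxx orbT.
  - by apply: mcv_group_D; rewrite !inE eqxx ?orbT.
  - exact: iSD.
  - by move=> v; exact: integrable_dotc_D.
  - by move=> v; exact: integral_dotc_D.
have E w : ((enorm (Sm m w) ^+ 2)%:E + 2%:E * (dotc (Sm m w) (D t w))%:E +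
    (enorm (D t w) ^+ 2)%:E = (enorm (Sm m.+1 w) ^+ 2)%:E)%E.
  have -> : Sm m.+1 w = Sm m w + D t w by rewrite /Sm big_ord_recr.
  by rewrite (sqr_enormD (Sm m w) (D t w)) -EFinM -!EFinD.
have i2 := integrableZl measurableT 2 iSD.
have i3 := integrableD measurableT iS i2.
split; first by apply: eq_integrable (integrableD measurableT i3 iD) => // w _; exact: E.
under eq_integral do rewrite -E.
rewrite integralD// integralD// integralZl// orth mule0 adde0.
by rewrite -natr1 mulrDl mul1r EFinD leeD.
Qed.

Definition batch_mean w := N%:R^-1 *: \sum_(t < N) zo_grad F mu x (u t w, xi t w).

Hypothesis N0 : (0 < N)%N.

Let batchE w : batch_mean w - g = N%:R^-1 *: Sm N w.
Proof.
rewrite /batch_mean /Sm /D big_split/= scalerDr sumr_const card_ord -(scaler_nat N (- g)).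
rewrite scalerA mulVf ?scale1r//.
by rewrite pnatr_eq0 -lt0n.
Qed.

Lemma batch_mean_unbiased c :
  P.-integrable setT (fun w => (dotc (batch_mean w - g) c)%:E) /\
  (\int[P]_w (dotc (batch_mean w - g) c)%:E = 0)%E.
Proof.
have E w : (\sum_(t < N) (N%:R^-1)%:E * (dotc c (D t w))%:E = (dotc (batch_mean w - g) c)%:E)%E.
  rewrite batchE dotcZl; under eq_bigr do rewrite -EFinM.
  rewrite sumEFin; congr _%:E; rewrite -mulr_sumr; congr (_ * _).
  rewrite /Sm dotcC; elim/big_rec2: _ => [|t a v _ ->]; first by rewrite dotc0r.
  by rewrite dotcDr.
have i1 (t : 'I_N) := integrableZl measurableT N%:R^-1 (integrable_dotc_D t c).
split.
  have i2 : P.-integrable setT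
      (fun w => (\sum_(t < N) (N%:R^-1)%:E * (dotc c (D t w))%:E)%E).
    by apply: integrable_sum => // t _; exact: i1.
  by apply: eq_integrable i2 => // w _; exact: E.
under eq_integral do rewrite -E.
rewrite integral_sum//; apply: big1 => t _.
by rewrite integralZl ?integral_dotc_D ?mule0//; exact: integrable_dotc_D.
Qed.

Lemma batch_mean_variance :
  P.-integrable setT (fun w => (enorm (batch_mean w - g) ^+ 2)%:E) /\
  (\int[P]_w (enorm (batch_mean w - g) ^+ 2)%:E <= (V / N%:R)%:E)%E.
Proof.
have [iS leS] := sqr_enorm_batch_sum (leqnn N).
have E w : ((N%:R^-1 ^+ 2)%:E * (enorm (Sm N w) ^+ 2)%:E = (enorm (batch_mean w - g) ^+ 2)%:E)%E.
  by rewrite batchE enormZ exprMn -EFinM ger0_norm ?invr_ge0.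
have i1 := integrableZl measurableT (N%:R^-1 ^+ 2) iS.
split; first by apply: eq_integrable i1 => // w _; exact: E.
under eq_integral do rewrite -E.
rewrite integralZl//.
have c0 : (0 <= (N%:R^-1 ^+ 2)%:E :> \bar R)%E by rewrite lee_fin sqr_ge0.
apply: le_trans (lee_wpmul2l c0 leS) _.
rewrite -EFinM lee_fin le_eqVlt; apply/orP; left; apply/eqP.
by field; rewrite pnatr_eq0 -lt0n.
Qed.

End batch.

(** * The run of the method *)

Lemma preimage_set_system_setI (aT rT : Type) (h : aT -> rT) (G : set (set rT)) :
  setI_closed G -> setI_closed (preimage_set_system setT h G).
Proof.
move=> IG _ _ [A GA <-] [B GB <-]; exists (A `&` B); first exact: IG.
by rewrite !setTI preimage_setI.
Qed.

Lemma preimage_set_system_setT (aT rT : Type) (h : aT -> rT) (G : set (set rT)) :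
  G setT -> preimage_set_system setT h G setT.
Proof. by move=> GT; exists setT => //; rewrite preimage_setT setTI. Qed.

Lemma fin_preimage_measurable {d} {W : measurableType d} {J : finType} (h : W -> J) :
  (forall s, measurable (h @^-1` [set s])) -> forall B, measurable (h @^-1` B).
Proof.
move=> mh B; rewrite (_ : h @^-1` B = \bigcup_(s in B) (h @^-1` [set s])).
  by apply: fin_bigcup_measurable => //; exact: finite_finset.
by apply/seteqP; split => [w Bw|w [s Bs /= hs]]; [exists (h w)|rewrite /= hs].
Qed.

Section method_independence.
Context {R : realType} {b : nat} {n_ : 'I_b.+1 -> nat}.
Local Notation n := (\sum_s n_ s)%N.
Context {dX : measure_display} {Xi : measurableType dX}.
Context {d : measure_display} {Omega : measurableType d} (P : probability Omega R).
Variables (T : nat) (N : nat -> nat) (i : nat -> Omega -> 'I_b.+1).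
Variables (xi : nat -> nat -> {RV P >-> Xi}) (u : nat -> nat -> {RV P >-> n.-tuple R}).
Variable (rho : Omega -> 'I_T).
Hypothesis mi : forall (k : 'I_T) s, measurable (i k @^-1` [set s]).
Hypothesis mrho : forall k, measurable (rho @^-1` [set k]).

Definition source : finType := ('I_T + sample_index T N + sample_index T N + unit)%type.

Local Notation SS := (@method_sigma R b n_ dX Xi d Omega P T N i xi u rho).

Definition index_source (k : 'I_T) : source := inl (inl (inl k)).
Definition oracle_source (k : 'I_T) (t : 'I_(N k)) : source :=
  inl (inl (inr (existT _ k t))).
Definition gauss_source (k : 'I_T) (t : 'I_(N k)) : source := inl (inr (existT _ k t)).
Definition output_source : source := inr tt.

(** The step at which a source is consulted. The output index gets stage [T], after all steps
    [0 .. T-1], so [before T] contains the whole run but not the output. *)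
Definition stage (z : source) : nat :=
  match z with
  | inl (inl (inl k)) => k
  | inl (inl (inr (existT k _))) => k
  | inl (inr (existT k _)) => k
  | inr _ => T
  end.

Definition is_index (z : source) : bool := if z is inl (inl (inl _)) then true else false.

Definition before (k : nat) : {set source} := [set z | (stage z < k)%N]%SET.
Definition at_stage (k : nat) : {set source} := [set z | stage z == k]%SET.
(** The block index is left out, so that it is independent of the batch of the same step. *)
Definition samples_at (k : nat) : {set source} := [set z | (stage z == k) && ~~ is_index z]%SET.

Lemma method_sigma_measurable z : SS z `<=` measurable.
Proof.
case: z => [[[k|[k t]]|[k t]]|[]] /= _ [B mB <-]; rewrite setTI.
- exact: (fin_preimage_measurable (mi k)).
- by rewrite -[X in measurable X]setTI; exact: measurable_funP.
- by rewrite -[X in measurable X]setTI; exact: measurable_funP.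
- exact: (fin_preimage_measurable mrho).
Qed.

Lemma method_sigma_setI z : setI_closed (SS z).
Proof.
by case: z => [[[k|[k t]]|[k t]]|[]] /=; apply: preimage_set_system_setI => // A B; exact: measurableI.
Qed.

Lemma method_sigma_setT z : SS z setT.
Proof. by case: z => [[[k|[k t]]|[k t]]|[]] /=; apply: preimage_set_system_setT. Qed.

Local Notation O J := (g_sigma_algebraType (group_sys SS J)).

Lemma measurable_index (J : {set source}) (k : 'I_T) s : index_source k \in J ->
  measurable (i k @^-1` [set s] : set (O J)).
Proof.
move=> kJ; apply: sub_sigma_algebra; apply: (sub_group_sys method_sigma_setT kJ).
by exists [set s] => //; rewrite setTI.
Qed.

Lemma measurable_output (J : {set source}) k : output_source \in J ->
  <<s group_sys SS J >> (rho @^-1` [set k]).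
Proof.
move=> kJ; apply: sub_sigma_algebra; apply: (sub_group_sys method_sigma_setT kJ).
by exists [set k] => //; rewrite setTI.
Qed.

Lemma measurable_oracle (J : {set source}) (k : 'I_T) (t : 'I_(N k)) :
  oracle_source t \in J -> measurable_fun setT (xi k t : O J -> Xi).
Proof. by move=> tJ; exact: (group_measurable_member method_sigma_setT tJ). Qed.

Lemma measurable_gauss (J : {set source}) (k : 'I_T) (t : 'I_(N k)) :
  gauss_source t \in J -> measurable_fun setT (u k t : O J -> n.-tuple R).
Proof. by move=> tJ; exact: (group_measurable_member method_sigma_setT tJ). Qed.

Lemma oracle_source_inj k : injective (@oracle_source k).
Proof.
(* A projection out of the sum type; its value on the other constructors is an arbitrary default. *)
move=> t t' /(congr1 (fun z : source =>
  if z is inl (inl (inr q)) then q else existT _ k t)) /= /eqP.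
by rewrite eq_Tagged => /eqP.
Qed.

Lemma gauss_source_inj k : injective (@gauss_source k).
Proof.
move=> t t' /(congr1 (fun z : source =>
  if z is inl (inr q) then q else existT _ k t)) /= /eqP.
by rewrite eq_Tagged => /eqP.
Qed.

Lemma disjoint_stage (J1 J2 : {set source}) (C : pred source) :
  {subset J1 <= C} -> {subset J2 <= predC C} -> [disjoint J1 & J2]%B.
Proof.
move=> H1 H2; apply/pred0P => z /=; apply/negP => /andP[/H1 h1 /H2].
by move: h1; rewrite !inE /in_mem /= => ->.
Qed.

End method_independence.

(** * Expectations along the run *)

Section run.
Context {R : realType} {b : nat} {n_ : 'I_b.+1 -> nat}.
Local Notation n := (\sum_s n_ s)%N.
Context {dX : measure_display} {Xi : measurableType dX}.
Context {d : measure_display} {Omega : measurableType d} (P : probability Omega R).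
Variables (Q : probability Xi R) (F : 'cV[R]_n -> Xi -> R) (f : 'cV[R]_n -> R).
Variables (X : forall s, set 'cV[R]_(n_ s)) (phi chi : forall s, 'cV[R]_(n_ s) -> R).
Variables (Phistar Lf mu sigma M : R) (L p : 'I_b.+1 -> R).
Variables (T : nat) (alpha : nat -> R) (N : nat -> nat) (x1 : 'cV[R]_n).
Variables (i : nat -> Omega -> 'I_b.+1).
Variables (xi : nat -> nat -> {RV P >-> Xi}) (u : nat -> nat -> {RV P >-> n.-tuple R}).
Variable (rho : Omega -> 'I_T).
Hypothesis mF : measurable_fun setT (fun z : n.-tuple R * Xi => F (tcol z.1) z.2).
Hypotheses (cX : forall s, closed (@X s)) (sX : forall s, segment_closed (@X s)).
Hypotheses (cchi : forall s, closed_convex (@chi s)).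
Hypotheses (dphi : forall s y, differentiable (@phi s) y).
Hypotheses (sphi : forall s, strongly_convex1 (@phi s)).
Local Notation Phi := (composite (gsmooth mu f) chi).
Hypothesis Phi_ge : forall x, block_prod X x -> Phistar <= Phi x.
Hypotheses (Lf0 : 0 < Lf) (L0 : forall s, 0 < L s) (mu0 : 0 < mu).
Hypothesis df : forall x, differentiable f x.
Hypothesis Lip : forall x y, enorm (grad f x - grad f y) <= Lf * enorm (x - y).
Hypothesis blkLip : forall s x (h : 'cV[R]_(n_ s)),
  enorm (blk s (grad f (x + Umx n_ s *m h)) - blk s (grad f x)) <= L s * enorm h.
Hypothesis Ff : forall x,
  Q.-integrable setT (EFin \o F x) /\ ('E_Q[F x] = (f x)%:E)%E.
Hypothesis gradFf : forall x j,
  Q.-integrable setT (fun z => (grad (F ^~ z) x j 0)%:E) /\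
  ('E_Q[fun z => (grad (F ^~ z) x j 0)%R] = (grad f x j 0)%:E)%E.
Hypothesis varF : forall x, block_prod X x ->
  ('E_Q[fun z => (enorm (grad (F ^~ z) x - grad f x) ^+ 2)%R] <= (sigma ^+ 2)%:E)%E.
Hypothesis LipF : {ae Q, forall z, (forall x, differentiable (F ^~ z) x) /\
   forall x y, enorm (grad (F ^~ z) x - grad (F ^~ z) y) <= Lf * enorm (x - y)}.
Hypothesis gradM : forall x, block_prod X x -> enorm (grad f x) <= M.
Hypothesis Xx1 : block_prod X x1.
Hypothesis N0 : forall k : 'I_T, (0 < N k)%N.
Hypotheses (p01 : forall s, 0 <= p s <= 1) (sp1 : \sum_s p s = 1).
Hypotheses (a0 : forall k : 'I_T, 0 < alpha k) (aL : forall (k : 'I_T) s, alpha k <= 2 / L s).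
Hypothesis mi : forall (k : 'I_T) s, measurable (i k @^-1` [set s]).
Hypothesis Pi : forall (k : 'I_T) s, P (i k @^-1` [set s]) = (p s)%:E.
Hypothesis law_xi : forall (k : 'I_T) (t : 'I_(N k)), same_law (xi k t) Q.
Hypothesis law_u : forall (k : 'I_T) (t : 'I_(N k)), same_law (u k t) (std_gaussian n).
Hypothesis mrho : forall k, measurable (rho @^-1` [set k]).
Local Notation SS := (@method_sigma R b n_ dX Xi d Omega P T N i xi u rho).
Hypothesis indS : mutually_independent P SS.
Local Notation src := (source T N).
Local Notation O J := (g_sigma_algebraType (group_sys SS J)).
Local Notation batch k x := (batch_mean F mu x (N k) (xi k) (u k)).
Local Notation weight k := (step_weight L p (alpha k)).
Local Notation V := (zo_variance (n := n) Lf mu sigma M).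
Local Notation x_ k := (zsbmd X phi chi F mu alpha N i xi u x1 k).

Let mS := @method_sigma_measurable R b n_ dX Xi d Omega P T N i xi u rho mi mrho.
Let IS := @method_sigma_setI R b n_ dX Xi d Omega P T N i xi u rho.
Let TS := @method_sigma_setT R b n_ dX Xi d Omega P T N i xi u rho.

Let X0 s : @X s !=set0.
Proof. by exists (blk s x1); exact: Xx1. Qed.

Let cPhi : continuous (gsmooth mu f).
Proof. exact: (gsmooth_continuous df mu0 Lf0 Lip). Qed.

Lemma zsbmdS k w : x_ k.+1 w =
  block_step X phi chi (alpha k) (i k w) (x_ k w) (batch k (x_ k w) w).
Proof.
rewrite /= /block_step; apply: eq_mxcol => s; case: eqP => // _; congr bprox.
by rewrite /Gbatch /batch_mean blkZ blk_sum.
Qed.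

Lemma zsbmd_in (k : nat) w : (k <= T)%N -> block_prod X (x_ k w).
Proof.
elim: k => [//|k IH kT]; rewrite zsbmdS.
by have := IH (ltnW kT); have := a0 (Ordinal kT); move=> /= ak Xk; exact: block_step_in.
Qed.

(** The point [y] and the outcome [h] feeding the samples are separate maps on [W], so that [W] can
    be a product with the past in one factor and the current step in the other. *)
Lemma measurable_cv_batch {d'} {W : measurableType d'} (J : {set source T N})
    (k : 'I_T) (y : W -> 'cV[R]_n) (h : W -> O J) :
  {subset samples_at T N k <= J} ->
  measurable_cv y -> measurable_fun setT h ->
  measurable_cv (fun z => batch k (y z) (h z)).
Proof.
move=> kJ my mh; apply: measurable_cvZ => //; apply: measurable_cv_sum => t.
have mt : (stage (oracle_source t) == k) && ~~ is_index (oracle_source t) by rewrite /= eqxx.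
have mt' : (stage (gauss_source t) == k) && ~~ is_index (gauss_source t) by rewrite /= eqxx.
apply: (measurable_cv_Gmu mu mF my (v := fun z => tcol (u k t (h z)))
  (zeta := fun z => xi k t (h z))).
  apply: (measurable_cv_comp measurable_cv_tcol (h := fun z => u k t (h z))).
  apply: (measurableT_comp _ mh); apply: measurable_gauss; apply: kJ.
  by rewrite inE.
by apply: (measurableT_comp _ mh); apply: measurable_oracle; apply: kJ; rewrite inE.
Qed.

Let mcv_batch (J : {set src}) (k : 'I_T) x : {subset samples_at T N k <= J} ->
  measurable_cv (batch k x : O J -> 'cV[R]_n).
Proof.
move=> kJ; apply: (@measurable_cv_batch _ _ J k (fun=> x) id kJ).
  exact: measurable_cv_cst.
exact: measurable_id.
Qed.

Let Phi_measurable {d'} {W : measurableType d'} (y : W -> 'cV[R]_n) : measurable_cv y ->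
  measurable_fun setT (fun z => (Phi (y z) - Phistar)%:E).
Proof.
move=> my; apply/measurable_EFinP; apply: measurable_funB => //.
exact: measurable_composite.
Qed.

Let step_gap k x w := Phi (block_step X phi chi (alpha k) (i k w) x (batch k x w)) - Phistar.

Definition step_error k : R :=
  weight k / 2 * (Lf ^+ 2 * mu ^+ 2 * n%:R) + 2 * alpha k * bmax p * (V / (N k)%:R).

(** The integrand is split by the indicators of the values of the block index, each independent of
    the batch at the fixed point [x]. *)
Lemma step_gap_mixture (k : 'I_T) x : block_prod X x ->
  (\int[P]_w (step_gap k x w)%:E = \int[P]_w (\sum_s p s *
     (Phi (block_step X phi chi (alpha k) s x (batch k x w)) - Phistar))%:E)%E.
Proof.
move=> Xx.
pose Psi s w := (Phi (block_step X phi chi (alpha k) s x (batch k x w)) - Phistar)%:E.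
have Psi0 s w : (0 <= Psi s w)%E.
  rewrite lee_fin subr_ge0; apply: Phi_ge.
  exact: (block_step_in cX sX cchi dphi sphi (a0 k) Xx).
have mPsi (J : {set src}) s : {subset samples_at T N k <= J} -> measurable_fun setT (Psi s : O J -> _).
  move=> kJ; apply: Phi_measurable.
  apply: (measurable_cv_block_step cX sX X0 cchi dphi sphi (a0 k) (iota := fun=> s)).
  - by move=> s'; rewrite preimage_cst; case: ifP => _; [exact: measurableT|exact: measurable0].
  - exact: measurable_cv_cst.
  - exact: mcv_batch.
have mPsi' s : measurable_fun setT (Psi s).
  exact: (group_measurable_fun mS (mPsi (samples_at T N k) s _)).
transitivity (\int[P]_w (\sum_s (\1_(i k @^-1` [set s]) w)%:E * Psi s w))%E.
  apply: eq_integral => w _; apply/esym; apply: etrans; first exact: (bigD1 (i k w)).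
  rewrite /= indicE mem_set// mul1e big1 ?adde0// => s sw.
  by rewrite indicE memNset ?mul0e//= => /esym/eqP; rewrite (negbTE sw).
rewrite ge0_integral_sum//; last 2 first.
- move=> s; apply: emeasurable_funM => //; apply/measurable_EFinP.
  exact: measurable_indic.
- by move=> s w _; rewrite mule_ge0// lee_fin.
under eq_integral do rewrite -sumEFin.
rewrite ge0_integral_sum//; last 2 first.
- move=> s; under eq_fun do rewrite EFinM.
  by apply: emeasurable_funM => //; exact: mPsi'.
- move=> s w _; rewrite EFinM mule_ge0//; last exact: Psi0.
  by rewrite lee_fin; case/andP: (p01 s).
apply: eq_bigr => s _.
have dis : [disjoint [set index_source N k]%SET & samples_at T N k]%B.
  by rewrite disjoints1 inE /= andbF.
rewrite (group_indic mS IS TS indS dis)//; last 2 first.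
- by apply: measurable_index; rewrite inE.
- exact: mPsi.
rewrite Pi; under [RHS]eq_integral do rewrite EFinM.
rewrite ge0_integralZl//; first exact: mPsi'.
- by move=> w _; exact: Psi0.
- by rewrite lee_fin; case/andP: (p01 s).
Qed.

Local Notation sqgrad k x := (enorm (ggrad X phi chi x (grad f x) (alpha k)) ^+ 2).

(** The pointwise inequality is integrated at fixed [x]. The left-hand side [Y] is only known to be
    nonnegative; the bound [Z] is integrable, its linear term has mean zero and its quadratic term
    is bounded by the batch variance. *)
Lemma step_mean (k : 'I_T) x : block_prod X x ->
  (\int[P]_w (step_gap k x w)%:E + (weight k / 4 * sqgrad k x)%:E <=
   (Phi x - Phistar + step_error k)%:E)%E.
Proof.
move=> Xx; rewrite step_gap_mixture//; set c := weight k / 4 * _.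
pose Y w := \sum_s p s *
  (Phi (block_step X phi chi (alpha k) s x (batch k x w)) - Phistar).
pose Z w := Phi x - Phistar + weight k / 2 * (Lf ^+ 2 * mu ^+ 2 * n%:R)
  + alpha k * dotc (batch k x w - gsmooth_grad mu f x) (lin_coef X phi chi f mu p (alpha k) x)
  + 2 * alpha k * bmax p * enorm (batch k x w - gsmooth_grad mu f x) ^+ 2.
have YZ w : Y w + c <= Z w.
  exact: (one_step_mean cX sX cchi dphi sphi Lf0 L0 mu0 df Lip blkLip p01 sp1 (a0 k) (aL k) Xx).
have Y0 w : 0 <= Y w.
  apply: sumr_ge0 => s _; apply: mulr_ge0; first by case/andP: (p01 s).
  rewrite subr_ge0; apply: Phi_ge.
  exact: (block_step_in cX sX cchi dphi sphi (a0 k) Xx).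
have c0 : 0 <= c.
  by rewrite mulr_ge0 ?sqr_ge0// divr_ge0// (step_weight_ge0 L0 p01 (a0 k) (aL k)).
have jxu (t t' : 'I_(N k)) : oracle_source t != gauss_source t' by [].
have Sx (t : 'I_(N k)) : g_sigma_algebra_preimage (xi k t) `<=` SS (oracle_source t) by [].
have Su (t : 'I_(N k)) : g_sigma_algebra_preimage (u k t) `<=` SS (gauss_source t) by [].
have G2 := zo_grad_second_moment mF Lf0 mu0 gradFf (varF Xx) LipF (gradM Xx).
have iG := zo_grad_integrable mF Lf0 mu0 gradFf (varF Xx) LipF (gradM Xx).
have EG := zo_grad_mean mF Lf0 mu0 df Lip Ff gradFf (varF Xx) LipF (gradM Xx).
have [i1 E1] := batch_mean_unbiased TS indS jxu Sx Su (@law_xi k) (@law_u k) iG EG (N0 k)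
  (lin_coef X phi chi f mu p (alpha k) x).
have [i2 E2] := batch_mean_variance mS IS TS indS (@oracle_source_inj T N k)
  (@gauss_source_inj T N k) jxu Sx Su (@law_xi k) (@law_u k) mF G2 iG EG (N0 k).
have mb : measurable_cv (batch k x).
  by move=> j; apply: (group_measurable_fun mS (mcv_batch (J := samples_at T N k) x _ j)).
have mY : measurable_fun setT Y.
  apply: measurable_sum => s; apply: measurable_funM => //.
  apply/measurable_EFinP; apply: Phi_measurable.
  apply: (measurable_cv_block_step cX sX X0 cchi dphi sphi (a0 k) (iota := fun=> s)).
  - by move=> s'; rewrite preimage_cst; case: ifP => _; [exact: measurableT|exact: measurable0].
  - exact: measurable_cv_cst.
  - exact: mb.
pose K := Phi x - Phistar + weight k / 2 * (Lf ^+ 2 * mu ^+ 2 * n%:R).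
have iK : P.-integrable setT (fun=> K%:E) by exact: finite_measure_integrable_cst.
have i1' := integrableZl measurableT (alpha k) i1.
have i2' := integrableZl measurableT (2 * alpha k * bmax p) i2.
have iK1 := integrableD measurableT iK i1'.
have iZ := integrableD measurableT iK1 i2'.
have ZE w : (K%:E + (alpha k)%:E * (dotc (batch k x w - gsmooth_grad mu f x)
    (lin_coef X phi chi f mu p (alpha k) x))%:E + (2 * alpha k * bmax p)%:E *
    (enorm (batch k x w - gsmooth_grad mu f x) ^+ 2)%:E = (Z w)%:E)%E by [].
apply: (@le_trans _ _ (\int[P]_w (Y w + c)%:E)%E).
  under [leRHS]eq_integral do rewrite EFinD.
  rewrite ge0_integralD//; last 2 first.
  - by move=> w _; rewrite lee_fin.
  - exact/measurable_EFinP.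
  by rewrite integral_cst//= probability_setT mule1.
apply: (@le_trans _ _ (\int[P]_w (Z w)%:E)%E).
  apply: ge0_le_integral => //.
  - by move=> w _; rewrite lee_fin addr_ge0.
  - by apply/measurable_EFinP; apply: measurable_funD.
  - exact: measurable_int iZ.
  - by move=> w _; rewrite lee_fin.
under eq_integral do rewrite -ZE.
rewrite integralD// integralD// integralZl// integralZl// E1 mule0 adde0.
rewrite integral_cst//= probability_setT mule1 /step_error addrA -/K [leRHS]EFinD leeD2lE//.
have B0 : 0 <= 2 * alpha k * bmax p.
  rewrite mulr_ge0//; first by rewrite mulr_ge0// ltW// a0.
  by apply: le_trans (bmax_ge p ord0); case/andP: (p01 ord0).
by rewrite [leRHS]EFinM; apply: lee_wpmul2l => //; rewrite lee_fin.
Qed.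

(** The precise sense in which the iterate is a function of the sources consulted before step [k]:
    measurability for the sigma-algebra they generate. *)
Lemma measurable_zsbmd (J : {set src}) k : (k <= T)%N ->
  {subset before T N k <= J} -> measurable_cv (x_ k : O J -> 'cV[R]_n).
Proof.
elim: k => [_ _|k IH kT kJ]; first exact: measurable_cv_cst.
have sub m : (m <= k)%N -> {subset before T N m <= J}.
  by move=> mk z; rewrite inE => zm; apply: kJ; rewrite inE ltnS ltnW// (leq_trans zm).
have mx := IH (ltnW kT) (sub k (leqnn k)).
rewrite (_ : x_ k.+1 = fun w => block_step X phi chi (alpha k) (i k w) (x_ k w)
  (batch k (x_ k w) w)); last by apply/funext => w; exact: zsbmdS.
apply: (measurable_cv_block_step cX sX X0 cchi dphi sphi (a0 (Ordinal kT)) (iota := i k : O J -> _)).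
- by move=> s; apply: (@measurable_index _ _ _ _ _ _ _ P T N i xi u rho J (Ordinal kT));
    apply: kJ; rewrite inE.
- exact: mx.
- have kJ' : {subset samples_at T N (Ordinal kT) <= J}.
    by move=> z; rewrite inE => /andP[/eqP zk _]; apply: kJ; rewrite inE zk.
  have mid : measurable_fun setT (id : O J -> O J) by exact: measurable_id.
  exact: (measurable_cv_batch kJ' mx mid).
Qed.

(** Kept in the extended reals: finiteness is not known beforehand, and nonnegativity of the
    integrand is enough for what follows. *)
Definition mean_gap k : \bar R := (\int[P]_w (Phi (x_ k w) - Phistar)%:E)%E.

Definition mean_sqr_ggrad k : \bar R := (\int[P]_w (sqgrad k (x_ k w))%:E)%E.

Lemma measurable_sqgrad (k : 'I_T) d' (W : measurableType d') (y : W -> 'cV[R]_n) :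
  measurable_cv y -> measurable_fun setT (fun w => (sqgrad k (y w))%:E).
Proof.
move=> my; apply/measurable_EFinP; apply: measurable_sqr_enorm.
apply: (measurable_cv_ggrad cX sX X0 cchi dphi sphi (a0 k) my).
exact: (measurable_cv_grad my df).
Qed.

(** The sources before [k] and those of stage [k] are disjoint groups, so the mean gap is a double
    integral. The inner one, at a frozen iterate, is bounded by [step_mean]. *)
Lemma mean_descent (k : 'I_T) :
  (mean_gap k.+1 + (weight k / 4)%:E * mean_sqr_ggrad k <=
   mean_gap k + (step_error k)%:E)%E.
Proof.
pose J1 := before T N k; pose J2 := at_stage T N k.
have J12 : [disjoint J1 & J2]%B.
  apply: (@disjoint_stage _ _ J1 J2 [pred z | (stage z < k)%N]) => z; rewrite !inE//.
  by move=> /eqP ->; rewrite ltnn.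
have mx : measurable_cv (x_ k : O J1 -> 'cV[R]_n) by apply: measurable_zsbmd => //; exact: ltnW.
have mx' : measurable_cv (x_ k) by move=> j; exact: (group_measurable_fun mS (mx j)).
pose H (q : O J1 * O J2) := (step_gap k (x_ k q.1) q.2)%:E.
have xin w : block_prod X (x_ k w) by apply: zsbmd_in; exact: ltnW.
have H0 q : (0 <= H q)%E.
  rewrite lee_fin subr_ge0; apply: Phi_ge.
  exact: (block_step_in cX sX cchi dphi sphi (a0 k) (xin _)).
have mx1 : measurable_cv (fun q : O J1 * O J2 => x_ k q.1).
  exact: (measurable_cv_comp mx measurable_fst).
have mH : measurable_fun setT H.
  apply: Phi_measurable.
  apply: (measurable_cv_block_step cX sX X0 cchi dphi sphi (a0 k)
    (iota := fun q : O J1 * O J2 => i k q.2)).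
  - move=> s; have := @measurable_index _ _ _ _ _ _ _ P T N i xi u rho J2 k s.
    rewrite inE /= eqxx => /(_ isT) m2.
    by have := @measurable_snd _ _ (O J1) (O J2) measurableT _ m2; rewrite setTI.
  - exact: mx1.
  - apply: (measurable_cv_batch (h := fun q : O J1 * O J2 => q.2)) => //; last exact: measurable_snd.
    by move=> z; rewrite !inE => /andP[].
have -> : mean_gap k.+1 = (\int[P]_w1 \int[P]_w2 H (w1, w2))%E.
  rewrite -(group_decouple mS IS TS indS J12 mH H0).
  by apply: eq_integral => w _; rewrite /H /step_gap zsbmdS.
have w0 : 0 <= weight k by exact: (step_weight_ge0 L0 p01 (a0 k) (aL k)).
have msq : measurable_fun setT (fun w => (sqgrad k (x_ k w))%:E) by exact: measurable_sqgrad.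
rewrite /mean_sqr_ggrad -ge0_integralZl//; last 2 first.
- by move=> w _; rewrite lee_fin sqr_ge0.
- by rewrite lee_fin divr_ge0.
have gap0 w : 0 <= Phi (x_ k w) - Phistar by rewrite subr_ge0 Phi_ge.
have V0 : 0 <= V.
  have := zo_grad_second_moment mF Lf0 mu0 gradFf (varF Xx1) LipF (gradM Xx1).
  rewrite -lee_fin; apply: le_trans; apply: integral_ge0 => q _.
  by rewrite lee_fin sqr_ge0.
have e0 : 0 <= step_error k.
  apply: addr_ge0.
    by apply: mulr_ge0; [rewrite divr_ge0|apply: mulr_ge0 => //; apply: mulr_ge0; exact: sqr_ge0].
  rewrite mulr_ge0 ?divr_ge0// mulr_ge0//; first by rewrite mulr_ge0// ltW// a0.
  by apply: le_trans (bmax_ge p ord0); case/andP: (p01 ord0).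
have sm w : (\int[P]_w2 H (w, w2) + (weight k / 4)%:E * (sqgrad k (x_ k w))%:E <=
    (Phi (x_ k w) - Phistar + step_error k)%:E)%E.
  by rewrite -EFinM; exact: (step_mean k (xin w)).
have mHm := group_measurable_decouple P mS (J1 := J1) mH H0.
have mHm' := group_measurable_fun mS mHm.
rewrite -ge0_integralD//; last 3 first.
- by move=> w _; exact: integral_ge0.
- by move=> w _; rewrite -EFinM lee_fin mulr_ge0 ?sqr_ge0// divr_ge0.
- exact: emeasurable_funM.
apply: (@le_trans _ _ (\int[P]_w (Phi (x_ k w) - Phistar + step_error k)%:E)%E).
  apply: ge0_le_integral => //.
  - move=> w _; apply: adde_ge0; first exact: integral_ge0.
    by rewrite -EFinM lee_fin mulr_ge0 ?sqr_ge0// divr_ge0.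
  - by apply: emeasurable_funD => //; exact: emeasurable_funM.
  - apply/measurable_EFinP; apply: measurable_funD => //.
    by apply/measurable_EFinP; exact: Phi_measurable.
under eq_integral do rewrite EFinD.
rewrite ge0_integralD//; last 2 first.
- by move=> w _; rewrite lee_fin.
- exact: Phi_measurable.
by rewrite integral_cst//= probability_setT mule1.
Qed.

(** The gap at [k] stays on the left, so the induction never subtracts a possibly infinite
    quantity. *)
Lemma mean_telescope k : (k <= T)%N ->
  (mean_gap k + \sum_(j < k) (weight j / 4)%:E * mean_sqr_ggrad j <=
   (Phi x1 - Phistar + \sum_(j < k) step_error j)%:E)%E.
Proof.
elim: k => [_|k IH kT].
  by rewrite !big_ord0 adde0 addr0 /mean_gap /= integral_cst//= probability_setT mule1.
rewrite big_ord_recr [\sum_(j < k.+1) step_error j]big_ord_recr /= addeCA [in leRHS]addrA [leRHS]EFinD.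
apply: (@le_trans _ _ (\sum_(j < k) (weight j / 4)%:E * mean_sqr_ggrad j +
    (mean_gap k + (step_error k)%:E))%E).
  by apply: leeD => //; exact: (mean_descent (Ordinal kT)).
by rewrite addeA; apply: leeD => //; rewrite addeC; apply: IH; exact: ltnW.
Qed.

Lemma mean_output_mixture :
  (\int[P]_w (sqgrad (rho w) (x_ (rho w) w))%:E =
   \sum_(k < T) P (rho @^-1` [set k]) * mean_sqr_ggrad k)%E.
Proof.
have mx (k : 'I_T) : measurable_cv (x_ k : O (before T N T) -> 'cV[R]_n).
  apply: measurable_zsbmd; first exact: ltnW.
  by move=> z; rewrite !inE => zk; apply: ltn_trans zk _.
have msq (k : 'I_T) := measurable_sqgrad k (mx k).
have dis : [disjoint [set output_source T N]%SET & before T N T]%B.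
  by rewrite disjoints1 inE /= ltnn.
transitivity (\int[P]_w \sum_(k < T)
    (\1_(rho @^-1` [set k]) w)%:E * (sqgrad k (x_ k w))%:E)%E.
  (* Both the iterate and the stepsize are read at [rho w]; writing the integrand as a function of
     the index lets the sum of indicators collapse to one term. *)
  apply: eq_integral => w _; pose g (k : 'I_T) := (sqgrad k (x_ k w))%:E.
  rewrite -[LHS]/(g (rho w)) [RHS](eq_bigr (fun k => (\1_(rho @^-1` [set k]) w)%:E * g k)%E)//.
  move: g => g; rewrite (bigD1 (rho w))//= indicE mem_set// mul1e big1 ?adde0// => k kw.
  by rewrite indicE memNset ?mul0e//= => /esym/eqP; rewrite (negbTE kw).
rewrite ge0_integral_sum//; last 2 first.
- move=> k; apply: emeasurable_funM; last exact: (group_measurable_fun mS (msq k)).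
  by apply/measurable_EFinP; exact: measurable_indic.
- by move=> k w _; rewrite -EFinM lee_fin mulr_ge0// sqr_ge0.
apply: eq_bigr => k _; apply: (group_indic mS IS TS indS dis).
- by apply: measurable_output; rewrite inE.
- exact: msq.
- by move=> w; rewrite lee_fin sqr_ge0.
Qed.

Hypothesis Prho : forall k : 'I_T,
  P (rho @^-1` [set k]) = (weight k / \sum_(l < T) weight l)%:E.
Hypothesis W0 : \sum_(k < T) weight k != 0.

Lemma mean_output_le :
  (\int[P]_w (sqgrad (rho w) (x_ (rho w) w))%:E <=
   (4 / (\sum_(k < T) weight k) * (Phi x1 - Phistar + \sum_(k < T) step_error k))%:E)%E.
Proof.
rewrite mean_output_mixture; set W := \sum_(k < T) weight k.
have w0 (k : 'I_T) : 0 <= weight k by exact: (step_weight_ge0 L0 p01 (a0 k) (aL k)).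
have Wge0 : 0 <= W by apply: sumr_ge0 => k _.
have I0 k : (0 <= mean_sqr_ggrad k)%E.
  by apply: integral_ge0 => w _; rewrite lee_fin sqr_ge0.
have gT : (0 <= mean_gap T)%E.
  apply: integral_ge0 => w _; rewrite lee_fin subr_ge0; apply: Phi_ge.
  exact: zsbmd_in.
(* The output probability is [(4 / W) * (weight k / 4)], which reproduces the coefficients of the
   telescoped sum; the final gap is nonnegative and is dropped. *)
rewrite EFinM (eq_bigr (fun k : 'I_T => (4 / W)%:E * ((weight k / 4)%:E * mean_sqr_ggrad k))%E); last first.
  move=> k _; rewrite Prho -/W muleA -EFinM; congr (_%:E * _)%E.
  by rewrite mulrACA -[X in _ = _ * X]invfM; field; exact: W0.
rewrite -ge0_sume_distrr; last by move=> k _; rewrite mule_ge0// lee_fin divr_ge0.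
apply: lee_wpmul2l; first by rewrite lee_fin divr_ge0.
apply: le_trans (mean_telescope (leqnn T)).
by rewrite leeDr.
Qed.

End run.

(** * The bound on the generalized gradient at the output *)

Theorem theorem3 (R : realType) (b : nat) (n_ : 'I_b.+1 -> nat)
  (* the problem *)
  (dX : measure_display) (Xi : measurableType dX) (Q : probability Xi R)
  (F : 'cV[R]_(\sum_s n_ s) -> Xi -> R) (f : 'cV[R]_(\sum_s n_ s) -> R)
  (X : forall s, set 'cV[R]_(n_ s)) (chi phi : forall s, 'cV[R]_(n_ s) -> R)
  (Phistar mu Phimustar : R)
  (* the constants of the assumptions *)
  (sigma Lf M : R) (L : 'I_b.+1 -> R)
  (* the method *)
  (d : measure_display) (Omega : measurableType d) (P : probability Omega R)
  (T : nat) (alpha : nat -> R) (N : nat -> nat) (p : 'I_b.+1 -> R)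
  (x1 : 'cV[R]_(\sum_s n_ s))
  (i : nat -> Omega -> 'I_b.+1)
  (xi : nat -> nat -> {RV P >-> Xi})
  (u : nat -> nat -> {RV P >-> (\sum_s n_ s).-tuple R})
  (rho : Omega -> 'I_T) :
  let XX := block_prod X in
  let n := (\sum_s n_ s)%N in
  let weight := fun k : nat =>
    alpha k * bmin (fun s => p s * (1 - L s / 2 * alpha k)) in
  let sigmat2 :=
    4 * (n%:R + 4) * (2 * M ^+ 2 + sigma ^+ 2 + mu ^+ 2 * Lf ^+ 2 * (n%:R + 4) ^+ 2) in
  let x := fun k w => zsbmd X phi chi F mu alpha N i xi u x1 k w in
  (* structure of the problem *)
  measurable_fun setT
    (fun z : n.-tuple R * Xi => F (tcol z.1) z.2) ->
  (forall s, closed (X s)) -> (forall s, convex_set (X s)) ->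
  (forall s, closed_convex (@chi s)) ->
  (forall s y, differentiable (@phi s) y) ->
  (forall s, strongly_convex1 (@phi s)) ->
  is_min XX (composite f chi) Phistar ->
  is_min XX (composite (gsmooth mu f) chi) Phimustar ->
  (* assumptions *)
  0 < Lf -> (forall s, 0 < L s) ->
  assumption1 Q F f XX sigma ->
  assumption2 Q F Lf L ->
  assumption3 f XX M ->
  (* parameters of the method *)
  XX x1 -> 0 < mu ->
  (forall k : 'I_T, (1 <= N k)%N) ->
  (forall s, 0 <= p s <= 1) -> \sum_s p s = 1 ->
  (forall (k : 'I_T) s, 0 < alpha k <= 2 / L s) ->
  \sum_(k < T) weight k != 0 ->
  method_randomness N i xi u rho Q p
    (fun k => weight k / \sum_(l < T) weight l) ->
  ('E_P[fun w => (let xR := x (rho w) w in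
                  enorm (ggrad X phi chi xR (grad f xR) (alpha (rho w))) ^+ 2)%R]
   <= ((4 * (composite (gsmooth mu f) chi x1 - Phimustar)
        + 8 * bmax p * sigmat2 * \sum_(k < T) (alpha k / (N k)%:R))
       / (\sum_(k < T) weight k)
       + mu ^+ 2 / 2 * Lf ^+ 2 * (n%:R + 3) ^+ 3)%:E)%E.
Proof.
move=> XX n weight sigmat2 x mF cX sX cchi dphi sphi _ [xm [Xxm xm_min] <-] Lf0 L0.
move=> [df Ff gradFf varF] A2 gradM Xx1 mu0 N1 p01 sp1 aL W0 [mi law_xi law_u mrho indS].
(* The almost sure Lipschitz bounds on [F] pass to [f], here with the identity matrix and next with
   the block projections. *)
have Lip y z : enorm (grad f y - grad f z) <= Lf * enorm (y - z).
  rewrite -[grad f y]mul1mx -[grad f z]mul1mx.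
  apply: (mean_grad_lipschitz gradFf); first by rewrite mulr_ge0 ?enorm_ge0// ltW.
  by apply: filterS A2 => zeta [_ H _]; rewrite !mul1mx.
have blkLip s y (h : 'cV[R]_(n_ s)) :
    enorm (blk s (grad f (y + Umx n_ s *m h)) - blk s (grad f y)) <= L s * enorm h.
  apply: (mean_grad_lipschitz gradFf); first by rewrite mulr_ge0 ?enorm_ge0// ltW.
  by apply: filterS A2 => zeta [_ _]; apply.
have LipF : {ae Q, forall z, (forall y, differentiable (F ^~ z) y) /\
    forall y y', enorm (grad (F ^~ z) y - grad (F ^~ z) y') <= Lf * enorm (y - y')}.
  by apply: filterS A2 => zeta [].
have a0 (k : 'I_T) : 0 < alpha k by case/andP: (aL k ord0).
have aL' (k : 'I_T) s : alpha k <= 2 / L s by case/andP: (aL k s).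
rewrite unlock; apply: le_trans.
  apply: (mean_output_le (L := L) (p := p) mF cX (fun s => convex_set_segment (@sX s)) cchi dphi sphi xm_min
    Lf0 L0 mu0 df Lip blkLip Ff gradFf varF LipF gradM Xx1 N1 p01 sp1 a0 aL' _ _
    law_xi law_u _ indS _ W0) => //.
  - by move=> k s; case: (mi k s).
  - by move=> k s; case: (mi k s).
  - by move=> k; case: (mrho k).
  - by move=> k; case: (mrho k).
rewrite lee_fin /step_error big_split/= -!mulr_suml -/n -/sigmat2.
have -> : \sum_(k < T) 2 * alpha k * bmax p * (sigmat2 / (N k)%:R) =
    2 * bmax p * sigmat2 * \sum_(k < T) (alpha k / (N k)%:R).
  by rewrite mulr_sumr; apply: eq_bigr => k _; ring.
rewrite -[\sum_(k < T) step_weight _ _ _]/(\sum_(k < T) weight k).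
set W := \sum_(k < T) weight k in W0 *; set S := \sum_(k < T) (alpha k / _).
set D := composite _ _ x1 - _.
have -> : 4 / W * (D + (W / 2 * (Lf ^+ 2 * mu ^+ 2 * n%:R) + 2 * bmax p * sigmat2 * S)) =
    (4 * D + 8 * bmax p * sigmat2 * S) / W + mu ^+ 2 / 2 * Lf ^+ 2 * (4 * n%:R).
  by field; exact: W0.
rewrite lerD2l ler_wpM2l//; first by rewrite mulr_ge0 ?sqr_ge0// divr_ge0// sqr_ge0.
have n0 : 0 <= n%:R :> R by [].
by move: n0; set r : R := n%:R => r0; nra.
Qed.
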